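(* Consider an $L$-layer CNN (as defined in the context). Let $\tau:\mathbb{R}^2\to\mathbb{R}^2$ be $C^2$ with $|\nabla\tau|_\infty:=\sup_u\|\nabla\tau(u)\|<\frac15$ (operator norm), let $\rho(u)=u-\tau(u)$, and let $D_\tau x(u,\lambda)=x(\rho(u),\lambda)$. Suppose the nonlinearity $\sigma:\mathbb{R}\to\mathbb{R}$ is non-expansive, i.e. $|\sigma(s)-\sigma(t)|\le|s-t|$ for all $s,t$. Suppose moreover that for all $l=1,\dots,L$ the constants $$B_l := \max\Big\{ \sup_{\lambda} \sum_{\lambda'=1}^{M_{l-1}} \| W^{(l)}_{\lambda',\lambda}\|_1,\ \sup_{\lambda'} \frac{M_{l-1}}{M_l}\sum_{\lambda=1}^{M_l}\| W^{(l)}_{\lambda',\lambda}\|_1 \Big\},$$ $$C_l := \max\Big\{ \sup_{\lambda} \sum_{\lambda'=1}^{M_{l-1}} \big\| |v||\nabla W^{(l)}_{\lambda',\lambda}(v)|\big\|_1,\ \sup_{\lambda'} \frac{M_{l-1}}{M_l}\sum_{\lambda=1}^{M_l}\big\| |v||\nabla W^{(l)}_{\lambda',\lambda}(v)|\big\|_1 \Big\}$$ are less than $1$. Then $$\big\|D_\tau x^{(L)}[x^{(0)}]-x^{(L)}[D_\tau x^{(0)}]\big\|\le 8L\,|\nabla\tau|_\infty\,\|x^{(0)}\|.$$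
   Context: Write $[M]=\{1,\dots,M\}$. A CNN with $L$ layers and channel numbers $M_0,\dots,M_L\ge1$ maps an input $x^{(0)}(u,\lambda)$, $u\in\mathbb{R}^2$, $\lambda\in[M_0]$ (real-valued, square-integrable in $u$), to $x^{(L)}(u,\lambda)$, $u\in\mathbb{R}^2,\lambda\in[M_L]$, recursively for $l=1,\dots,L$ by $$x^{(l)}(u,\lambda)=\sigma\Big(\sum_{\lambda'=1}^{M_{l-1}}\int_{\mathbb{R}^2}W^{(l)}_{\lambda',\lambda}(v')\,x^{(l-1)}(u+v',\lambda')\,dv'+b^{(l)}(\lambda)\Big),$$ with filters $W^{(l)}_{\lambda',\lambda}:\mathbb{R}^2\to\mathbb{R}$ and biases $b^{(l)}(\lambda)\in\mathbb{R}$. The filters are compactly supported and integrable with integrable (weak) gradient $\nabla W^{(l)}_{\lambda',\lambda}$ on $\mathbb{R}^2$. $x^{(L)}[x^{(0)}]$ denotes the output of the $L$-layer network with input $x^{(0)}$. Suprema over $\lambda$ are over $[M_l]$ and over $\lambda'$ are over $[M_{l-1}]$. Here $\|f\|_1=\int_{\mathbb{R}^2}|f(u)|du$ and $\||v||\nabla W(v)|\|_1=\int_{\mathbb{R}^2}|v||\nabla W(v)|dv$. For a function $x(u,\lambda)$, $u\in\mathbb{R}^2$, $\lambda\in[M]$, the norm is $$\|x\|^2=\frac1M\sum_{\lambda\in[M]}\frac1{|\Omega|}\int_{\mathbb{R}^2}|x(u,\lambda)|^2du,$$ where $|\Omega|=(2\cdot2^J)^2$ is the area of the image-support domain $\Omega$,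 a fixed square of side $2\cdot 2^J$ (the same for all layers). *)

(* Defs.v *)
From HB Require Import structures.
From mathcomp Require Import all_boot all_order all_algebra.
From mathcomp Require Import all_classical all_reals all_analysis.

Set Implicit Arguments.
Unset Strict Implicit.
Unset Printing Implicit Defensive.

Import Order.TTheory GRing.Theory Num.Theory.
Import numFieldNormedType.Exports.

Local Open Scope classical_set_scope.
Local Open Scope ring_scope.

(* The library norm on a product type is the max norm, so the Euclidean norm  *)
(* of the plane R * R is introduced separately.                               *)
Definition eucl (R : realType) (v : R * R) : R :=
  Num.sqrt (v.1 ^+ 2 + v.2 ^+ 2).

Definition leb2 (R : realType) :
    {measure set (measurableTypeR R * measurableTypeR R) -> \bar R} :=
  ((@lebesgue_measure R) \x (@lebesgue_measure R))%E.
Arguments leb2 : clear implicits.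

(* In finite dimension, a differentiable map all of whose directional         *)
(* derivatives are of class C^k is a map of class C^(k+1).                    *)
Fixpoint Ck (R : realType) (V : normedModType R) (k : nat) (f : R * R -> V)
    : Prop :=
  match k with
  | 0 => continuous f
  | k'.+1 => (forall x, differentiable f x) /\
             (forall v : R * R, Ck k' (fun x => 'D_v f x))
  end.

Definition compactly_supported (R : realType) (f : R * R -> R) : Prop :=
  compact (closure [set v | f v != 0]).

Definition test_function (R : realType) (phi : R * R -> R) : Prop :=
  compactly_supported phi /\ forall k, Ck k phi.

Definition weak_gradient (R : realType) (W : R * R -> R) (dW : R * R -> R * R)
    : Prop :=
  forall phi : R * R -> R, test_function phi ->
    \int[leb2 R]_v (W v * 'D_((1, 0) : R * R) phi v) =
      - (\int[leb2 R]_v ((dW v).1 * phi v)) /\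
    \int[leb2 R]_v (W v * 'D_((0, 1) : R * R) phi v) =
      - (\int[leb2 R]_v ((dW v).2 * phi v)).

(* dW is a representative of the weak gradient of W, which is unique up to a  *)
(* null set.                                                                  *)
Definition cnn_filter (R : realType) (W : R * R -> R) (dW : R * R -> R * R)
    : Prop :=
  [/\ compactly_supported W,
      (leb2 R).-integrable setT (fun v => (W v)%:E),
      weak_gradient W dW,
      (leb2 R).-integrable setT (fun v => (dW v).1%:E) &
      (leb2 R).-integrable setT (fun v => (dW v).2%:E)].

Definition layer (R : realType) (sigma : R -> R) (m n : nat)
    (W : 'I_m -> 'I_n -> R * R -> R) (b : 'I_n -> R)
    (x : 'I_m -> R * R -> R) : 'I_n -> R * R -> R :=
  fun lam u => sigma ((\sum_(lam' < m) \int[leb2 R]_v' (W lam' lam v' * x lam' (u + v')))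
               + b lam).

(* Layers are indexed from 0: W l and b l are the filters and biases of the   *)
(* (l+1)-st layer, which goes from M l to M l.+1 channels.                    *)
Fixpoint cnn (R : realType) (sigma : R -> R) (M : nat -> nat)
    (W : forall l, 'I_(M l) -> 'I_(M l.+1) -> R * R -> R)
    (b : forall l, 'I_(M l.+1) -> R) (L : nat) (x0 : 'I_(M 0%N) -> R * R -> R)
    : 'I_(M L) -> R * R -> R :=
  match L with
  | 0 => x0
  | l.+1 => layer sigma (@W l) (@b l) (@cnn R sigma M W b l x0)
  end.
Arguments cnn {R} sigma {M} W b L x0.

Definition deform (R : realType) (tau : R * R -> R * R) (m : nat)
    (x : 'I_m -> R * R -> R) : 'I_m -> R * R -> R :=
  fun lam u => x lam (u - tau u).

(* All norms and suprema below take values in the extended reals, so that an  *)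
(* unbounded supremum or a divergent integral is +oo and not a default value. *)
Definition op_norm (R : realType) (f : R * R -> R * R) : \bar R :=
  ereal_sup [set (eucl (f v))%:E | v in [set v : R * R | eucl v <= 1]].

Definition grad_sup (R : realType) (tau : R * R -> R * R) : \bar R :=
  ereal_sup (range (fun u : R * R => op_norm ('d tau u))).

Definition L1norm (R : realType) (f : R * R -> R) : \bar R :=
  (\int[leb2 R]_u `|f u|%:E)%E.

Definition chan_norm (R : realType) (J : R) (m : nat)
    (x : 'I_m -> R * R -> R) : \bar R :=
  sqrte (((m%:R)^-1)%:E * \sum_(lam < m)
    ((((2 * 2 `^ J) ^+ 2)^-1)%:E *
       \int[leb2 R]_u (`|x lam u| ^+ 2)%:E))%E.

(* The common shape of the constants B_l and C_l, for a matrix of norms       *)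
(* N lam' lam.                                                                *)
Definition schur_const (R : realType) (m n : nat)
    (N : 'I_m -> 'I_n -> \bar R) : \bar R :=
  maxe (ereal_sup (range (fun lam : 'I_n => (\sum_(lam' < m) N lam' lam)%E)))
       (ereal_sup (range (fun lam' : 'I_m =>
          ((m%:R / n%:R)%:E * \sum_(lam < n) N lam' lam)%E))).

Definition Bconst (R : realType) (m n : nat)
    (W : 'I_m -> 'I_n -> R * R -> R) : \bar R :=
  schur_const (fun lam' lam => L1norm (W lam' lam)).

Definition Cconst (R : realType) (m n : nat)
    (dW : 'I_m -> 'I_n -> R * R -> R * R) : \bar R :=
  schur_const (fun lam' lam =>
    L1norm (fun v => eucl v * eucl (dW lam' lam v))).

(* Main.v *)
Require Import Defs.
From HB Require Import structures.
From mathcomp Require Import all_boot all_order all_algebra.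
From mathcomp Require Import all_classical all_reals all_analysis.
From mathcomp Require Import measurable_realfun ring lra.

(* Subtracting the response to the input 0, which is constant on the plane, reduces    *)
(* everything to L^2. After the substitution z = rho z' the commutator of one layer     *)
(* with the deformation is dominated by an integral operator whose kernel is            *)
(*   |W (rho z - rho u) - W (z - u)| J z + |W (z - u)| |J z - 1|,                       *)
(* J being the Jacobian of rho. For fixed u or z the first term is an increment         *)
(* W (v - delta v) - W v with delta v = O(|grad tau| |v|). Since a filter with an       *)
(* integrable weak gradient is absolutely continuous along almost all lines, moving     *)
(* one coordinate after the other bounds its L^1 norm by 16/5 |grad tau| C_l. Schur's   *)
(* test with weight J on the column side then bounds the commutator by                  *)
(* 7 |grad tau|. Each layer is non-expansive by Schur's test as B_l <= 1, so the errors *)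
(* of the layers add up to at most 7 L + 1/2 <= 8 L.                                    *)

Set Implicit Arguments.
Unset Strict Implicit.
Unset Printing Implicit Defensive.

Import Order.TTheory GRing.Theory Num.Theory.
Import numFieldNormedType.Exports.

Local Open Scope classical_set_scope.
Local Open Scope ring_scope.

(** * Integration on the plane and changes of variables *)

(** Let [e] be a positive bound of the gradient of [tau] with [5 * e < 1], let [rho v = v - tau v],
    and let [J] be the Jacobian of [rho]. Since [J] stays within 11/5 e of 1, [rho] is an admissible
    change of variables ([ge0_integral_contraction]), and null sets pull back to null sets
    ([ae_contraction]).

    One layer: substituting [rho z - rho u] in one correlation and [z - u] in the other bounds the
    commutator with the deformation by an integral operator acting on [x \o rho]
    ([deform_correl_diff]). Its kernel is small in rows and in columns because displacing the
    argument of a filter by at most e |v| changes the filter by at most 16/5 e C in the L^1 norm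
    ([increment_bound]). This rests on [ac_representation]: integrating by parts against smooth
    bumps that tend to rectangles shows that a filter is, at almost every point, the integral of its
    weak partial derivative along the half-line ending there. An increment along an axis is then an
    integral of the derivative over a segment, and Tonelli's theorem with the change of variables
    handles each position on the segment separately. Schur's test ([schur_ae]) turns the row and
    column bounds into [layer_deform_error]: the squared error is at most (7 e)^2 times the squared
    norm of the input, up to a ratio of channel numbers that the normalization of the norm absorbs.

    The network: the error after one more layer is the commutator of that layer plus the difference
    of its responses to two inputs that differ by the previous error. A layer does not expand
    differences ([layer_nonexpansive]), nor does the network expand its input ([cnn_energy]), so the
    errors add up linearly in the depth ([cnn_deform_energy]).

    Two points need care. Biases make the outputs square integrable only after subtraction of the
    response to 0, a constant on the plane and therefore unaffected by a deformation. And a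
    vanishing gradient is reached by letting the positive bound [e] tend to 0. *)

Section plane_measurability.
Context {R : realType}.
Local Notation mR := (measurableTypeR R).
Local Notation P := (mR * mR)%type.

(** Measurability on the plane refers to the product sigma-algebra, continuity to the product
    topology. They are compatible because an open set is a countable union of squares with rational
    centres and radii 1/(n+1). *)
Lemma open_measurable2 (U : set (R * R)) : open U -> measurable (U : set P).
Proof.
move=> oU.
pose box (p q : rat) (n : nat) : set P :=
  (ball (ratr p : R) (n.+1%:R^-1 : R) `*` ball (ratr q : R) (n.+1%:R^-1 : R)).
have -> : (U : set P) = \bigcup_p \bigcup_q \bigcup_n
    (if `[< box p q n `<=` U >] then box p q n else set0).
  apply/seteqP; split => [[x y] Uxy|z [p _ [q _ [n _]]]]; last first.
    by case: ifPn => // /asboolP sub /sub.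
  move: oU; rewrite openE => /(_ _ Uxy) /nbhs_ballP [e /= e0 eU].
  have [n ne] : exists n : nat, (n.+1%:R^-1 : R) < e / 2.
    have e20 : 0 < e / 2 by rewrite divr_gt0.
    exists (Num.truncn (e / 2)^-1).
    by rewrite invf_plt ?posrE// truncnS_gt.
  have : (0 : R) < n.+1%:R^-1 by rewrite invr_gt0.
  move: ne (erefl (n.+1%:R^-1 : R)); move: {1 2 4}(n.+1%:R^-1 : R) => r re rn r0.
  have [p /= pI] := @rat_in_itvoo R (x - r) (x + r) ltac:(lra).
  have [q /= qI] := @rat_in_itvoo R (y - r) (y + r) ltac:(lra).
  exists p => //; exists q => //; exists n => //.
  move: pI qI; rewrite !in_itv/= => /andP[p1 p2] /andP[q1 q2].
  case: ifPn => [_|/asboolP nb].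
    by split; rewrite /ball/= -rn ltr_norml; apply/andP; split; lra.
  exfalso; apply: nb => -[x' y'] [/= /= bx by_]; apply: eU.
  move: bx by_; rewrite /ball/= -rn !ltr_norml => /andP[? ?] /andP[? ?].
  by split; rewrite /= /ball/= ltr_norml; apply/andP; split; lra.
apply: bigcupT_measurable_rat => p; apply: bigcupT_measurable_rat => q.
apply: bigcupT_measurable => n; case: ifPn => // _.
by apply: measurableX; apply: open_measurable; exact: ball_open.
Qed.

Lemma continuous_measurable2 (f : R * R -> R) :
  continuous f -> measurable_fun setT (f : P -> mR).
Proof.
move=> /continuousP cf; apply: (measurability _ (RGenOpens.measurableE R)).
move=> _ [_ [a [b ->] <-]]; rewrite setTI; apply: open_measurable2.
exact/cf/interval_open.
Qed.

End plane_measurability.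

Section density.
Context d (T : measurableType d) (R : realType) (m : {measure set T -> \bar R}).
Local Open Scope ereal_scope.
Variable g : T -> \bar R.

(* The absolute value makes this a measure for every measurable [g]. *)
Definition density (A : set T) : \bar R := \int[m]_(t in A) `|g t|.

Hypothesis mg : measurable_fun setT g.

Let density0 : density set0 = 0. Proof. exact: integral_set0. Qed.
Let density_ge0 A : 0 <= density A. Proof. exact: integral_ge0. Qed.
Let density_sigma_additive : semi_sigma_additive density.
Proof.
by apply: semi_sigma_additive_nng_induced => //; exact: measurableT_comp.
Qed.

Let density_mixin := isMeasure.Build _ _ _ density
  density0 density_ge0 density_sigma_additive.
Definition density_measure : {measure set T -> \bar R} :=
  HB.pack density density_mixin.

End density.

Section integral_density.
Context d (T : measurableType d) (R : realType) (m : {measure set T -> \bar R}).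
Local Open Scope ereal_scope.
Variable g : T -> R.
Hypothesis mg : measurable_fun setT (EFin \o g).

Import HBNNSimple.

(** Definition of the measure for indicators, linearity for simple functions, monotone convergence
    in general. *)
Lemma ge0_integral_density (f : T -> \bar R) :
  measurable_fun setT f -> (forall x, 0 <= f x) ->
  \int[density_measure m mg]_x f x = \int[m]_x (f x * `|g x|%:E).
Proof.
move=> mf f0; pose f_ := nnsfun_approx measurableT mf.
have mg' : measurable_fun setT (fun x => `|g x|%:E).
  exact: (measurableT_comp (@abse_measurable R setT) mg).
transitivity (limn (fun n => \int[density_measure m mg]_x (f_ n x)%:E)).
  rewrite -monotone_convergence//.
  - by apply: eq_integral => y _; apply/esym/cvg_lim => //; exact: cvg_nnsfun_approx.
  - by move=> n; exact/measurable_EFinP/measurable_funP.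
  - by move=> n y _; rewrite lee_fin.
  - by move=> y _ p q pq; rewrite lee_fin; exact/lefP/nd_nnsfun_approx.
transitivity (limn (fun n => \int[m]_x ((f_ n x)%:E * `|g x|%:E))); last first.
  rewrite -monotone_convergence//; last 3 first.
  - move=> n; apply: emeasurable_funM => //.
    exact/measurable_EFinP/measurable_funP.
  - by move=> n y _; rewrite mule_ge0// lee_fin.
  - move=> y _ p q pq; rewrite lee_wpmul2r// lee_fin//.
    exact/lefP/nd_nnsfun_approx.
  apply: eq_integral => y _; apply/cvg_lim => //.
  by apply: cvgeZr => //; exact: cvg_nnsfun_approx.
congr (limn _); apply/funext => n.
under eq_integral do rewrite fimfunE -fsumEFin//.
rewrite ge0_integral_fsum//; last 2 first.
- by move=> y; exact/measurable_EFinP/measurable_funM.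
- by move=> y x _; rewrite nnfun_muleindic_ge0.
transitivity (\int[m]_x (\sum_(y \in range (f_ n))
    ((y * \1_(f_ n @^-1` [set y]) x)%:E * `|g x|%:E))); last first.
  apply: eq_integral => x _; rewrite fimfunE -fsumEFin// ge0_mule_fsuml//.
  by move=> y; rewrite nnfun_muleindic_ge0.
rewrite ge0_integral_fsum//; last 2 first.
- move=> y; apply: emeasurable_funM => //.
  exact/measurable_EFinP/measurable_funM.
- by move=> y x _; rewrite mule_ge0// nnfun_muleindic_ge0.
apply: eq_fsbigr => r _; rewrite integralZl_indic_nnsfun// integral_indic//= setIT.
have [r0|r0] := leP 0%R r.
  under [in RHS]eq_integral do rewrite EFinM -muleA.
  rewrite ge0_integralZl_EFin//; last first.
  - apply: emeasurable_funM => //; exact/measurable_EFinP.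
  rewrite /density [X in r%:E * X = _]integral_mkcond; congr (r%:E * _).
  by apply: eq_integral => x _; rewrite patchE/= indicE; case: ifPn => _; rewrite ?mul1e ?mul0e.
(* A negative [r] is not a value of a nonnegative simple function, so both sides vanish. *)
rewrite preimage_nnfun0// /density integral_set0 mule0 integral0_eq// => x _.
by rewrite indic0/= mulr0 mul0e.
Qed.

End integral_density.

Section substitution_line.
Context {R : realType}.
Local Notation mR := (measurableTypeR R).
Local Notation mu := (@lebesgue_measure R).

Lemma is_derive_continuous (f df : R -> R) :
  (forall x : R, is_derive x 1 f (df x)) -> continuous f.
Proof.
move=> fdf x; apply: differentiable_continuous; apply/derivable1_diffP.
by have [] := fdf x.
Qed.

Lemma MVT_line (f df : R -> R) (a b : R) : (forall x : R, is_derive x 1 f (df x)) ->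
  a <= b -> exists2 c, a <= c <= b & f b - f a = df c * (b - a).
Proof.
move=> fdf ab.
have [|c] := @MVT_segment R f df a b ab (fun x _ => fdf x).
  by apply: continuous_subspaceT; exact: is_derive_continuous fdf.
by rewrite in_itv/= => acb fE; exists c.
Qed.

Variables (phi dphi : R -> R) (c : R).
Hypotheses (c0 : 0 < c) (phiE : forall x : R, is_derive x 1 phi (dphi x)).
Hypotheses (cdphi : continuous dphi) (dphi_ge : forall x, c <= dphi x).

Lemma expanding_ge x y : x <= y -> c * (y - x) <= phi y - phi x.
Proof.
move=> xy; have [z _ ->] := MVT_line phiE xy.
by rewrite ler_wpM2r// subr_ge0.
Qed.

Lemma expanding_lt x y : (phi x < phi y) = (x < y).
Proof.
apply/idP/idP => [|xy].
  apply: contraTT; rewrite -!leNgt => yx.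
  by have := expanding_ge yx; have := c0; nra.
by have := expanding_ge (ltW xy); have := c0; nra.
Qed.

Lemma expanding_le x y : (phi x <= phi y) = (x <= y).
Proof. by rewrite !leNgt expanding_lt. Qed.

Lemma expanding_surj y : exists x, phi x = y.
Proof.
(* Growth at rate at least [c] carries [phi] past [y] within distance [r] of 0, on the right or on
   the left, so the intermediate value theorem applies on [[- r, r]]. *)
pose r := `|y - phi 0| / c.
have r0 : 0 <= r by rewrite divr_ge0// ltW.
have rc : c * r = `|y - phi 0| by rewrite /r mulrC divfK// gt_eqF.
have h1 := @expanding_ge 0 r r0.
have h2 := @expanding_ge (- r) 0 ltac:(lra).
have [] := @IVT R phi (- r) r y ltac:(lra).
- by apply: continuous_subspaceT; exact: is_derive_continuous phiE.
- have := ler_norm (y - phi 0); have := ler_norm (- (y - phi 0)); rewrite normrN => n1 n2.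
  by rewrite ge_min le_max; apply/andP; split; apply/orP; [left|right]; lra.
- by move=> x _ <-; exists x.
Qed.

Let mphi : measurable_fun setT (phi : mR -> mR).
Proof. by apply: continuous_measurable_fun; exact: is_derive_continuous phiE. Qed.

Let mdphi : measurable_fun setT (dphi : mR -> mR).
Proof. exact: continuous_measurable_fun. Qed.

Lemma integral_expanding_itv (a b : R) : a <= b ->
  (\int[mu]_(x in `]a, b]) (dphi x)%:E = (phi b - phi a)%:E)%E.
Proof.
rewrite le_eqVlt => /predU1P[<-|ab].
  by rewrite set_itv_ge ?bnd_simp ?ltxx// integral_set0 subrr.
rewrite integral_itv_obnd_cbnd; last by apply/measurable_EFinP/measurable_funTS.
rewrite (@continuous_FTC2 _ _ phi)//.
- exact: continuous_subspaceT.
- have cphi := is_derive_continuous phiE; split.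
  + by move=> x _; have [] := phiE x.
  + by apply: cvg_at_right_filter; exact: cphi.
  + by apply: cvg_at_left_filter; exact: cphi.
- by move=> x _; rewrite derive1E; have [_] := phiE x.
Qed.

(** By the fundamental theorem of calculus, the image under [phi] of the measure with density [dphi]
    gives []a, b]] the mass [b - a]; by uniqueness it is Lebesgue measure. *)
Lemma ge0_integral_expanding (f : R -> \bar R) :
  measurable_fun setT (f : mR -> \bar R) -> (forall x, 0 <= f x)%E ->
  (\int[mu]_x f x = \int[mu]_x (f (phi x) * (dphi x)%:E))%E.
Proof.
move=> mf f0.
have mdphi' : measurable_fun setT (EFin \o (dphi : mR -> mR)) by exact/measurable_EFinP.
pose dm := density_measure mu mdphi'.
unshelve epose (pm := pushforward dm (phi : mR -> mR) : {measure set mR -> \bar R}).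
  exact: mphi.
have muE A : measurable A -> mu A = pm A.
  apply: lebesgue_measure_unique => _ [[a b] _ <-] /=.
  have [ab|ba] := leP a b; last first.
    rewrite set_itv_ge; last by rewrite bnd_simp -leNgt ltW.
    by rewrite measure0 -(measure0 pm).
  have [x xa] := expanding_surj a; have [y yb] := expanding_surj b.
  have xy : x <= y by rewrite -expanding_le xa yb.
  rewrite /pushforward/=.
  have -> : (phi @^-1` `]a, b] = `]x, y])%classic.
    by apply/seteqP; split => z /=; rewrite !in_itv/= -xa -yb expanding_lt expanding_le.
  rewrite /density.
  under eq_integral do rewrite gee0_abs ?lee_fin ?(le_trans (ltW c0))//.
  rewrite integral_expanding_itv// xa yb lebesgue_measure_itv/= lte_fin.
  by case: ltP => // ba; rewrite (_ : b = a) ?subrr//; lra.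
rewrite (@eq_measure_integral _ _ _ _ pm) => [|A mA _]; last exact: muE.
rewrite (ge0_integral_pushforward mphi)//= ge0_integral_density//=.
- by apply: eq_integral => x _; rewrite ger0_norm ?(le_trans (ltW c0)).
- exact: measurableT_comp.
Qed.

End substitution_line.

Section tonelli_plane.
Context {R : realType}.
Local Notation mR := (measurableTypeR R).
Local Notation P := (mR * mR)%type.
Local Notation mu := (@lebesgue_measure R).
Local Open Scope ereal_scope.
Variable f : P -> \bar R.
Hypotheses (mf : measurable_fun setT f) (f0 : forall x, 0 <= f x).

Lemma integral_plane12 : \int[leb2 R]_v f v = \int[mu]_x \int[mu]_y f (x, y).
Proof. exact: (@fubini_tonelli1 _ _ _ _ _ mu mu f). Qed.

Lemma integral_plane21 : \int[leb2 R]_v f v = \int[mu]_y \int[mu]_x f (x, y).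
Proof. exact: (@fubini_tonelli2 _ _ _ _ _ mu mu f). Qed.

End tonelli_plane.

(** * Differentiability in coordinates and the chain rule *)

Section gradient.
Context {R : realType}.

(** Total differentiability at [p] with partial derivatives [a] and [b], spelled out with the sum
    norm so that real arithmetic suffices to handle it. *)
Definition has_grad (f : R * R -> R) (a b : R) (p : R * R) : Prop :=
  forall eta : R, 0 < eta -> exists2 del : R, 0 < del &
    forall h k : R, `|h| < del -> `|k| < del ->
    `|f (p.1 + h, p.2 + k) - f p - (a * h + b * k)| <= eta * (`|h| + `|k|).

(** The difference quotient is multiplied out, so that [h = 0] needs no exclusion and the form
    matches [has_grad]. *)
Lemma is_derive_eps (f : R -> R) (x l : R) :
  (forall eta : R, 0 < eta -> exists2 del : R, 0 < del &
    forall h, `|h| < del -> `|f (x + h) - f x - l * h| <= eta * `|h|) <->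
  is_derive x 1 f l.
Proof.
split=> [H|[df <-] eta eta0].
  have D : h^-1 *: (f (h *: 1 + x) - f x) @[h --> 0^'] --> l.
    apply/cvgrPdist_le => eta eta0.
    have [del del0 Hdel] := H _ eta0.
    exists del => //= h; rewrite /ball_ /= sub0r normrN => hdel h0.
    rewrite distrC [h *: 1]mulr1 [h + x]addrC.
    rewrite [X in `|X|](_ : _ = h^-1 * (f (x + h) - f x - l * h)); last first.
      by rewrite mulrBr mulrCA mulVf// mulr1.
    by rewrite normrM normfV mulrC ler_pdivrMr ?normr_gt0// Hdel.
  by split; [apply/cvg_ex; exists l|exact: cvg_lim].
move: df => /derivableP [/cvg_ex[l' /= D] _].
have l'E : 'D_1 f x = l' by apply: cvg_lim.
rewrite l'E.
move/cvgrPdist_le : D => /(_ _ eta0) [del /= del0 Hdel].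
exists del => // h hdel; have [->|h0] := eqVneq h 0.
  by rewrite addr0 subrr mulr0 subrr normr0 mulr0.
have := Hdel h; rewrite /ball_/= sub0r normrN => /(_ hdel h0).
rewrite [h *: 1]mulr1 [h + x]addrC distrC.
rewrite [X in `|X|](_ : _ = h^-1 * (f (x + h) - f x - l' * h)); last first.
  by rewrite mulrBr mulrCA mulVf// mulr1.
by rewrite normrM normfV mulrC ler_pdivrMr// normr_gt0.
Qed.

Lemma has_grad_comp (f : R * R -> R) a b (x y : R -> R) (t dx dy : R) :
  has_grad f a b (x t, y t) -> is_derive t 1 x dx -> is_derive t 1 y dy ->
  is_derive t 1 (fun s => f (x s, y s)) (a * dx + b * dy).
Proof.
move=> gf /is_derive_eps Dx /is_derive_eps Dy; apply/is_derive_eps => eta eta0.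
(* [M] dominates the sum of all coefficients of the error terms, as well as the local Lipschitz
   constants of [x] and [y]; with tolerance [e1] the total error is at most [e1 * M * |h|]. *)
pose M := (`|a| + `|b| + `|dx| + `|dy| + 3).
have na := normr_ge0 a; have nb := normr_ge0 b.
have ndx := normr_ge0 dx; have ndy := normr_ge0 dy.
have M0 : 0 < M by rewrite /M; lra.
pose e1 := Num.min 1 (eta / (2 * M)).
have e10 : 0 < e1 by rewrite lt_min ltr01 divr_gt0// mulr_gt0.
have e11 : e1 <= 1 by rewrite ge_min lexx.
have e1M : e1 * M * 2 <= eta.
  by rewrite -mulrA [M * 2]mulrC -ler_pdivlMr ?mulr_gt0// ge_min lexx orbT.
have [d1 d10 H1] := gf _ e10.
have [d2 d20 H2] := Dx _ e10.
have [d3 d30 H3] := Dy _ e10.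
exists (Num.min (d1 / M) (Num.min d2 d3)) => [|h].
  by rewrite !lt_min d20 d30 divr_gt0.
rewrite !lt_min ltr_pdivlMr// => /and3P[hd1 hd2 hd3].
have {}H2 := H2 _ hd2; have {}H3 := H3 _ hd3.
have nh := normr_ge0 h.
pose u := x (t + h) - x t; pose v := y (t + h) - y t.
have uE : `|u| <= (`|dx| + 1) * `|h|.
  have -> : u = (x (t + h) - x t - dx * h) + dx * h by rewrite /u; ring.
  by rewrite (le_trans (ler_normD _ _))// normrM; nra.
have vE : `|v| <= (`|dy| + 1) * `|h|.
  have -> : v = (y (t + h) - y t - dy * h) + dy * h by rewrite /v; ring.
  by rewrite (le_trans (ler_normD _ _))// normrM; nra.
have ud : `|u| < d1 by apply: le_lt_trans hd1; rewrite /M; nra.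
have vd : `|v| < d1 by apply: le_lt_trans hd1; rewrite /M; nra.
have := H1 u v ud vd; rewrite /= /u /v !subrKC -/u -/v => {}H1.
set A := f _ - _ in H1 *.
have -> : A - (a * dx + b * dy) * h = (A - (a * u + b * v)) +
  (a * (x (t + h) - x t - dx * h) + b * (y (t + h) - y t - dy * h)).
  by rewrite /u /v; ring.
have nu := normr_ge0 u; have nv := normr_ge0 v.
apply: (@le_trans _ _ (e1 * (`|u| + `|v|) + (`|a| * (e1 * `|h|) + `|b| * (e1 * `|h|)))).
  rewrite (le_trans (ler_normD _ _))// lerD// (le_trans (ler_normD _ _))//.
  by rewrite !normrM lerD// ler_wpM2l.
apply: (@le_trans _ _ (e1 * M * `|h|)); first by rewrite /M; nra.
by apply: ler_wpM2r => //; nra.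
Qed.

End gradient.

(** * Change of variables for a small perturbation of the identity *)

Section contraction.
Context {R : realType}.
Local Notation mR := (measurableTypeR R).
Local Notation P := (mR * mR)%type.
Local Notation mu := (@lebesgue_measure R).

Lemma continuous_pair2 (T : topologicalType) (f g : T -> R) :
  continuous f -> continuous g -> continuous (fun v => (f v, g v)).
Proof. by move=> cf cg v; exact: (cvg_pair (cf v) (cg v)). Qed.

Lemma normr_le_sqr (x e : R) : 0 <= e -> x ^+ 2 <= e ^+ 2 -> `|x| <= e.
Proof.
by move=> e0 xe; rewrite -(@ler_pXn2r _ 2) ?nnegrE// real_normK ?num_real.
Qed.

(** All that is used of a displacement field: its gradient has rows (a, b) and (c, d), continuous
    entries and columns of norm at most [e], and the field is [e]-Lipschitz for the Euclidean norm.
    Unlike a bound on [grad_sup], this form passes at once to translated, reflected, swapped and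
    coordinatewise scaled fields. *)
Record C1_contraction (e : R) (tau : R * R -> R * R) (a b c d : R * R -> R) : Prop :=
  Contraction {
  contraction_grad1 : forall p, has_grad (fun q => (tau q).1) (a p) (b p) p ;
  contraction_grad2 : forall p, has_grad (fun q => (tau q).2) (c p) (d p) p ;
  contraction_cont : [/\ continuous a, continuous b, continuous c & continuous d] ;
  contraction_col1 : forall p, a p ^+ 2 + c p ^+ 2 <= e ^+ 2 ;
  contraction_col2 : forall p, b p ^+ 2 + d p ^+ 2 <= e ^+ 2 ;
  contraction_lip : forall p q,
    ((tau p).1 - (tau q).1) ^+ 2 + ((tau p).2 - (tau q).2) ^+ 2 <=
      e ^+ 2 * ((p.1 - q.1) ^+ 2 + (p.2 - q.2) ^+ 2) }.

Lemma lipschitz_continuous2 (f : R * R -> R) (k : R) :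
  (forall p q, `|f p - f q| <= k * (`|p.1 - q.1| + `|p.2 - q.2|)) -> continuous f.
Proof.
move=> flip p; apply/cvgrPdist_lt => eta eta0.
pose del := eta / (2 * (`|k| + 1)).
have k0 := normr_ge0 k.
have del0 : 0 < del by rewrite divr_gt0// mulr_gt0// ltr_wpDl.
exists (ball p.1 del, ball p.2 del); first by split; exact: nbhsx_ballx.
move=> q [/= q1 q2].
apply: (le_lt_trans (flip _ _)).
apply: (@le_lt_trans _ _ ((`|k| + 1) * (`|p.1 - q.1| + `|p.2 - q.2|))).
  by rewrite ler_wpM2r ?addr_ge0// (le_trans (ler_norm k))// lerDl.
rewrite -ltr_pdivlMl ?ltr_wpDl// (_ : _ * eta = del + del); first exact: ltrD.
by rewrite /del; field; lra.
Qed.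

Context (e : R) (tau : R * R -> R * R) (a b c d : R * R -> R).
Hypotheses (e0 : 0 < e) (e5 : 5 * e < 1) (tauC : C1_contraction e tau a b c d).

(** The determinant of the derivative of [v - tau v], not of [tau]. *)
Definition jacobian_det (p : R * R) : R := (1 - a p) * (1 - d p) - b p * c p.

Lemma contraction_entries p :
  [/\ `|a p| <= e, `|b p| <= e, `|c p| <= e & `|d p| <= e].
Proof.
have h1 := contraction_col1 tauC p; have h2 := contraction_col2 tauC p.
have := sqr_ge0 (a p); have := sqr_ge0 (b p).
have := sqr_ge0 (c p); have := sqr_ge0 (d p).
by split; apply: normr_le_sqr (ltW e0) _; lra.
Qed.

(** A case of Hadamard's inequality: |ad - bc| is at most half the sum of the four squares, by
    expanding the squares of a - d, b + c, a + d and b - c. *)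
Lemma contraction_det p : `|a p * d p - b p * c p| <= e ^+ 2.
Proof.
have h1 := contraction_col1 tauC p; have h2 := contraction_col2 tauC p.
have s1 := sqr_ge0 (a p - d p); have s2 := sqr_ge0 (b p + c p).
have s3 := sqr_ge0 (a p + d p); have s4 := sqr_ge0 (b p - c p).
by rewrite ler_norml; apply/andP; split; nra.
Qed.

(** The trace contributes at most 2 e and the determinant of the gradient at most e^2, which is
    below e / 5. With 5 e < 1 this gives the bounds 1 - 11/25 and 1 + 11/25 for the Jacobian. *)
Lemma jacobian_det_sub1 p : `|jacobian_det p - 1| <= 11 / 5 * e.
Proof.
have [ha hb hc hd] := contraction_entries p.
have -> : jacobian_det p - 1 = - a p - d p + (a p * d p - b p * c p).
  by rewrite /jacobian_det; ring.
rewrite (le_trans (ler_normD _ _))//.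
have := contraction_det p; have := ler_normB (- a p) (d p); rewrite normrN.
by move: ha hd e0 e5; set x := `|_ - _|; set y := `|_ - _|; nra.
Qed.

Lemma jacobian_det_bounds p : 14 / 25 <= jacobian_det p <= 36 / 25.
Proof.
have := jacobian_det_sub1 p; rewrite ler_norml => /andP[h1 h2].
by have := e5; move=> ?; apply/andP; split; lra.
Qed.

Lemma jacobian_det_gt0 p : 0 < jacobian_det p.
Proof. by have /andP[h _] := jacobian_det_bounds p; lra. Qed.

Lemma jacobian_det_continuous : continuous jacobian_det.
Proof.
have [ca cb cc cd] := contraction_cont tauC.
move=> p; apply: cvgB; apply: cvgM; [| |exact: cb|exact: cc].
- by apply: cvgB; [exact: cvg_cst|exact: ca].
- by apply: cvgB; [exact: cvg_cst|exact: cd].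
Qed.

Lemma contraction_lip1 p q :
  `|(tau p).1 - (tau q).1| <= e * (`|p.1 - q.1| + `|p.2 - q.2|).
Proof.
have h := contraction_lip tauC p q.
have n1 := normr_ge0 (p.1 - q.1); have n2 := normr_ge0 (p.2 - q.2).
apply: normr_le_sqr; first by rewrite mulr_ge0 ?addr_ge0// ltW.
have -> : (e * (`|p.1 - q.1| + `|p.2 - q.2|)) ^+ 2 =
  e ^+ 2 * (`|p.1 - q.1| ^+ 2 + `|p.2 - q.2| ^+ 2) +
  2 * e ^+ 2 * (`|p.1 - q.1| * `|p.2 - q.2|) by ring.
rewrite !real_normK ?num_real//.
have : 0 <= 2 * e ^+ 2 * (`|p.1 - q.1| * `|p.2 - q.2|).
  by apply: mulr_ge0; apply: mulr_ge0; rewrite ?sqr_ge0.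
by have := sqr_ge0 ((tau p).2 - (tau q).2); lra.
Qed.

Lemma contraction_lip2 p q :
  `|(tau p).2 - (tau q).2| <= e * (`|p.1 - q.1| + `|p.2 - q.2|).
Proof.
have h := contraction_lip tauC p q.
have n1 := normr_ge0 (p.1 - q.1); have n2 := normr_ge0 (p.2 - q.2).
apply: normr_le_sqr; first by rewrite mulr_ge0 ?addr_ge0// ltW.
have -> : (e * (`|p.1 - q.1| + `|p.2 - q.2|)) ^+ 2 =
  e ^+ 2 * (`|p.1 - q.1| ^+ 2 + `|p.2 - q.2| ^+ 2) +
  2 * e ^+ 2 * (`|p.1 - q.1| * `|p.2 - q.2|) by ring.
rewrite !real_normK ?num_real//.
have : 0 <= 2 * e ^+ 2 * (`|p.1 - q.1| * `|p.2 - q.2|).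
  by apply: mulr_ge0; apply: mulr_ge0; rewrite ?sqr_ge0.
by have := sqr_ge0 ((tau p).1 - (tau q).1); lra.
Qed.

Lemma contraction_measurable : measurable_fun setT (tau : P -> P).
Proof.
rewrite (_ : (tau : P -> P) = fun v => ((tau v).1, (tau v).2)); last first.
  by apply/funext => v; case: (tau v).
apply: measurable_fun_pair; apply: continuous_measurable2.
- exact: lipschitz_continuous2 contraction_lip1.
- exact: lipschitz_continuous2 contraction_lip2.
Qed.

Let Fder (y x : R) : is_derive x 1 (fun x => x - (tau (x, y)).1) (1 - a (x, y)).
Proof.
have D : is_derive x 1 (fun x => (tau (x, y)).1) (a (x, y)).
  have -> : a (x, y) = a (x, y) * 1 + b (x, y) * 0 by rewrite mulr1 mulr0 addr0.
  apply: (@has_grad_comp _ (fun q => (tau q).1) _ _ id (cst y)).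
  exact: (contraction_grad1 tauC).
exact: is_deriveB.
Qed.

Let Fder_ge (y x : R) : 4 / 5 <= 1 - a (x, y).
Proof. by have [+ _ _ _] := contraction_entries (x, y); rewrite ler_norml => /andP[]; have := e5; lra. Qed.

Lemma implicit_fun_subproof (v : R * R) :
  exists x, x - (tau (x, v.2)).1 = v.1.
Proof. by apply: (expanding_surj _ (Fder v.2) (Fder_ge v.2)); lra. Qed.

(* The solution [x] of [x - tau_1 (x, y) = s]. *)
Definition implicit_fun (v : R * R) : R := projT1 (cid (implicit_fun_subproof v)).

Lemma implicit_funP s y :
  implicit_fun (s, y) - (tau (implicit_fun (s, y), y)).1 = s.
Proof. by rewrite /implicit_fun; case: cid. Qed.

Lemma implicit_funK x y : implicit_fun (x - (tau (x, y)).1, y) = x.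
Proof.
have /eqP := implicit_funP (x - (tau (x, y)).1) y.
have Fle := @expanding_le R _ _ (4 / 5) ltac:(lra) (Fder y) (Fder_ge y).
by rewrite eq_le !Fle -eq_le => /eqP.
Qed.

Lemma implicit_fun_lip p q :
  `|implicit_fun p - implicit_fun q| <= 5 / 4 * (`|p.1 - q.1| + `|p.2 - q.2|).
Proof.
case: p q => [s y] [s' y'] /=.
have h1 := implicit_funP s y; have h2 := implicit_funP s' y'.
set X := implicit_fun (s, y) in h1 *; set X' := implicit_fun (s', y') in h2 *.
have := contraction_lip1 (X, y) (X', y') => /=.
have -> : X - X' = (s - s') + ((tau (X, y)).1 - (tau (X', y')).1) by lra.
have := ler_normD (s - s') ((tau (X, y)).1 - (tau (X', y')).1).
have -> : (s - s') + ((tau (X, y)).1 - (tau (X', y')).1) = X - X' by lra.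
have := normr_ge0 (X - X'); have := normr_ge0 (s - s'); have := normr_ge0 (y - y').
by move: e0 e5; nra.
Qed.

Lemma implicit_fun_continuous : continuous implicit_fun.
Proof. exact: lipschitz_continuous2 implicit_fun_lip. Qed.

(** Implicit differentiation of [X - tau_1 (X, y) = s]. The remainder is that of [tau_1] divided by
    1 - a, which is at least 4/5; the tolerance [eta / 4] suffices because |k| + |X' - X| is at most
    9/4 |k|. *)
Let Xder (s y : R) : is_derive y 1 (fun y => implicit_fun (s, y))
  (b (implicit_fun (s, y), y) / (1 - a (implicit_fun (s, y), y))).
Proof.
apply/is_derive_eps => eta eta0.
set X := implicit_fun (s, y).
have [del del0 H] := contraction_grad1 tauC (X, y) (eta := eta / 4) ltac:(lra).
exists (del / 2) => [|k kdel]; first lra.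
have D0 := Fder_ge y X.
have h1 := implicit_funP s y; have h2 := implicit_funP s (y + k).
set X' := implicit_fun (s, y + k) in h2 *; rewrite -/X in h1.
have := implicit_fun_lip (s, y + k) (s, y); rewrite /= -/X -/X' subrr normr0 add0r.
rewrite (_ : y + k - y = k); last by ring.
move=> hX; have nk := normr_ge0 k; have nX := normr_ge0 (X' - X).
have := H (X' - X) k ltac:(lra) ltac:(lra); rewrite /= subrKC => {}H.
set A := a (X, y) in H D0 *; set B := b (X, y) in H *.
have -> : X' - X - B / (1 - A) * k =
  ((tau (X', y + k)).1 - (tau (X, y)).1 - (A * (X' - X) + B * k)) / (1 - A).
  have -> : (tau (X', y + k)).1 = X' - s by lra.
  have -> : (tau (X, y)).1 = X - s by lra.
  by field; lra.
rewrite normrM normfV (ger0_norm (_ : 0 <= 1 - A)) ?ler_pdivrMr; [|lra|lra].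
apply: (le_trans H).
have p1 : 0 <= eta * (5 / 4 * `|k| - `|X' - X|) by apply: mulr_ge0; lra.
have p2 : 0 <= eta * `|k| * (1 - A - 4 / 5).
  by apply: mulr_ge0; [apply: mulr_ge0|]; lra.
have p3 : 0 <= eta * `|k| by apply: mulr_ge0; lra.
by nra.
Qed.

(** The second coordinate of [v - tau v] along the curve on which the first one equals [s]. Its
    derivative in [y] is the Schur complement [jacobian_det / (1 - a)], bounded below by (14/25) /
    (6/5) = 7/15. *)
Let H (s y : R) := y - (tau (implicit_fun (s, y), y)).2.
Let dH (s y : R) := let p := (implicit_fun (s, y), y) in jacobian_det p / (1 - a p).

Let Hder (s y : R) : is_derive y 1 (H s) (dH s y).
Proof.
have D : is_derive y 1 (fun y => (tau (implicit_fun (s, y), y)).2)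
   (c (implicit_fun (s, y), y) *
      (b (implicit_fun (s, y), y) / (1 - a (implicit_fun (s, y), y))) +
     d (implicit_fun (s, y), y) * 1).
  apply: (@has_grad_comp _ (fun q => (tau q).2) _ _ (fun y => implicit_fun (s, y)) id).
  - exact: (contraction_grad2 tauC).
  - exact: Xder.
have D2 := is_deriveB (is_derive_id y (1 : R)) D.
apply: (is_derive_eq D2).
rewrite /dH /jacobian_det; have := Fder_ge y (implicit_fun (s, y)) => h.
by field; lra.
Qed.

Let dH_ge (s y : R) : 7 / 15 <= dH s y.
Proof.
rewrite /dH; set p := (_, y).
have /andP[h _] := jacobian_det_bounds p; have h1 := Fder_ge y (implicit_fun (s, y)).
have [ + _ _ _] := contraction_entries p; rewrite ler_norml => /andP[h2 h3].
rewrite ler_pdivlMr; last lra.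
by have := e5; rewrite /p in h h2 *; lra.
Qed.

Let dH_continuous : continuous (fun v : R * R => dH v.1 v.2).
Proof.
have [ca _ _ _] := contraction_cont tauC.
have cX : continuous (fun v : R * R => (implicit_fun (v.1, v.2), v.2)).
  apply: continuous_pair2; last by move=> v; exact: cvg_snd.
  rewrite [X in continuous X](_ : _ = implicit_fun); last by apply/funext => -[].
  exact: implicit_fun_continuous.
move=> v; apply: cvgM.
  exact: (continuous_comp (@cX v) (@jacobian_det_continuous _)).
apply: cvgV.
  by have := Fder_ge v.2 (implicit_fun (v.1, v.2)); apply: contraTneq => ->; lra.
apply: cvgB; first exact: cvg_cst.
exact: (continuous_comp (@cX v) (ca _)).
Qed.

(** Two substitutions on lines and Tonelli's theorem: for fixed [s] the second coordinate becomes
    [H s y], and then, for fixed [y], [s] becomes [x - tau_1 (x, y)]. The derivatives multiply to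
    [jacobian_det / (1 - a) * (1 - a)], and [implicit_funK] removes the implicit function. *)
Lemma ge0_integral_contraction (f : P -> \bar R) :
  measurable_fun setT f -> (forall v, 0 <= f v)%E ->
  (\int[leb2 R]_v f v = \int[leb2 R]_v (f (v - tau v)%R * (jacobian_det v)%:E))%E.
Proof.
move=> mf f0.
have mH : measurable_fun setT (fun v : P => H v.1 v.2).
  apply: measurable_funB => //.
  apply: (@measurableT_comp _ _ _ _ _ _ (fun p : P => (tau p).2)).
    by apply: measurableT_comp => //; exact: contraction_measurable.
  apply: measurable_fun_pair => //; apply: continuous_measurable2.
  rewrite [X in continuous X](_ : _ = implicit_fun); last by apply/funext => -[].
  exact: implicit_fun_continuous.
have mdH : measurable_fun setT (fun v : P => dH v.1 v.2).
  exact: continuous_measurable2.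
have mrho : measurable_fun setT (fun v : P => (v - tau v : P)%R).
  by apply: measurable_fun_pair; apply: measurable_funB => //;
    apply: measurableT_comp => //; exact: contraction_measurable.
have mJ : measurable_fun setT (jacobian_det : P -> mR).
  exact: continuous_measurable2 jacobian_det_continuous.
rewrite integral_plane12//.
transitivity (\int[mu]_s \int[mu]_y (f (s, H s y) * (dH s y)%:E))%E.
  apply: eq_integral => s _.
  rewrite (@ge0_integral_expanding _ (H s) (dH s) (7 / 15) ltac:(lra) (Hder s))//.
  - move=> y; have cs := continuous_pair2 (@cst_continuous _ _ s) (fun x : R => @cvg_id _ (nbhs x)).
    exact: (continuous_comp (cs y) (@dH_continuous _)).
  - exact: measurableT_comp.
pose g v := (f (v.1, H v.1 v.2) * (dH v.1 v.2)%:E)%E.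
have mg : measurable_fun setT (g : P -> _).
  apply: emeasurable_funM; last exact/measurable_EFinP.
  by apply: measurableT_comp => //; apply: measurable_fun_pair.
have g0 v : (0 <= g v)%E.
  by rewrite mule_ge0// lee_fin; have := dH_ge v.1 v.2; lra.
rewrite -(integral_plane12 mg g0) (integral_plane21 mg g0).
rewrite [RHS]integral_plane21; last 2 first.
- by apply: emeasurable_funM; [exact: measurableT_comp|exact/measurable_EFinP].
- by move=> v; rewrite mule_ge0// lee_fin ltW ?jacobian_det_gt0.
apply: eq_integral => y _.
rewrite (@ge0_integral_expanding _ _ (fun x => 1 - a (x, y)) (4 / 5) ltac:(lra) (Fder y))//; first last.
- exact: measurableT_comp.
- move=> x; have [ca _ _ _] := contraction_cont tauC.
  have cy := continuous_pair2 (fun x : R => @cvg_id _ (nbhs x)) (@cst_continuous _ _ y).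
  by apply: cvgB; [exact: cvg_cst|exact: (continuous_comp (cy x) (ca _))].
apply: eq_integral => x _; rewrite /g/= /H /dH implicit_funK -muleA; congr mule.
by rewrite -EFinM divfK//; have := Fder_ge y x; apply: contraTneq => ->; lra.
Qed.

End contraction.

Definition pswap (R : Type) (v : R * R) : R * R := (v.2, v.1).

Section contraction_stability.
Context {R : realType}.
Local Notation mR := (measurableTypeR R).
Local Notation P := (mR * mR)%type.

Lemma has_grad_shift (f : R * R -> R) (a b : R) (u p : R * R) (k : R) :
  has_grad f a b (u + p) -> has_grad (fun v => f (u + v) - k) a b p.
Proof.
move=> gf eta eta0; have [del del0 H] := gf eta eta0.
exists del => // h l hdel ldel; have := H h l hdel ldel.
have -> : u + (p.1 + h, p.2 + l) = ((u + p).1 + h, (u + p).2 + l).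
  by congr pair; rewrite /= addrA.
by apply: le_trans; rewrite le_eqVlt; apply/orP; left; apply/eqP; congr (`|_|); ring.
Qed.

Lemma has_gradZ (f : R * R -> R) (a b t : R) (p : R * R) :
  has_grad f a b p -> 0 <= t <= 1 -> has_grad (fun v => t * f v) (t * a) (t * b) p.
Proof.
move=> gf /andP[t0 t1] eta eta0; have [del del0 H] := gf eta eta0.
exists del => // h l hdel ldel.
have -> : t * f (p.1 + h, p.2 + l) - t * f p - (t * a * h + t * b * l) =
  t * (f (p.1 + h, p.2 + l) - f p - (a * h + b * l)) by ring.
rewrite normrM (ger0_norm t0); apply: le_trans (H h l hdel ldel).
by rewrite ler_piMl.
Qed.

Lemma has_grad_swap (f : R * R -> R) (a b : R) (p : R * R) :
  has_grad f a b (pswap p) -> has_grad (fun v => f (pswap v)) b a p.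
Proof.
move=> gf eta eta0; have [del del0 H] := gf eta eta0.
exists del => // h l hdel ldel; have := H l h ldel hdel.
by rewrite /= [`|l| + _]addrC [a * l + _]addrC.
Qed.

Lemma add_continuous2 (u : R * R) : continuous (fun v : R * R => u + v).
Proof. by move=> v; apply: cvgD; [exact: cvg_cst|exact: cvg_id]. Qed.

Lemma swap_continuous2 : continuous (@pswap R).
Proof. by apply: continuous_pair2 => v; [exact: cvg_snd|exact: cvg_fst]. Qed.

Context (e : R) (tau : R * R -> R * R) (a b c d : R * R -> R).
Hypotheses (e0 : 0 < e) (tauC : C1_contraction e tau a b c d).

(** The displacement field relative to its value at [u]; it vanishes at 0, as the increment bounds
    require. *)
Lemma contraction_shift (u : R * R) : C1_contraction e (fun v => tau (u + v) - tau u)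
  (fun v => a (u + v)) (fun v => b (u + v))
  (fun v => c (u + v)) (fun v => d (u + v)).
Proof.
have [ca cb cc cd] := contraction_cont tauC.
have cu := @add_continuous2 u.
split.
- move=> p; exact: has_grad_shift (contraction_grad1 tauC _).
- move=> p; exact: has_grad_shift (contraction_grad2 tauC _).
- split=> v; [exact: (continuous_comp (@cu v) (@ca _))|exact: (continuous_comp (@cu v) (@cb _))|
    exact: (continuous_comp (@cu v) (@cc _))|exact: (continuous_comp (@cu v) (@cd _))].
- by move=> p; exact: (contraction_col1 tauC).
- by move=> p; exact: (contraction_col2 tauC).
- move=> p q; have := contraction_lip tauC (u + p) (u + q).
  have E1 (x y z : R) : x - z - (y - z) = x - y by ring.
  have E2 (x y z : R) : z + x - (z + y) = x - y by ring.
  by rewrite /= !E1 !E2.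
Qed.

(** Serves to move one coordinate at a time: a factor [t] between 0 and 1 gives the intermediate
    positions along a segment, a factor 0 freezes a coordinate. *)
Lemma contraction_scale (t s : R) : 0 <= t <= 1 -> 0 <= s <= 1 ->
  C1_contraction e (fun v => (t * (tau v).1, s * (tau v).2))
  (fun v => t * a v) (fun v => t * b v) (fun v => s * c v) (fun v => s * d v).
Proof.
have [ca cb cc cd] := contraction_cont tauC.
move=> t01 s01.
have sq (x r : R) : 0 <= r <= 1 -> (r * x) ^+ 2 <= x ^+ 2.
  move=> /andP[r0 r1]; have p1 : 0 <= (1 - r) * (1 + r) by apply: mulr_ge0; lra.
  by have := mulr_ge0 p1 (sqr_ge0 x); lra.
split.
- by move=> p; apply: has_gradZ => //; exact: (contraction_grad1 tauC).
- by move=> p; apply: has_gradZ => //; exact: (contraction_grad2 tauC).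
- by split=> v; (apply: cvgM; first exact: cvg_cst);
    [exact: ca|exact: cb|exact: cc|exact: cd].
- by move=> p; apply: le_trans (contraction_col1 tauC p); apply: lerD; exact: sq.
- by move=> p; apply: le_trans (contraction_col2 tauC p); apply: lerD; exact: sq.
- move=> p q; apply: le_trans (contraction_lip tauC p q) => /=.
  by rewrite -!mulrBr; apply: lerD; exact: sq.
Qed.

Lemma contraction_swap : C1_contraction e (fun v => pswap (tau (pswap v)))
  (fun v => d (pswap v)) (fun v => c (pswap v)) (fun v => b (pswap v)) (fun v => a (pswap v)).
Proof.
have [ca cb cc cd] := contraction_cont tauC.
have cs := @swap_continuous2.
split.
- by move=> p; exact: has_grad_swap (contraction_grad2 tauC (pswap p)).
- by move=> p; exact: has_grad_swap (contraction_grad1 tauC (pswap p)).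
- split=> v; [exact: (continuous_comp (@cs v) (@cd _))|exact: (continuous_comp (@cs v) (@cc _))|
    exact: (continuous_comp (@cs v) (@cb _))|exact: (continuous_comp (@cs v) (@ca _))].
- by move=> p; rewrite addrC; exact: (contraction_col2 tauC).
- by move=> p; rewrite addrC; exact: (contraction_col1 tauC).
- move=> p q; rewrite addrC; apply: le_trans (contraction_lip tauC _ _) _ => /=.
  by rewrite [X in _ * X]addrC.
Qed.

End contraction_stability.

(** * Translations, reflections and null sets *)

Section plane_substitutions.
Context {R : realType}.
Local Notation mR := (measurableTypeR R).
Local Notation P := (mR * mR)%type.
Local Notation mu := (@lebesgue_measure R).
Local Open Scope ereal_scope.

(** Makes translations an instance of the change of variables; the gradient is 0, and 1/10 is just a
    number between 0 and 1/5. *)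
Lemma contraction_cst (u : R * R) : C1_contraction (10^-1)%R (cst u) (cst 0%R) (cst 0%R) (cst 0%R) (cst 0%R).
Proof.
have g x p : has_grad (cst x : R * R -> R) 0 0 p.
  move=> eta eta0; exists 1%R => // h k _ _.
  by rewrite /= subrr !mul0r addr0 subrr normr0 mulr_ge0 ?addr_ge0// ltW.
split=> [p|p||p|p|p q] /=.
- exact: g.
- exact: g.
- by split=> v; exact: cvg_cst.
- by rewrite expr0n addr0 sqr_ge0.
- by rewrite expr0n addr0 sqr_ge0.
- by rewrite !subrr expr0n addr0 mulr_ge0 ?addr_ge0 ?sqr_ge0.
Qed.

Lemma ge0_integral_translate (u : R * R) (f : P -> \bar R) :
  measurable_fun setT f -> (forall v, 0 <= f v) ->
  \int[leb2 R]_v f (u + v)%R = \int[leb2 R]_v f v.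
Proof.
move=> mf f0.
have e0 : (0 < 10^-1 :> R)%R by lra.
have e5 : (5 * 10^-1 < 1 :> R)%R by lra.
rewrite [RHS](ge0_integral_contraction e0 e5 (contraction_cst (- u)%R) mf f0).
apply: eq_integral => v _.
rewrite (_ : jacobian_det _ _ _ _ v = 1%R); last by rewrite /jacobian_det /cst; ring.
by rewrite mule1 /cst opprK addrC.
Qed.

Lemma ge0_integral_line_opp (f : R -> \bar R) :
  measurable_fun setT (f : mR -> _) -> (forall v, 0 <= f v) ->
  \int[mu]_x f (- x)%R = \int[mu]_x f x.
Proof.
move=> mf f0.
have mN : measurable_fun setT (-%R : mR -> mR) by exact: oppr_measurable.
have := ge0_integral_pushforward mN mu measurableT mf (fun y _ => f0 y).
rewrite preimage_setT => <-.
by apply: eq_measure_integral => A mA _; exact: lebesgue_measureN.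
Qed.

Lemma ge0_integral_opp (f : P -> \bar R) :
  measurable_fun setT f -> (forall v, 0 <= f v) ->
  \int[leb2 R]_v f (- v)%R = \int[leb2 R]_v f v.
Proof.
move=> mf f0.
have mN : measurable_fun setT (-%R : mR -> mR) by exact: oppr_measurable.
have mN2 : measurable_fun setT (-%R : P -> P).
  by apply: measurable_fun_pair; apply: measurableT_comp.
rewrite integral_plane12//; last exact: measurableT_comp.
rewrite [RHS]integral_plane12//.
have mf1 x : measurable_fun setT (fun y : mR => f (x, y)) by exact: measurableT_comp.
transitivity (\int[mu]_x \int[mu]_y f (- x, y)%R).
  apply: eq_integral => x _.
  by rewrite -(@ge0_integral_line_opp (fun y => f (- x, y)%R)).
rewrite (@ge0_integral_line_opp (fun x => \int[mu]_y f (x, y))) //.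
- exact: measurable_fun_fubini_tonelli_F.
- by move=> x; exact: integral_ge0.
Qed.

Lemma ge0_integral_swap (f : P -> \bar R) :
  measurable_fun setT f -> (forall v, 0 <= f v) ->
  \int[leb2 R]_v f (pswap v) = \int[leb2 R]_v f v.
Proof.
move=> mf f0.
rewrite integral_plane12//; first by rewrite [RHS]integral_plane21.
by apply: measurableT_comp => //; exact: measurable_fun_pair.
Qed.

(** A rule for nonnegative functions extends to real ones by positive and negative parts; [w] is
    nonnegative, so the parts of the product are the products of the parts. *)
Lemma integral_substitution (phi : P -> P) (w : P -> R) (f : P -> R) :
  (forall g : P -> \bar R, measurable_fun setT g -> (forall v, 0 <= g v) ->
    \int[leb2 R]_v g v = \int[leb2 R]_v (g (phi v) * (w v)%:E)) ->
  (forall v, 0 <= w v)%R -> measurable_fun setT f ->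
  \int[leb2 R]_v (f v)%:E = \int[leb2 R]_v (f (phi v) * w v)%:E.
Proof.
move=> H w0 mf.
have mf' : measurable_fun setT (EFin \o f) by exact/measurable_EFinP.
rewrite integralE [RHS]integralE; congr (_ - _).
- rewrite H//; last exact: measurable_funepos.
  apply: eq_integral => v _; rewrite !funeposE/= -!EFin_max -EFinM.
  by rewrite maxr_pMl// mul0r.
- rewrite H//; last exact: measurable_funeneg.
  apply: eq_integral => v _; rewrite !funenegE/= -!EFin_max -EFinM.
  by rewrite maxr_pMl// mul0r mulNr.
Qed.

Context (e : R) (tau : R * R -> R * R) (a b c d : R * R -> R).
Hypotheses (e0 : (0 < e)%R) (e5 : (5 * e < 1)%R) (tauC : C1_contraction e tau a b c d).

(** 25/14 is the inverse of the lower bound of the Jacobian. *)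
Lemma ge0_integral_contraction_le (f : P -> \bar R) :
  measurable_fun setT f -> (forall v, 0 <= f v) ->
  \int[leb2 R]_v f (v - tau v)%R <= (25 / 14)%:E * \int[leb2 R]_v f v.
Proof.
move=> mf f0.
have mrho : measurable_fun setT (fun v : P => (v - tau v : P)%R).
  by apply: measurable_fun_pair; apply: measurable_funB => //;
    apply: measurableT_comp => //; exact: contraction_measurable tauC.
have mfrho : measurable_fun setT (fun v : P => f (v - tau v)%R).
  exact: measurableT_comp.
have mg : measurable_fun setT
    (fun v : P => f (v - tau v)%R * (jacobian_det a b c d v)%:E).
  apply: emeasurable_funM => //; apply/measurable_EFinP.
  by apply: continuous_measurable2; exact: jacobian_det_continuous tauC.
have Jge v : (14 / 25 <= jacobian_det a b c d v)%R.
  by have /andP[] := jacobian_det_bounds e0 e5 tauC v.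
have g0 v : 0 <= f (v - tau v)%R * (jacobian_det a b c d v)%:E.
  by rewrite mule_ge0// lee_fin; have := Jge v; lra.
rewrite (ge0_integral_contraction e0 e5 tauC mf f0).
have r0 : (0 <= 25 / 14 :> R)%R by lra.
apply: (@le_trans _ _ (\int[leb2 R]_v ((25 / 14)%:E *
    (f (v - tau v)%R * (jacobian_det a b c d v)%:E)))); last first.
  by rewrite ge0_integralZl_EFin.
apply: ge0_le_integral => //.
- exact: emeasurable_funM.
move=> v _; rewrite muleCA -EFinM; apply: lee_pemulr => //.
by rewrite lee_fin; have := Jge v; lra.
Qed.

(** The preimage of a null set is null, by [ge0_integral_contraction_le] for its indicator. *)
Lemma ae_contraction (Q : R * R -> Prop) :
  {ae leb2 R, forall v, Q v} -> {ae leb2 R, forall v, Q (v - tau v)%R}.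
Proof.
move=> [N [mN N0 QN]].
have mrho : measurable_fun setT (fun v : P => (v - tau v : P)%R).
  by apply: measurable_fun_pair; apply: measurable_funB => //;
    apply: measurableT_comp => //; exact: contraction_measurable tauC.
pose rho (v : P) : P := (v - tau v)%R.
have mrN : measurable (rho @^-1` N).
  by rewrite -[X in measurable X]setTI; exact: mrho.
have E (A : set P) : measurable A ->
    \int[leb2 R]_v (\1_A v)%:E = leb2 R A.
  by move=> mA; rewrite integral_indic// setIT.
exists (rho @^-1` N); split => //.
- apply/eqP; rewrite eq_le measure_ge0 andbT -E//.
  have EN : \int[leb2 R]_v (\1_N v)%:E = 0 by rewrite -N0; exact: E.
  have := @ge0_integral_contraction_le (fun v => (\1_N v)%:E).
  rewrite EN mule0; apply => //; first exact/measurable_EFinP/measurable_indic.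
- by move=> v /= nQ; apply: QN.
Qed.

End plane_substitutions.

(** * Test functions *)

Section smooth_functions.
Context {R : realType}.

(** The flat function exp(-1/x) is the case [n = 0]. The powers are included because a derivative of
    a member is again a combination of members. *)
Definition expinv (n : nat) (x : R) : R :=
  if 0 < x then x^-1 ^+ n * expR (- x^-1) else 0.

(** The exponential of 1/h exceeds one term of its series, that of degree n + 2. The quadratic bound
    yields derivative 0 at the origin. *)
Lemma expinv_le (n : nat) (h : R) : 0 < h ->
  expinv n h <= (n.+2)`!%:R * h ^+ 2.
Proof.
move=> h0; rewrite /expinv h0.
have hV : 0 < h^-1 by rewrite invr_gt0.
have f0 : 0 < (n.+2)`!%:R :> R by rewrite ltr0n fact_gt0.
have E := expR_ge1Dxn n.+1 (ltW hV).
rewrite expRN ler_pdivrMr ?expR_gt0//.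
have : h^-1 ^+ n.+2 / (n.+2)`!%:R <= expR h^-1 by apply: le_trans E; rewrite lerDr.
rewrite ler_pdivrMr// => {}E.
have -> : h^-1 ^+ n = h^-1 ^+ n.+2 * h ^+ 2.
  by rewrite -addn2 exprD -mulrA -exprMn mulVf ?gt_eqF// expr1n mulr1.
rewrite [leRHS](_ : _ = expR h^-1 * (n.+2)`!%:R * h ^+ 2); last by ring.
by rewrite ler_wpM2r// sqr_ge0.
Qed.

Lemma expinv_ge0 n x : 0 <= expinv n x.
Proof.
rewrite /expinv; case: ifPn => // x0.
by rewrite mulr_ge0 ?exprn_ge0 ?expR_ge0// invr_ge0 ltW.
Qed.

Lemma is_derive_expinv (n : nat) (x : R) :
  is_derive x 1 (expinv n) (- n%:R * expinv n.+1 x + expinv n.+2 x).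
Proof.
have [x0|x0|->] := ltgtP x 0.
- rewrite /expinv !ltNge (ltW x0)/= mulr0 addr0.
  apply: (@near_eq_is_derive _ _ _ (cst 0)).
  near=> y; rewrite ifN// -leNgt; apply: ltW; near: y.
  by apply: lt_nbhsl.
- apply: (@near_eq_is_derive _ _ _ (fun y : R => y^-1 ^+ n * expR (- y^-1))).
    near=> y; rewrite /expinv ifT//; near: y.
    by apply: lt_nbhsr.
  rewrite /expinv x0.
  have x0' : x != 0 by rewrite gt_eqF.
  have D1 : is_derive x 1 (fun y : R => y^-1) (- x ^- 2 *: 1).
    exact: (@is_deriveV _ (fun y : R => y)).
  have D2 : is_derive x 1 (fun y : R => expR (- y^-1)) (expR (- x^-1) * - (- x ^- 2 *: 1)).
    apply: (@is_derive1_comp _ expR (fun y : R => - y^-1)).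
  have D3 := is_deriveX n D1.
  have E m (y : R) : ((fun z : R => z^-1) ^+ m) y = y^-1 ^+ m.
    by elim: m => // m IH; rewrite !exprS -IH.
  rewrite (_ : (fun y : R => _) = (fun y => y^-1) ^+ n * (fun y => expR (- y^-1))); last first.
    by apply/funext => y; rewrite -E.
  apply: (is_derive_eq (is_deriveM D3 D2)).
  rewrite /GRing.scale/= E !mulr1 -!exprVn.
  case: n {D3} => [|n] /=; first by rewrite mul0r; ring.
  by rewrite !exprS; ring.
- rewrite /expinv ltxx mulr0 addr0; apply/is_derive_eps => eta eta0.
  set c : R := (n.+2)`!%:R.
  have c0 : 0 < c by rewrite ltr0n fact_gt0.
  exists (eta / c) => [|h hd]; first by rewrite divr_gt0.
  rewrite add0r ltxx subr0 mul0r subr0.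
  rewrite -/(expinv n h) ger0_norm ?expinv_ge0//.
  have [h0|h0] := ltP 0 h; last first.
    by rewrite /expinv ltNge h0/= mulr_ge0// ltW.
  apply: (le_trans (expinv_le n h0)); rewrite -/c.
  move: hd; rewrite !(gtr0_norm h0) ltr_pdivlMr// => hd.
  by nra.
Unshelve. all: by end_near. Qed.

(** A class of infinitely differentiable functions given by generators, so that closure under
    derivation is an induction. The last constructor admits functions defined as integrals, such as
    [bump_window] below. *)
Inductive smooth : (R -> R) -> Prop :=
| smooth_expinv n : smooth (expinv n)
| smooth_cst k : smooth (cst k)
| smooth_affine f k l : smooth f -> smooth (fun x => f (k * x + l))
| smoothD f g : smooth f -> smooth g -> smooth (fun x => f x + g x)
| smoothM f g : smooth f -> smooth g -> smooth (fun x => f x * g x)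
| smooth_primitive f g : smooth g -> (forall x : R, is_derive x 1 f (g x)) -> smooth f.

Lemma smooth_derive f : smooth f ->
  exists2 g, smooth g & forall x : R, is_derive x 1 f (g x).
Proof.
elim=> {f} [n|k|f k l _ [f' sf' D]|f g sf [f' sf' Df] sg [g' sg' Dg]
           |f g sf [f' sf' Df] sg [g' sg' Dg]|f g sg _ D].
- exists (fun x => cst (- n%:R) x * expinv n.+1 x + expinv n.+2 x).
    by apply: smoothD; [apply: smoothM; [exact: smooth_cst|]|]; exact: smooth_expinv.
  exact: is_derive_expinv.
- exists (cst 0); first exact: smooth_cst.
  by move=> x; exact: is_derive_cst.
- exists (fun x => cst k x * f' (k * x + l)).
    by apply: smoothM; [exact: smooth_cst|exact: smooth_affine].
  move=> x; rewrite /cst mulrC.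
  apply: (@is_derive1_comp _ f (fun x => k * x + l)).
  apply/is_derive_eps => eta eta0; exists 1 => // h _ /=.
  rewrite (_ : k * (x + h) + l - (k * x + l) - k * h = 0); last by ring.
  by rewrite normr0 mulr_ge0 // ltW.
- exists (fun x => f' x + g' x); first exact: smoothD.
  by move=> x; exact: is_deriveD.
- exists (fun x => f x * g' x + g x * f' x).
    by apply: smoothD; exact: smoothM.
  by move=> x; exact: is_deriveM.
- by exists g.
Qed.

Lemma smooth_continuous f : smooth f -> continuous f.
Proof. by move=> /smooth_derive[g _ D]; exact: is_derive_continuous D. Qed.

(** Products in separate variables and their linear combinations: a directional derivative of a
    product is a combination of two products. *)
Inductive smooth2 : (R * R -> R) -> Prop :=
| smooth_tensor p q : smooth p -> smooth q -> smooth2 (fun v => p v.1 * q v.2)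
| smooth2_comb k l f g : smooth2 f -> smooth2 g -> smooth2 (fun v => k * f v + l * g v).

Lemma diff_fst_comp (p p' : R -> R) (v : R * R) : (forall x : R, is_derive x 1 p (p' x)) ->
  is_diff v (fun v => p v.1) (fun h => h.1 * p' v.1).
Proof.
move=> D.
have D1 : differentiable p v.1 by apply/derivable1_diffP; have [] := D v.1.
have D2 : differentiable (fst : R * R -> R) v.
  by apply: linear_differentiable => w; exact: cvg_fst.
split; first exact: differentiable_comp.
rewrite (diff_comp D2 D1) diff_lin => [|w]; last exact: cvg_fst.
apply/funext => h /=; rewrite diff1E//; have [_ <-] := D v.1.
by rewrite derive1E.
Qed.

Lemma diff_snd_comp (p p' : R -> R) (v : R * R) : (forall x : R, is_derive x 1 p (p' x)) ->
  is_diff v (fun v => p v.2) (fun h => h.2 * p' v.2).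
Proof.
move=> D.
have D1 : differentiable p v.2 by apply/derivable1_diffP; have [] := D v.2.
have D2 : differentiable (snd : R * R -> R) v.
  by apply: linear_differentiable => w; exact: cvg_snd.
split; first exact: differentiable_comp.
rewrite (diff_comp D2 D1) diff_lin => [|w]; last exact: cvg_snd.
apply/funext => h /=; rewrite diff1E//; have [_ <-] := D v.2.
by rewrite derive1E.
Qed.

Lemma smooth2_derive f : smooth2 f -> (forall v, differentiable f v) /\
  forall w : R * R, exists2 g, smooth2 g & forall v, 'D_w f v = g v.
Proof.
elim=> {f} [p q sp sq|k l f g sf [df Df] sg [dg Dg]].
  have [p' sp' Dp] := smooth_derive sp; have [q' sq' Dq] := smooth_derive sq.
  have dp v := diff_fst_comp v Dp; have dq v := diff_snd_comp v Dq.
  have dpq v : differentiable (fun v => p v.1 * q v.2) v.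
    by apply: differentiableM; [have [] := dp v|have [] := dq v].
  split=> // w.
  exists (fun v => w.2 * (p v.1 * q' v.2) + w.1 * (p' v.1 * q v.2)).
    by apply: smooth2_comb; exact: smooth_tensor.
  move=> v; rewrite deriveE//.
  have [d1 e1] := dp v; have [d2 e2] := dq v.
  rewrite (diffM d1 d2).
  transitivity (p v.1 * (w.2 * q' v.2) + q v.2 * (w.1 * p' v.1)); last by ring.
  have e1w := congr1 (fun F : R * R -> R => F w) e1.
  have e2w := congr1 (fun F : R * R -> R => F w) e2.
  exact: (congr2 (fun x y => p v.1 * x + q v.2 * y) e2w e1w).
split=> [v|w].
  by apply: differentiableD; apply: differentiableM.
have [f' sf' Df'] := Df w; have [g' sg' Dg'] := Dg w.
exists (fun v => k * f' v + l * g' v); first exact: smooth2_comb.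
move=> v; have dfv : derivable f v w by exact: diff_derivable.
have dgv : derivable g v w by exact: diff_derivable.
have Zf : 'D_w (k \*: f) v = k * f' v by rewrite deriveZ// Df'.
have Zg : 'D_w (l \*: g) v = l * g' v by rewrite deriveZ// Dg'.
rewrite -Zf -Zg; apply: deriveD; exact: derivableZ.
Qed.

Lemma smooth2_Ck f k : smooth2 f -> Ck k f.
Proof.
elim: k f => [|k IH] f sf; have [df Df] := smooth2_derive sf.
  by move=> v; exact: differentiable_continuous.
split=> // w; have [g sg Dg] := Df w.
by rewrite (_ : (fun v => 'D_w f v) = g); [exact: IH|exact/funext].
Qed.

Lemma tensor_test_function (p q : R -> R) (r : R) : smooth p -> smooth q ->
  (forall x, r < `|x| -> p x = 0) -> (forall x, r < `|x| -> q x = 0) ->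
  test_function (fun v => p v.1 * q v.2).
Proof.
move=> sp sq p0 q0; split; last by move=> k; apply: smooth2_Ck; exact: smooth_tensor.
have cK : compact (`[-r, r] `*` `[-r, r] : set (R * R)).
  by apply: compact_setX; exact: segment_compact.
apply: (subclosed_compact _ cK); first exact: closed_closure.
rewrite [X in _ `<=` X](closure_id _).1.
  apply: closure_subset => -[x y] /=.
  rewrite mulf_eq0 negb_or => /andP[px qy].
  split; rewrite /= in_itv/= -ler_norml leNgt.
    by apply: contra px => /p0 ->.
  by apply: contra qy => /q0 ->.
exact: compact_closed.
Qed.

End smooth_functions.

(** * Absolutely continuous representatives *)

Section plane_uniqueness.
Context {R : realType}.
Local Notation mR := (measurableTypeR R).
Local Notation P := (mR * mR)%type.
Local Notation mu := (@lebesgue_measure R).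

Definition ocrect : set (set P) := [set A `*` B | A in @ocitv R & B in @ocitv R].

Definition ocbox (n : nat) : set R := `]- n%:R, n%:R]%classic.

Lemma ocbox_cover : \bigcup_n ocbox n = setT.
Proof.
apply/seteqP; split => // x _; exists (Num.truncn `|x|).+1 => //.
have := truncnS_gt `|x|; set k : R := (_.+1)%:R => xk.
rewrite /ocbox /= in_itv/= -/k.
by have := ler_norm x; have := ler_norm (- x); rewrite normrN => ? ?; apply/andP; split; lra.
Qed.

Lemma ocbox2_cover : \bigcup_n (ocbox n `*` ocbox n) = [set: P].
Proof.
apply/seteqP; split => // -[x y] _.
have [n _ xn] : (\bigcup_n ocbox n) x by rewrite ocbox_cover.
have [k _ yk] : (\bigcup_n ocbox n) y by rewrite ocbox_cover.
have sub (i j : nat) : (i <= j)%N -> ocbox i `<=` ocbox j.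
  move=> ij z; rewrite /ocbox/= !in_itv/= => /andP[h1 h2].
  have : (i%:R <= j%:R :> R)%R by rewrite ler_nat.
  by move=> h; apply/andP; split; lra.
exists (maxn n k) => //; split => /=.
  by apply: sub xn; exact: leq_maxl.
by apply: sub yk; exact: leq_maxr.
Qed.

Lemma ocbox_ocitv n : ocitv (ocbox n). Proof. exact: is_ocitv. Qed.

Lemma ocrect_setI : setI_closed ocrect.
Proof.
move=> _ _ [A oA [B oB <-]] [A' oA' [B' oB' <-]].
rewrite -setXI; exists (A `&` A'); first exact: ocitvI.
by exists (B `&` B') => //; exact: ocitvI.
Qed.

Lemma measurable_ocrect : @measurable _ P = <<s ocrect >>.
Proof.
rewrite measurable_prod_measurableType; apply/seteqP; split; last first.
  apply: smallest_sub; first exact: smallest_sigma_algebra.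
  move=> _ [A oA [B oB <-]]; apply: sub_sigma_algebra.
  by exists A; [exact: sub_sigma_algebra|exists B => //; exact: sub_sigma_algebra].
apply: smallest_sub; first exact: smallest_sigma_algebra.
have m1 : measurable_fun setT (fst : g_sigma_algebraType ocrect -> mR).
  apply: (measurability (@ocitv R)) => // _ [A oA <-]; rewrite setTI.
  have -> : fst @^-1` A = \bigcup_n (A `*` ocbox n) :> set P.
    by rewrite -setX_bigcupr ocbox_cover; apply/seteqP; split=> [[x y]|[x y] []].
  apply: bigcupT_measurable => n; apply: sub_sigma_algebra.
  by exists A => //; exists (ocbox n) => //; exact: ocbox_ocitv.
have m2 : measurable_fun setT (snd : g_sigma_algebraType ocrect -> mR).
  apply: (measurability (@ocitv R)) => // _ [A oA <-]; rewrite setTI.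
  have -> : snd @^-1` A = \bigcup_n (ocbox n `*` A) :> set P.
    by rewrite -setX_bigcupl ocbox_cover; apply/seteqP; split=> [[x y]|[x y] []].
  apply: bigcupT_measurable => n; apply: sub_sigma_algebra.
  by exists (ocbox n); [exact: ocbox_ocitv|exists A].
move=> _ [A mA [B mB <-]].
have := @measurableI _ (g_sigma_algebraType ocrect) (fst @^-1` A) (snd @^-1` B).
apply; first by rewrite -[X in measurable X]setTI; exact: m1.
by rewrite -[X in measurable X]setTI; exact: m2.
Qed.

Lemma ocrect_ocbox2 n : ocrect (ocbox n `*` ocbox n).
Proof.
by exists (ocbox n); [exact: ocbox_ocitv|exists (ocbox n) => //; exact: ocbox_ocitv].
Qed.

Lemma measurable_ocbox2 n : measurable (ocbox n `*` ocbox n : set P).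
Proof.
by rewrite measurable_ocrect; apply: sub_sigma_algebra; exact: ocrect_ocbox2.
Qed.

Local Open Scope ereal_scope.

(** The measures with densities [f] and [g] agree on half-open rectangles, a generating family
    closed under intersections, and are finite on an exhausting sequence of squares. Hence they
    agree everywhere, and on each square the densities agree almost everywhere. *)
Lemma plane_ae_eq (f g : P -> \bar R) :
  measurable_fun setT f -> measurable_fun setT g ->
  (forall v, 0 <= f v) -> (forall v, 0 <= g v) ->
  (forall A, ocrect A -> \int[leb2 R]_(v in A) f v = \int[leb2 R]_(v in A) g v) ->
  (forall n, \int[leb2 R]_(v in ocbox n `*` ocbox n) f v < +oo) ->
  {ae leb2 R, forall v, f v = g v}.
Proof.
move=> mf mg f0 g0 fgE ffin.
pose m1 := density_measure (leb2 R) mf; pose m2 := density_measure (leb2 R) mg.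
have m1E A : m1 A = \int[leb2 R]_(v in A) f v.
  by apply: eq_integral => v _; rewrite gee0_abs.
have m2E A : m2 A = \int[leb2 R]_(v in A) g v.
  by apply: eq_integral => v _; rewrite gee0_abs.
have box := ocrect_ocbox2; have mbox := measurable_ocbox2.
have m12 A : measurable A -> m1 A = m2 A.
  apply: (measure_unique ocrect (fun n => ocbox n `*` ocbox n)) => //.
  - exact: measurable_ocrect.
  - exact: ocrect_setI.
  - exact: ocbox2_cover.
  - by move=> B oB; have := fgE _ oB; rewrite -(m1E B) -(m2E B).
  - by move=> n; have := ffin n; rewrite -m1E.
have aen n : ae_eq (leb2 R) (ocbox n `*` ocbox n) f g.
  apply: integral_ae_eq => //.
  - apply/integrableP; split; first exact: measurable_funTS.
    by under eq_integral do rewrite gee0_abs//.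
  - exact: measurable_funTS.
  - by move=> E _ mE; rewrite -(m1E E) -(m2E E); exact: m12.
have : (leb2 R).-negligible (\bigcup_n ~` [set v | (ocbox n `*` ocbox n) v -> f v = g v]).
  by apply: negligible_bigcup => n; exact: aen.
apply: negligibleS => v /= fgv.
have [n _ vn] : (\bigcup_n (ocbox n `*` ocbox n)) v by rewrite ocbox2_cover.
by exists n => //= h; apply: fgv; exact: h.
Qed.

End plane_uniqueness.

Section sigma_finite_plane.
Context (R : realType).
Local Notation mR := (measurableTypeR R).
Local Notation P := (mR * mR)%type.
Local Notation mu := (@lebesgue_measure R).

Let leb2_sigma_finite : sigma_finite setT (leb2 R).
Proof.
exists (fun n => ocbox n `*` ocbox n); first by rewrite ocbox2_cover.
move=> n; split; first exact: measurable_ocbox2.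
have mb : measurable (ocbox n : set mR) by apply: sub_sigma_algebra; exact: ocbox_ocitv.
rewrite (_ : leb2 R _ = mu (ocbox n) * mu (ocbox n))%E; last first.
  exact: (@product_measure1E _ _ _ _ _ mu mu).
rewrite /ocbox lebesgue_measure_itv/=; case: ifPn => _.
  by rewrite -EFinB -EFinM ltry.
by rewrite mule0 ltry.
Qed.

(* [leb2 R] together with its sigma-finiteness, as required by Tonelli's theorem. *)
Definition sigma_leb2 : {sigma_finite_measure set P -> \bar R} :=
  HB.pack_for (SigmaFiniteMeasure.type P R) (Measure.sort (leb2 R)) (leb2 R)
   (Measure_isSigmaFinite.Build _ P R (leb2 R) leb2_sigma_finite).

End sigma_finite_plane.
Arguments sigma_leb2 : clear implicits.

(** * Smooth approximation of half-open intervals *)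

Section smooth_bumps.
Context {R : realType}.
Local Notation mR := (measurableTypeR R).
Local Notation mu := (@lebesgue_measure R).

Lemma expinv0_ge t : 0 < t :> R -> 1 - t^-1 <= expinv 0 t <= 1.
Proof.
move=> t0; rewrite /expinv t0 expr0 mul1r expR_ge1Dx /=.
by rewrite -expR0 ler_expR oppr_le0 invr_ge0 ltW.
Qed.

Lemma expinv_le0 n t : t <= 0 :> R -> expinv n t = 0.
Proof. by move=> t0; rewrite /expinv ltNge t0. Qed.

Lemma expinv0_le1 t : expinv 0 t <= 1 :> R.
Proof.
have [t0|t0] := leP t 0; first by rewrite expinv_le0.
by have /andP[] := expinv0_ge t0.
Qed.

(** With N = n + 1, the first factor vanishes up to [a]. The second has argument N^2 (b - x) + N, so
    it vanishes from b + 1/N on, while at x = b the argument N tends to infinity. The limit is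
    therefore the indicator of []a, b]] with [b] included. *)
Definition itv_bump (a b : R) (n : nat) (x : R) : R :=
  let N := n.+1%:R in
  expinv 0 (N * x + - (N * a)) * expinv 0 (- N ^+ 2 * x + (N ^+ 2 * b + N)).

Lemma smooth_bump a b n : smooth (itv_bump a b n).
Proof. by apply: smoothM; apply: smooth_affine; exact: smooth_expinv. Qed.

Lemma bump_ge0 a b n x : 0 <= itv_bump a b n x.
Proof. by rewrite mulr_ge0 ?expinv_ge0. Qed.

Lemma bump_le_indic a b n x : itv_bump a b n x <= \1_(`]a, b + 1]%classic) x.
Proof.
have N1 : (1 : R) <= n.+1%:R by rewrite ler1n.
rewrite indicE /itv_bump; move: N1; move: (n.+1%:R : R) => N N1.
have [h|] := boolP (x \in _).
  by apply: mulr_ile1; [exact: expinv_ge0|exact: expinv_ge0|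
    exact: expinv0_le1|exact: expinv0_le1].
rewrite notin_setE/= in_itv/= => /negP; rewrite negb_and -leNgt -ltNge => /orP[xa|bx].
  by rewrite expinv_le0 ?mul0r//; nra.
by rewrite mulrC expinv_le0 ?mul0r//; nra.
Qed.

Lemma bump_cvg a b x : itv_bump a b n x @[n --> \oo] --> (\1_(`]a, b]%classic) x : R).
Proof.
apply/cvgrPdist_le => eta eta0; rewrite indicE.
have [xa|ax] := leP x a.
  near=> n; rewrite memNset /=; last by rewrite in_itv/= => /andP[]; lra.
  rewrite /itv_bump expinv_le0; last first.
    have : (0 : R) <= n.+1%:R by []. 
    by move: (n.+1%:R : R) => N N0; nra.
  by rewrite mul0r subrr normr0 ltW.
have [bx|xb] := ltP b x.
  near=> n; rewrite memNset /=; last by rewrite in_itv/= => /andP[]; lra.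
  rewrite /itv_bump mulrC expinv_le0; first by rewrite mul0r subrr normr0 ltW.
  have : (x - b)^-1 <= n.+1%:R.
    near: n; exists (Num.truncn (x - b)^-1) => // m /= km.
    apply: (le_trans (ltW (truncnS_gt _))); by rewrite ler_nat ltnS.
  have bx0 : 0 < x - b by lra.
  rewrite -[leLHS]mul1r ler_pdivrMr//.
  have : (0 : R) <= n.+1%:R by [].
  by move: (n.+1%:R : R) => N N0 Nx; nra.
near=> n; rewrite mem_set /=; last by rewrite in_itv/= ax xb.
have ax0 : 0 < x - a by lra.
(* As [expinv 0 t] is at least 1 - 1/t, the product of the two factors misses 1 by at most (1/(x -
   a) + 1) / N. *)
have : ((x - a)^-1 + 1) / eta <= n.+1%:R.
  near: n; exists (Num.truncn (((x - a)^-1 + 1) / eta)) => // m /= km.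
  apply: (le_trans (ltW (truncnS_gt _))); by rewrite ler_nat ltnS.
have : (1 : R) <= n.+1%:R by rewrite ler1n.
rewrite /itv_bump; move: (n.+1%:R : R) => N N1; rewrite ler_pdivrMr// => Neta.
have N0 : 0 < N by lra.
have t1 : 0 < N * x + - (N * a) by nra.
have t2 : N <= - N ^+ 2 * x + (N ^+ 2 * b + N) by nra.
have t2' : 0 < - N ^+ 2 * x + (N ^+ 2 * b + N) by lra.
have /andP[l1 u1] := expinv0_ge t1; have /andP[l2 u2] := expinv0_ge t2'.
have e1 := expinv_ge0 0 (N * x + - (N * a)).
have e2 := expinv_ge0 0 (- N ^+ 2 * x + (N ^+ 2 * b + N)).
have i2 : (- N ^+ 2 * x + (N ^+ 2 * b + N))^-1 <= N^-1.
  by rewrite lef_pV2 ?posrE.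
have i1 : (N * x + - (N * a))^-1 = (x - a)^-1 / N.
  by rewrite -mulrBr invfM mulrC.
have key : ((x - a)^-1 + 1) / N <= eta by rewrite ler_pdivrMr// mulrC.
rewrite mulrDl mul1r -i1 in key.
rewrite ger0_norm; last by rewrite subr_ge0; apply: mulr_ile1.
have p12 : 0 <= (1 - expinv 0 (N * x + - (N * a))) *
    (1 - expinv 0 (- N ^+ 2 * x + (N ^+ 2 * b + N))).
  by rewrite mulr_ge0 ?subr_ge0.
rewrite mulrBr mulr1 mulrBl mul1r in p12.
apply: le_trans key; apply: le_trans (lerD (lexx _) i2).
clear -l1 l2 p12; lra.
Unshelve. all: by end_near. Qed.

Lemma indic_itv_measurable (i : interval R) :
  measurable_fun setT (\1_[set` i] : mR -> mR).
Proof. by apply: measurable_indic. Qed.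

Lemma bump_measurable a b n : measurable_fun setT (itv_bump a b n : mR -> mR).
Proof.
by apply: continuous_measurable_fun; exact: smooth_continuous (smooth_bump a b n).
Qed.

Lemma integrable_itv_indic (a b : R) :
  mu.-integrable setT (EFin \o (\1_(`]a, b]%classic) : mR -> R)).
Proof.
apply/integrableP; split; first by apply/measurable_EFinP; exact: indic_itv_measurable.
under eq_integral do rewrite /= ger0_norm//.
rewrite integral_indic// setIT /= (lebesgue_measure_itv `]a, b])/=.
by case: ifPn => // _; rewrite ltry.
Qed.

Lemma integrable_bump a b n : mu.-integrable setT (EFin \o (itv_bump a b n : mR -> R)).
Proof.
apply: le_integrable (integrable_itv_indic a (b + 1)) => //.
  by apply/measurable_EFinP; exact: bump_measurable.
move=> x _ /=; rewrite lee_fin !ger0_norm ?bump_ge0//.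
exact: bump_le_indic.
Qed.

(** In the limit, a primitive of minus the bump. The window of finite length makes it vanish far to
    the left as well as to the right, hence a compactly supported test function. *)
Definition bump_window (a b : R) (n : nat) (x : R) : R :=
  \int[mu]_(t in `]x, (x + n.+1%:R)]) itv_bump a b n t.

Lemma is_derive_bump_window a b n (x : R) :
  is_derive x 1 (bump_window a b n) (itv_bump a b n (x + n.+1%:R) - itv_bump a b n x).
Proof.
pose A (y : R) := \int[mu]_(t in `]-oo, y]) itv_bump a b n t.
have ib (i : interval R) : mu.-integrable [set` i] (EFin \o (itv_bump a b n : mR -> R)).
  by apply: integrableS (integrable_bump a b n).
have AE (y : R) : is_derive y 1 A (itv_bump a b n y).
  have y1 : y < y + 1 by rewrite ltrDl.
  have cb : {for y, continuous (itv_bump a b n)} by exact: smooth_continuous (smooth_bump a b n) _.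
  have [|dA A'] := @continuous_FTC1 R (itv_bump a b n) -oo%O y (y + 1) y1 (ib _) _ cb.
    by rewrite ltNyr.
  by split; [exact: dA|rewrite -derive1E A'].
have -> : bump_window a b n = (fun x => A (x + n.+1%:R) - A x).
  apply/funext => y; rewrite /A Rintegral_itvB//.
  by rewrite bnd_simp lerDl.
apply: is_deriveB.
rewrite -[X in is_derive _ _ _ X]mulr1.
apply: (@is_derive1_comp _ A (fun x => x + n.+1%:R)).
apply/is_derive_eps => eta eta0; exists 1 => // h _ /=.
rewrite (_ : x + h + n.+1%:R - (x + n.+1%:R) - 1 * h = 0); last by ring.
by rewrite normr0 mulr_ge0// ltW.
Qed.

Lemma smooth_bump_window a b n : smooth (bump_window a b n).
Proof.
apply: (@smooth_primitive _ _ (fun x => itv_bump a b n (1 * x + n.+1%:R) + cst (- 1) x * itv_bump a b n x)).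
  apply: smoothD; first exact: smooth_affine (smooth_bump a b n).
  by apply: smoothM; [exact: smooth_cst|exact: smooth_bump].
move=> x; rewrite mul1r /cst mulN1r; exact: is_derive_bump_window.
Qed.

Lemma bump_window_ge0 a b n x : 0 <= bump_window a b n x.
Proof. by apply: Rintegral_ge0 => t _; exact: bump_ge0. Qed.

Lemma bump_windowE a b n x : bump_window a b n x =
  \int[mu]_t (itv_bump a b n t * \1_(`]x, (x + n.+1%:R)]%classic) t).
Proof.
rewrite /bump_window Rintegral_mkcond; apply: eq_Rintegral => t _.
by rewrite patchE indicE; case: ifPn; rewrite ?mulr1 ?mulr0.
Qed.

Lemma bump_window_eq0 a b n x : x + n.+1%:R <= a \/ b + 1 <= x ->
  bump_window a b n x = 0.
Proof.
move=> h; rewrite bump_windowE /Rintegral integral0_eq// => t _.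
congr EFin; rewrite [X in _ * X]indicE.
have [|] := boolP (t \in _); last by rewrite mulr0.
rewrite inE/= in_itv/= mulr1 => /andP[h1 h2].
apply/eqP; rewrite eq_le bump_ge0 andbT; apply: (le_trans (bump_le_indic _ _ _ _)).
rewrite indicE memNset//= in_itv/= => /andP[h3 h4].
by case: h => h; lra.
Qed.

Lemma bump_window_le a b n x : a < b -> bump_window a b n x <= b + 1 - a.
Proof.
move=> ab; rewrite bump_windowE.
have := @le_Rintegral _ _ _ mu setT (fun t => itv_bump a b n t * \1_(`]x, (x + n.+1%:R)]%classic) t)
  (\1_(`]a, b + 1]%classic) : mR -> R) measurableT.
have ii := integrable_itv_indic a (b + 1).
have h t : itv_bump a b n t * \1_(`]x, (x + n.+1%:R)]%classic) t <= (\1_(`]a, b + 1]%classic) t : R).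
  apply: le_trans (bump_le_indic a b n t).
  by rewrite ler_piMr ?bump_ge0// indicE; case: (_ \in _).
move=> /(_ _ ii (fun t _ => h t)).
rewrite {2}/Rintegral integral_indic// setIT /= (lebesgue_measure_itv `]a, b + 1])/= lte_fin.
rewrite ifT/=; last lra.
apply; apply: le_integrable ii => //.
  apply/measurable_EFinP; apply: measurable_funM; first exact: bump_measurable.
  exact: indic_itv_measurable.
by move=> t _ /=; rewrite lee_fin !ger0_norm// mulr_ge0 ?bump_ge0.
Qed.

(** The length of []a, b]] to the right of [x], the limit of [bump_window]. As an integral of
    indicators it appears directly when Tonelli's theorem is applied to a primitive. *)
Definition tail_length (a b x : R) : R :=
  \int[mu]_t (\1_(`]a, b]%classic) t * \1_(`]x, +oo[%classic) t).

Lemma bump_window_cvg a b x :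
  bump_window a b n x @[n --> \oo] --> tail_length a b x.
Proof.
pose f n (t : mR) : \bar R := (itv_bump a b n t * \1_(`]x, (x + n.+1%:R)]%classic) t)%:E.
pose g (t : mR) : \bar R := (\1_(`]a, b]%classic) t * \1_(`]x, +oo[%classic) t)%:E.
pose h : mR -> \bar R := EFin \o (\1_(`]a, b + 1]%classic) : mR -> R).
have fg : (\int[mu]_t f n t)%E @[n --> \oo] --> (\int[mu]_t g t)%E.
  apply: (@dominated_cvg _ _ _ mu setT measurableT f g h).
  - move=> n; apply/measurable_EFinP; apply: measurable_funM; first exact: bump_measurable.
    exact: indic_itv_measurable.
  - move=> t _; apply: cvg_EFin; first by apply: nearW.
    apply: cvgM; first exact: bump_cvg.
    apply: cvg_near_cst; have [tx|xt] := leP t x.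
      by near=> n; rewrite !indicE !memNset//=; rewrite in_itv/= ltNge tx.
    near=> n; rewrite !indicE !mem_set//=; rewrite in_itv/= ?andbT ?xt//=.
    rewrite -lerBlDl; near: n; exists (Num.truncn (t - x)) => // m /= km.
    by apply: (le_trans (ltW (truncnS_gt _))); rewrite ler_nat ltnS.
  - by [].
  - exact: integrable_itv_indic.
  - move=> n t _; rewrite /f /h /= lee_fin ger0_norm; last first.
      by apply: mulr_ge0 => //; exact: bump_ge0.
    apply: le_trans (bump_le_indic a b n t).
    by rewrite ler_piMr ?bump_ge0// indicE; case: (_ \in _).
have ig : mu.-integrable setT g.
  apply: le_integrable (integrable_itv_indic a b) => //.
    apply/measurable_EFinP; apply: measurable_funM; exact: indic_itv_measurable.
  move=> u _ /=; rewrite lee_fin !ger0_norm ?mulr_ge0//.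
  by rewrite ler_piMr// indicE; case: (_ \in _).
have E : (fun n => bump_window a b n x) =1 (fun n => fine (\int[mu]_t f n t)%E).
  by move=> k; rewrite bump_windowE.
rewrite (eq_cvg _ _ E).
apply: fine_cvg; rewrite /tail_length /Rintegral fineK//.
exact: integrable_fin_num.
Unshelve. all: by end_near. Qed.

End smooth_bumps.

Section dominated_real.
Context d (T : measurableType d) (R : realType) (m : {measure set T -> \bar R}).

Lemma Rintegral_dominated_cvg (f_ : nat -> T -> R) (f h : T -> R) :
  (forall n, measurable_fun setT (f_ n)) ->
  (forall x, f_ n x @[n --> \oo] --> f x) ->
  m.-integrable setT (EFin \o h) ->
  (forall n x, `|f_ n x| <= h x) ->
  \int[m]_x f_ n x @[n --> \oo] --> \int[m]_x f x.
Proof.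
move=> mf ff ih fh.
have [] := @dominated_convergence _ _ _ m setT measurableT
  (fun n x => (f_ n x)%:E) (EFin \o f) (EFin \o h).
- by move=> n; exact/measurable_EFinP.
- by apply/measurable_EFinP; apply: (measurable_fun_cvg mf) => x _; exact: ff.
- by apply: aeW => x _; apply: cvg_EFin; [exact: nearW|exact: ff].
- exact: ih.
- by apply: aeW => x n _ /=; rewrite lee_fin.
move=> iF _ cF; apply: fine_cvg; rewrite /Rintegral fineK//.
exact: integrable_fin_num.
Qed.

End dominated_real.

(** * From test functions to rectangles *)

Section absolutely_continuous_representative.
Context {R : realType}.
Local Notation mR := (measurableTypeR R).
Local Notation P := (mR * mR)%type.
Local Notation mu := (@lebesgue_measure R).

Lemma tail_length_ge0 a b x : 0 <= tail_length a b x :> R.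
Proof. by apply: Rintegral_ge0 => t _; rewrite mulr_ge0. Qed.

Lemma tail_lengthE a b x :
  (tail_length a b x)%:E = (\int[mu]_t (\1_(`]a, b]%classic) t * \1_(`]x, +oo[%classic) t)%:E)%E.
Proof.
rewrite /tail_length /Rintegral fineK//; apply: integrable_fin_num => //.
apply: le_integrable (integrable_itv_indic a b) => //.
  apply/measurable_EFinP; apply: measurable_funM; exact: indic_itv_measurable.
move=> t _ /=; rewrite lee_fin !ger0_norm ?mulr_ge0//.
by rewrite ler_piMr// indicE; case: (_ \in _).
Qed.

Lemma tail_length_le a b x : a < b -> tail_length a b x <= b + 1 - a :> R.
Proof.
move=> ab; have := @bump_window_cvg R a b x.
move/cvgr_to_le; apply; apply: nearW => n.
exact: bump_window_le.
Qed.

Lemma measurable_lt_plane : measurable ([set v | v.1 < v.2] : set P).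
Proof.
have := @measurable_fun_ltr _ P R setT fst snd (@measurable_fst _ _ mR mR) (@measurable_snd _ _ mR mR)
  measurableT [set true] I.
rewrite setTI; congr measurable.
Qed.

Context (W g : R * R -> R).
Hypothesis iW : (leb2 R).-integrable setT (EFin \o W).
Hypothesis ig : (leb2 R).-integrable setT (EFin \o g).
Hypothesis weak : forall (p p' q : R -> R) (r : R), smooth p -> smooth q ->
  (forall x : R, is_derive x 1 p (p' x)) ->
  (forall x, r < `|x| -> p x = 0) -> (forall x, r < `|x| -> q x = 0) ->
  \int[leb2 R]_v (W v * (p' v.1 * q v.2)) =
  - (\int[leb2 R]_v (g v * (p v.1 * q v.2))).

Let mW : measurable_fun setT (W : P -> mR).
Proof. by apply/measurable_EFinP; exact: measurable_int iW. Qed.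

Let mg : measurable_fun setT (g : P -> mR).
Proof. by apply/measurable_EFinP; exact: measurable_int ig. Qed.

(** The limit of the integration by parts with [bump_window] in the first variable and [itv_bump] in
    the second. The derivative of the former tends to minus the indicator of []a, b]], which cancels
    the minus sign of the formula. *)
Lemma weak_rectangle a b c d : a < b -> c < d ->
  \int[leb2 R]_v (W v * (\1_(`]a, b]%classic) v.1 * \1_(`]c, d]%classic) v.2)) =
  \int[leb2 R]_v (g v * (tail_length a b v.1 * \1_(`]c, d]%classic) v.2)).
Proof.
move=> ab cd.
have iWn k : (leb2 R).-integrable setT (EFin \o (fun v => k * `|W v|)).
  have := integrableZl measurableT k (integrable_norm iW).
  by apply: eq_integrable.
have ign k : (leb2 R).-integrable setT (EFin \o (fun v => k * `|g v|)).
  have := integrableZl measurableT k (integrable_norm ig).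
  by apply: eq_integrable.
have bump01 a' b' n x : `|itv_bump a' b' n x| <= 1 :> R.
  rewrite ger0_norm ?bump_ge0//; apply: le_trans (bump_le_indic _ _ _ _) _.
  by rewrite indicE; case: (_ \in _).
pose lhs n := \int[leb2 R]_v (W v * ((itv_bump a b n (v.1 + n.+1%:R) - itv_bump a b n v.1) * itv_bump c d n v.2)).
pose rhs n := \int[leb2 R]_v (g v * (bump_window a b n v.1 * itv_bump c d n v.2)).
have lr n : lhs n = - rhs n.
  (* The support of the window function starts n + 1 to the left of [a]; this radius covers it and
     the support of the bump in the second variable. *)
  pose r := `|a| + `|b| + `|c| + `|d| + 1 + n.+1%:R.
  apply: (@weak (bump_window a b n)
    (fun x => itv_bump a b n (x + n.+1%:R) - itv_bump a b n x) (itv_bump c d n) r).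
  - exact: smooth_bump_window.
  - exact: smooth_bump.
  - exact: is_derive_bump_window.
  - move=> x rx; apply: bump_window_eq0.
    have := ler_norm a; have := ler_norm b; have := ler_norm (- a); have := ler_norm (- b).
    rewrite !normrN; have := normr_ge0 c; have := normr_ge0 d.
    have := ler0n R n.+1.
    move: rx; rewrite /r; move: (n.+1%:R : R) => N.
    by case: (ger0P x) => x0 rx *; [right|left]; lra.
  - move=> x rx; apply/eqP; rewrite eq_le bump_ge0 andbT.
    apply: le_trans (bump_le_indic _ _ _ _) _; rewrite indicE memNset//= in_itv/=.
    move=> /andP[h1 h2].
    have := ler_norm d; have := ler_norm (- c); have := normr_ge0 a; have := normr_ge0 b.
    have := ler0n R n.+1; rewrite normrN; have := normr_ge0 c; have := normr_ge0 d.
    move: rx; rewrite /r; move: (n.+1%:R : R) => N.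
    by case: (ger0P x) => x0 rx *; lra.
have mb a' b' n : measurable_fun setT (fun v : P => itv_bump a' b' n v.2).
  by apply: measurableT_comp => //; exact: bump_measurable.
have cl : lhs n @[n --> \oo] -->
    \int[leb2 R]_v (W v * ((0 - \1_(`]a, b]%classic) v.1) * \1_(`]c, d]%classic) v.2)).
  apply: (@Rintegral_dominated_cvg _ _ _ (leb2 R) _ _ (fun v => 2 * `|W v|)) => //.
  - move=> n; apply: measurable_funM => //; apply: measurable_funM => //.
    apply: measurable_funB.
      apply: (@measurableT_comp _ _ _ _ _ _ (itv_bump a b n : mR -> mR)); first exact: bump_measurable.
      by apply: measurable_funD.
    by apply: measurableT_comp => //; exact: bump_measurable.
  - move=> [x y] /=; apply: cvgM; first exact: cvg_cst.
    apply: cvgM; last exact: bump_cvg.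
    apply: cvgB; last exact: bump_cvg.
    (* The bump at [x + n + 1] is 0 as soon as this point passes [b + 1]. *)
    apply: cvg_near_cst; near=> n.
    apply/eqP; rewrite eq_le bump_ge0 andbT.
    apply: le_trans (bump_le_indic _ _ _ _) _; rewrite indicE memNset//= in_itv/=.
    apply/negP; rewrite negb_and -[X in _ || X]ltNge; apply/orP; right.
    rewrite -ltrBlDl; near: n; exists (Num.truncn (b + 1 - x)) => // m /= km.
    by apply: (lt_le_trans (truncnS_gt _)); rewrite ler_nat ltnS.
  - move=> n v; rewrite normrM mulrC; apply: ler_wpM2r => //.
    rewrite normrM -[leRHS]mulr1; apply: ler_pM => //.
    by apply: (le_trans (ler_normB _ _)); apply: lerD.
have cr : rhs n @[n --> \oo] -->
    \int[leb2 R]_v (g v * (tail_length a b v.1 * \1_(`]c, d]%classic) v.2)).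
  apply: (@Rintegral_dominated_cvg _ _ _ (leb2 R) _ _ (fun v => (b + 1 - a) * `|g v|)) => //.
  - move=> n; apply: measurable_funM => //; apply: measurable_funM => //.
    apply: (@measurableT_comp _ _ _ _ _ _ (bump_window a b n : mR -> mR)) => //.
    by apply: continuous_measurable_fun; exact: smooth_continuous (smooth_bump_window a b n).
  - move=> [x y] /=; apply: cvgM; first exact: cvg_cst.
    by apply: cvgM; [exact: bump_window_cvg|exact: bump_cvg].
  - move=> n v; rewrite normrM mulrC; apply: ler_wpM2r => //.
    rewrite normrM -[leRHS]mulr1; apply: ler_pM => //.
    rewrite ger0_norm ?bump_window_ge0//; exact: bump_window_le.
have cr' : lhs n @[n --> \oo] -->
    - (\int[leb2 R]_v (g v * (tail_length a b v.1 * \1_(`]c, d]%classic) v.2))).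
  by rewrite (eq_cvg _ _ lr); exact: cvgN.
have E := cvg_unique (@Rhausdorff R) cl cr'.
apply: oppr_inj; rewrite -E.
have i1 : (leb2 R).-integrable setT (EFin \o (fun v => W v * (\1_(`]a, b]%classic) v.1 * \1_(`]c, d]%classic) v.2))).
  apply: le_integrable (iWn 1) => //.
    apply/measurable_EFinP; apply: measurable_funM => //.
    by apply: measurable_funM; apply: measurableT_comp => //; exact: indic_itv_measurable.
  move=> v _ /=; rewrite lee_fin mul1r normr_id normrM -[leRHS]mulr1.
  apply: ler_wpM2l => //; rewrite ger0_norm ?mulr_ge0//.
rewrite -mulN1r -RintegralZl//; apply: eq_Rintegral => v _; ring.
Unshelve. all: by end_near. Qed.

End absolutely_continuous_representative.

Section left_integral.
Context {R : realType}.
Local Notation mR := (measurableTypeR R).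
Local Notation P := (mR * mR)%type.
Local Notation mu := (@lebesgue_measure R).
Local Open Scope ereal_scope.

Lemma indic_itv_lt (s t : R) :
  \1_(`]s, +oo[%classic) t = (\1_([set v | v.1 < v.2] : set P) (s, t))%R :> R.
Proof. by rewrite !indicE; congr (nat_of_bool _)%:R; apply/idP/idP; rewrite !inE/= in_itv/= andbT. Qed.

Lemma measurable_tail_length (a b : R) :
  measurable_fun setT (tail_length a b : mR -> mR).
Proof.
have m1 : measurable_fun setT (\1_(`]a, b]%classic) : mR -> mR) by exact: indic_itv_measurable.
rewrite (_ : tail_length a b = fine \o (fun x => \int[mu]_t (\1_(`]a, b]%classic) t * \1_(`]x, +oo[%classic) t)%:E)) //.
apply: measurableT_comp; first exact: fine_measurable.
apply: (measurable_fun_fubini_tonelli_F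
  (fun w : P => (\1_(`]a, b]%classic) w.2 * \1_(`]w.1, +oo[%classic) w.2)%:E)).
  apply/measurable_EFinP; apply: measurable_funM; first exact: measurableT_comp.
  under eq_fun do rewrite indic_itv_lt -surjective_pairing.
  by apply: measurable_indic; exact: measurable_lt_plane.
by move=> w; rewrite lee_fin mulr_ge0.
Qed.

Lemma measurable_tail_indic (a b c d : R) :
  measurable_fun setT (fun v : P => tail_length a b v.1 * \1_(`]c, d]%classic) v.2)%R.
Proof.
apply: measurable_funM; apply: measurableT_comp => //; first exact: measurable_tail_length.
Qed.

Lemma measurable_rect_indic (a b c d : R) :
  measurable_fun setT (fun v : P => \1_(`]a, b]%classic) v.1 * \1_(`]c, d]%classic) v.2 : mR)%R.
Proof. by apply: measurable_funM; apply: measurableT_comp => //; exact: indic_itv_measurable. Qed.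

Lemma integrable_bounded (f phi : P -> R) (C : R) :
  (leb2 R).-integrable setT (EFin \o f) -> measurable_fun setT phi ->
  (forall v, (`|phi v| <= C)%R) ->
  (leb2 R).-integrable setT (EFin \o (fun v => f v * phi v)%R).
Proof.
move=> if_ mphi phiC.
have mf : measurable_fun setT f by apply/measurable_EFinP; exact: measurable_int if_.
have := integrableZl measurableT C (integrable_norm if_).
apply: le_integrable => //.
  by apply/measurable_EFinP; exact: measurable_funM.
move=> v _ /=; rewrite lee_fin normrM mulrC; apply: le_trans _ (ler_norm _).
by rewrite ler_wpM2r.
Qed.

(** The integral of [h] over the half-line to the left of [v], at the height of [v]. The bound of
    integration is an indicator, so that measurability in [v] comes from Tonelli's theorem. *)
Definition left_integral (h : P -> R) (v : P) : \bar R :=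
  \int[mu]_s (h (s, v.2) * \1_(`]s, +oo[%classic) v.1)%:E.

Variable h : P -> R.
Hypotheses (mh : measurable_fun setT h) (h0 : forall v, (0 <= h v)%R).

Lemma left_integral_ge0 v : 0 <= left_integral h v.
Proof. by apply: integral_ge0 => s _; rewrite lee_fin mulr_ge0. Qed.

Lemma measurable_left_integral : measurable_fun setT (left_integral h).
Proof.
apply: (measurable_fun_fubini_tonelli_F
  (fun w : P * mR => (h (w.2, w.1.2) * \1_(`]w.2, +oo[%classic) w.1.1)%:E)).
  apply/measurable_EFinP; apply: measurable_funM.
    apply: measurableT_comp => //; apply: measurable_fun_pair => //.
    exact: measurableT_comp.
  under eq_fun do rewrite indic_itv_lt.
  apply: (@measurableT_comp _ _ _ _ _ _ (\1_([set v | v.1 < v.2]%R : set P) : P -> mR)).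
    by apply: measurable_indic; exact: measurable_lt_plane.
  by apply: measurable_fun_pair => //; exact: measurableT_comp.
by move=> w; rewrite lee_fin mulr_ge0.
Qed.

(** Exchange of the integrals: integrating the indicator of [s < t] over [t] in []a, b]] first
    leaves [tail_length a b s]. *)
Lemma integral_left_integral (a b c d : R) :
  \int[leb2 R]_(v in `]a, b]%classic `*` `]c, d]%classic) left_integral h v =
  \int[leb2 R]_v (h v * (tail_length a b v.1 * \1_(`]c, d]%classic) v.2))%:E.
Proof.
have m1 : measurable_fun setT (\1_(`]a, b]%classic) : mR -> mR) by exact: indic_itv_measurable.
have m2 : measurable_fun setT (\1_(`]c, d]%classic) : mR -> mR) by exact: indic_itv_measurable.
rewrite integral_mkcond.
transitivity (\int[leb2 R]_v
  (left_integral h v * (\1_(`]a, b]%classic) v.1 * \1_(`]c, d]%classic) v.2)%:E)).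
  apply: eq_integral => -[x y] _; rewrite patchE/= !indicE in_setX/=.
  by case: (x \in _); case: (y \in _); rewrite /= ?mulr1 ?mulr0 ?mul0r ?mule0 ?mule1.
rewrite integral_plane21; last 2 first.
- apply: emeasurable_funM; first exact: measurable_left_integral.
  by apply/measurable_EFinP; apply: measurable_funM; exact: measurableT_comp.
- by move=> v; rewrite mule_ge0 ?left_integral_ge0// lee_fin mulr_ge0.
have mt := measurable_tail_length a b.
rewrite [RHS]integral_plane21; last 2 first.
- apply/measurable_EFinP; apply: measurable_funM => //.
  by apply: measurable_funM; exact: measurableT_comp.
- by move=> v; rewrite lee_fin mulr_ge0// mulr_ge0// tail_length_ge0.
apply: eq_integral => y _ /=.
pose F (w : P) := (h (w.1, y) * \1_(`]w.1, +oo[%classic) w.2 *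
   (\1_(`]a, b]%classic) w.2 * \1_(`]c, d]%classic) y))%:E.
have mF : measurable_fun setT F.
  apply/measurable_EFinP; apply: measurable_funM; last first.
    by apply: measurable_funM => //; exact: measurableT_comp.
  apply: measurable_funM.
    by apply: measurableT_comp => //; exact: measurable_fun_pair.
  under eq_fun do rewrite indic_itv_lt -surjective_pairing.
  by apply: measurable_indic; exact: measurable_lt_plane.
have F0 w : 0 <= F w by rewrite lee_fin !mulr_ge0.
transitivity (\int[mu]_t \int[mu]_s F (s, t)).
  apply: eq_integral => t _.
  have mk : measurable_fun setT (fun s : mR => (h (s, y) * \1_(`]s, +oo[%classic) t)%:E).
    apply/measurable_EFinP; apply: measurable_funM.
      by apply: measurableT_comp => //; exact: measurable_fun_pair.
    under eq_fun do rewrite indic_itv_lt.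
    apply: (@measurableT_comp _ _ _ _ _ _ (\1_([set v | v.1 < v.2]%R : set P) : P -> mR)).
      by apply: measurable_indic; exact: measurable_lt_plane.
    exact: measurable_fun_pair.
  rewrite /left_integral -ge0_integralZr//.
  - by move=> s _; rewrite lee_fin mulr_ge0.
transitivity (\int[mu]_s \int[mu]_t F (s, t)).
  by rewrite (@fubini_tonelli _ _ _ _ _ mu mu F mF F0).
apply: eq_integral => s _.
transitivity (\int[mu]_t ((h (s, y) * \1_(`]c, d]%classic) y)%:E *
    (\1_(`]a, b]%classic) t * \1_(`]s, +oo[%classic) t)%:E)).
  by apply: eq_integral => t _; rewrite /F /= -EFinM; congr EFin; ring.
rewrite ge0_integralZl_EFin//.
- by rewrite -tail_lengthE -EFinM; congr EFin; ring.
- by apply/measurable_EFinP; apply: measurable_funM => //; exact: indic_itv_measurable.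
- exact: mulr_ge0.
Qed.

End left_integral.

Section ac_representation.
Context {R : realType}.
Local Notation mR := (measurableTypeR R).
Local Notation P := (mR * mR)%type.
Local Notation mu := (@lebesgue_measure R).

Lemma ae_snd (Q : R -> Prop) : {ae mu, forall y, Q y} -> {ae leb2 R, forall v, Q v.2}.
Proof.
move=> [N [mN N0 QN]]; exists (setT `*` N); split.
- exact: measurableX.
- by rewrite [LHS](@product_measure1E _ _ _ _ _ mu mu)//= N0 mule0.
- by move=> v /= nQ; split => //=; exact: QN.
Qed.

Context (W g : R * R -> R).
Hypothesis iW : (leb2 R).-integrable setT (EFin \o W).
Hypothesis ig : (leb2 R).-integrable setT (EFin \o g).
Hypothesis weak : forall (p p' q : R -> R) (r : R), smooth p -> smooth q ->
  (forall x : R, is_derive x 1 p (p' x)) ->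
  (forall x, r < `|x| -> p x = 0) -> (forall x, r < `|x| -> q x = 0) ->
  \int[leb2 R]_v (W v * (p' v.1 * q v.2)) =
  - (\int[leb2 R]_v (g v * (p v.1 * q v.2))).

Let mW : measurable_fun setT (W : P -> mR).
Proof. by apply/measurable_EFinP; exact: measurable_int iW. Qed.

Let mg : measurable_fun setT (g : P -> mR).
Proof. by apply/measurable_EFinP; exact: measurable_int ig. Qed.

Let pos (f : R * R -> R) (v : P) : R := Num.max (f v) 0.
Let neg (f : R * R -> R) (v : P) : R := Num.max (- f v) 0.

(** By [weak_rectangle], [W] and the left integral of [g] have the same integrals over rectangles.
    Positive and negative parts are moved to opposite sides, so that [plane_ae_eq] compares the
    nonnegative functions [F1] and [F2]. Almost every horizontal line carries an integrable [g];
    there all terms are finite and the parts recombine. *)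
Lemma ac_representation : {ae leb2 R, forall v : R * R,
  mu.-integrable setT (fun s : mR => (g (s, v.2))%:E) /\
  (W v)%:E = (\int[mu]_s (g (s, v.2) * \1_(`]s, +oo[%classic) v.1)%:E)%E}.
Proof.
have pos0 f v : 0 <= pos f v by rewrite le_max lexx orbT.
have neg0 f v : 0 <= neg f v by rewrite le_max lexx orbT.
have posneg f v : f v = pos f v - neg f v.
  by rewrite /pos /neg; case: (ltP (f v) 0); case: (ltP (- f v) 0) => *; lra.
have posle f v : pos f v <= `|f v| by rewrite ge_max ler_norm normr_ge0.
have negle f v : neg f v <= `|f v|.
  by rewrite ge_max normr_ge0 andbT -normrN ler_norm.
have mpos (f : P -> mR) : measurable_fun setT f -> measurable_fun setT (pos f : P -> mR).
  by move=> mf; exact: measurable_maxr.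
have mneg (f : P -> mR) : measurable_fun setT f -> measurable_fun setT (neg f : P -> mR).
  by move=> mf; apply: measurable_maxr => //; exact: measurable_funN.
have ipos (f : P -> mR) : (leb2 R).-integrable setT (EFin \o f) ->
    (leb2 R).-integrable setT (EFin \o (pos f : P -> mR)).
  move=> if_; have mf : measurable_fun setT f by apply/measurable_EFinP; exact: measurable_int if_.
  apply: le_integrable if_ => //; first by apply/measurable_EFinP; exact: mpos.
  by move=> v _ /=; rewrite lee_fin ger0_norm.
have ineg (f : P -> mR) : (leb2 R).-integrable setT (EFin \o f) ->
    (leb2 R).-integrable setT (EFin \o (neg f : P -> mR)).
  move=> if_; have mf : measurable_fun setT f by apply/measurable_EFinP; exact: measurable_int if_.
  apply: le_integrable if_ => //; first by apply/measurable_EFinP; exact: mneg.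
  by move=> v _ /=; rewrite lee_fin ger0_norm.
pose F1 v := ((pos W v)%:E + left_integral (neg g) v)%E.
pose F2 v := ((neg W v)%:E + left_integral (pos g) v)%E.
have splitE (f phi : P -> R) (C : R) : (leb2 R).-integrable setT (EFin \o f) ->
    measurable_fun setT phi -> (forall v, `|phi v| <= C) ->
    \int[leb2 R]_v (f v * phi v) =
    \int[leb2 R]_v (pos f v * phi v) - \int[leb2 R]_v (neg f v * phi v).
  move=> if_ mphi phiC; rewrite -RintegralB//.
  - by apply: eq_Rintegral => v _; rewrite -mulrBl -posneg.
  - exact: (integrable_bounded (ipos _ if_) mphi phiC).
  - exact: (integrable_bounded (ineg _ if_) mphi phiC).
have rectC (a b c d : R) v : `|\1_(`]a, b]%classic) v.1 * \1_(`]c, d]%classic) v.2| <= 1 :> R.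
  by rewrite !indicE; case: (_ \in _); case: (_ \in _); rewrite ?mulr1 ?mulr0 ?normr1 ?normr0.
have tailC (a b c d : R) v : a < b ->
    `|tail_length a b v.1 * \1_(`]c, d]%classic) v.2| <= b + 1 - a.
  move=> ab; rewrite ger0_norm ?mulr_ge0 ?tail_length_ge0//.
  apply: le_trans (tail_length_le v.1 ab).
  by rewrite ler_piMr ?tail_length_ge0// indicE; case: (_ \in _).
have rect (f h : P -> R) (a b c d : R) : a < b ->
    (leb2 R).-integrable setT (EFin \o f) -> (leb2 R).-integrable setT (EFin \o h) ->
    (forall v, 0 <= f v) -> (forall v, 0 <= h v) ->
    (\int[leb2 R]_(v in `]a, b] `*` `]c, d]) ((f v)%:E + left_integral h v))%E =
    (\int[leb2 R]_v (f v * (\1_(`]a, b]%classic) v.1 * \1_(`]c, d]%classic) v.2)) +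
     \int[leb2 R]_v (h v * (tail_length a b v.1 * \1_(`]c, d]%classic) v.2)))%:E.
  move=> ab if_ ih f0 h0.
  have mf : measurable_fun setT f by apply/measurable_EFinP; exact: measurable_int if_.
  have mh : measurable_fun setT h by apply/measurable_EFinP; exact: measurable_int ih.
  have mA : measurable (`]a, b]%classic `*` `]c, d]%classic : set P) by exact: measurableX.
  rewrite ge0_integralD//; last 4 first.
  - by move=> v _; rewrite lee_fin.
  - exact/measurable_EFinP/measurable_funTS.
  - by move=> v _; exact: left_integral_ge0.
  - by apply: measurable_funTS; exact: measurable_left_integral.
  rewrite integral_left_integral// EFinD; congr (_ + _)%E.
    rewrite /Rintegral fineK; last first.
      apply: integrable_fin_num => //.
      exact: (integrable_bounded if_ (measurable_rect_indic _ _ _ _) (rectC _ _ _ _)).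
    rewrite integral_mkcond; apply: eq_integral => -[x y] _.
    rewrite patchE/= !indicE in_setX/=.
    by case: (x \in _); case: (y \in _); rewrite /= ?mulr1 ?mulr0 ?mul0r.
  rewrite /Rintegral fineK//; apply: integrable_fin_num => //.
  exact: (integrable_bounded ih (measurable_tail_indic _ _ _ _) (fun v => tailC _ _ _ _ v ab)).
have rect1 a b c d (ab : a < b) := @rect (pos W) (neg g) a b c d ab
  (ipos _ iW) (ineg _ ig) (pos0 W) (neg0 g).
have rect2 a b c d (ab : a < b) := @rect (neg W) (pos g) a b c d ab
  (ineg _ iW) (ipos _ ig) (neg0 W) (pos0 g).
have aeF : {ae leb2 R, forall v, F1 v = F2 v}.
  apply: plane_ae_eq.
  - apply: emeasurable_funD; first by apply/measurable_EFinP; exact: (mpos _ mW).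
    exact: (measurable_left_integral (mneg _ mg) (neg0 g)).
  - apply: emeasurable_funD; first by apply/measurable_EFinP; exact: (mneg _ mW).
    exact: (measurable_left_integral (mpos _ mg) (pos0 g)).
  - by move=> v; apply: adde_ge0; [rewrite lee_fin; exact: pos0|exact: left_integral_ge0 (neg0 g) v].
  - by move=> v; apply: adde_ge0; [rewrite lee_fin; exact: neg0|exact: left_integral_ge0 (pos0 g) v].
  - move=> _ [A oA [B oB <-]].
    have [->|[[a b] /= ab ->]] := (ocitvP A).1 oA; first by rewrite set0X !integral_set0.
    have [->|[[c d] /= cd ->]] := (ocitvP B).1 oB; first by rewrite setX0 !integral_set0.
    rewrite rect1 ?rect2//; congr EFin.
    have := weak_rectangle iW ig weak ab cd.
    rewrite (splitE _ _ 1 iW (measurable_rect_indic _ _ _ _) (rectC _ _ _ _)).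
    rewrite (splitE _ _ _ ig (measurable_tail_indic _ _ _ _) (fun v => tailC _ _ _ _ v ab)).
    by lra.
  (* The square of index 0 is empty, whereas the rectangle formula asks for [a < b]. *)
  - case=> [|n].
      by rewrite /ocbox (_ : `]- 0, 0]%classic = set0) ?set0X ?integral_set0// oppr0 set_itv_ge// bnd_simp ltxx.
    by rewrite rect1 ?ltry// ; have := ltr0Sn R n; lra.
have aeg := ae_snd (@ae_integrable2 _ _ _ _ _ mu mu _ ig).
have : {ae leb2 R, forall v, F1 v = F2 v /\ mu.-integrable setT (fun s : mR => (g (s, v.2))%:E)}.
  by apply: filterS2 aeF aeg => v.
apply: filterS => v [F12 igv]; split => //.
have mphi : measurable_fun setT (fun s : mR => \1_(`]s, +oo[%classic) v.1 : mR).
  under eq_fun do rewrite indic_itv_lt.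
  apply: (@measurableT_comp _ _ _ _ _ _ (\1_([set v | v.1 < v.2]%R : set P) : P -> mR)).
    by apply: measurable_indic; exact: measurable_lt_plane.
  exact: measurable_fun_pair.
have mv (f : P -> mR) : measurable_fun setT f -> measurable_fun setT (fun s : mR => f (s, v.2)).
  by move=> mf; apply: measurableT_comp => //; exact: measurable_fun_pair.
have iv (f : P -> mR) : measurable_fun setT f -> (forall w, 0 <= f w <= `|g w|) ->
    mu.-integrable setT (fun s : mR => (f (s, v.2) * \1_(`]s, +oo[%classic) v.1)%:E).
  move=> mf fg; apply: le_integrable igv => //.
    by apply/measurable_EFinP; apply: measurable_funM => //; exact: mv.
  move=> s _ /=; have /andP[f0 fle] := fg (s, v.2).
  rewrite lee_fin ger0_norm ?mulr_ge0//; apply: le_trans fle.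
  by rewrite ler_piMr// indicE; case: (_ \in _).
have ip : mu.-integrable setT (fun s : mR => (pos g (s, v.2) * \1_(`]s, +oo[%classic) v.1)%:E).
  by apply: iv => [|w]; [exact: mpos|rewrite pos0 posle].
have in_ : mu.-integrable setT (fun s : mR => (neg g (s, v.2) * \1_(`]s, +oo[%classic) v.1)%:E).
  by apply: iv => [|w]; [exact: mneg|rewrite neg0 negle].
transitivity (left_integral (pos g) v - left_integral (neg g) v)%E.
  have fp : left_integral (pos g) v \is a fin_num by exact: integrable_fin_num.
  have fn : left_integral (neg g) v \is a fin_num by exact: integrable_fin_num.
  move: F12; rewrite /F1 /F2 -(fineK fp) -(fineK fn) -!EFinD => -[E].
  by congr EFin; rewrite (posneg W); lra.
rewrite /left_integral -integralB//; apply: eq_integral => s _.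
by rewrite -EFinB -mulrBl -posneg.
Qed.

End ac_representation.

(** * Increments of a filter along a deformation *)

Section weak_partial_derivatives.
Context {R : realType}.
Local Notation mR := (measurableTypeR R).
Local Notation P := (mR * mR)%type.

(** The weak derivative in the first variable, tested against products; their limits already reach
    rectangles. *)
Definition weak_partial (W g : R * R -> R) : Prop :=
  forall (p p' q : R -> R) (r : R), smooth p -> smooth q ->
  (forall x : R, is_derive x 1 p (p' x)) ->
  (forall x, r < `|x| -> p x = 0) -> (forall x, r < `|x| -> q x = 0) ->
  \int[leb2 R]_v (W v * (p' v.1 * q v.2)) =
  - (\int[leb2 R]_v (g v * (p v.1 * q v.2))).

Lemma derive_tensor (p p' q q' : R -> R) (w v : R * R) :
  (forall x : R, is_derive x 1 p (p' x)) -> (forall x : R, is_derive x 1 q (q' x)) ->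
  'D_w (fun v : R * R => p v.1 * q v.2) v = w.1 * (p' v.1 * q v.2) + w.2 * (p v.1 * q' v.2).
Proof.
move=> Dp Dq.
have [d1 e1] := diff_fst_comp v Dp; have [d2 e2] := diff_snd_comp v Dq.
rewrite deriveE; last exact: differentiableM.
rewrite (diffM d1 d2).
transitivity (p v.1 * (w.2 * q' v.2) + q v.2 * (w.1 * p' v.1)); last by ring.
have e1w := congr1 (fun F : R * R -> R => F w) e1.
have e2w := congr1 (fun F : R * R -> R => F w) e2.
exact: (congr2 (fun x y => p v.1 * x + q v.2 * y) e2w e1w).
Qed.

Lemma weak_gradient_partial1 W dW : weak_gradient W dW ->
  weak_partial W (fun v => (dW v).1).
Proof.
move=> wW p p' q r sp sq Dp p0 q0.
have [q' _ Dq] := smooth_derive sq.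
have [+ _] := wW _ (tensor_test_function sp sq p0 q0).
move=> <-; apply: eq_Rintegral => v _; congr (_ * _).
by rewrite (derive_tensor _ _ Dp Dq)/= mul1r mul0r addr0.
Qed.

Lemma Rintegral_swap (f : P -> R) : measurable_fun setT f ->
  \int[leb2 R]_v f (pswap v) = \int[leb2 R]_v f v.
Proof.
move=> mf; rewrite /Rintegral; congr fine; apply/esym.
rewrite (@integral_substitution _ (@pswap R) (cst 1) f)//.
  by apply: eq_integral => v _; rewrite mulr1.
move=> h mh h0; rewrite -(ge0_integral_swap mh h0).
by apply: eq_integral => v _; rewrite mule1.
Qed.

Lemma smooth_measurable (p : R -> R) : smooth p -> measurable_fun setT (p : mR -> mR).
Proof. by move=> sp; apply: continuous_measurable_fun; exact: smooth_continuous. Qed.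

(** Exchanging the coordinates lets one argument in the first variable serve for both. *)
Lemma weak_gradient_partial2 W dW : weak_gradient W dW ->
  measurable_fun setT (W : P -> mR) -> measurable_fun setT (fun v : P => (dW v).2 : mR) ->
  weak_partial (fun v => W (pswap v)) (fun v => (dW (pswap v)).2).
Proof.
move=> wW mW mdW p p' q r sp sq Dp p0 q0.
have [q' _ Dq] := smooth_derive sq.
have mp : measurable_fun setT (p : mR -> mR) by exact: smooth_measurable.
have mq : measurable_fun setT (q : mR -> mR) by exact: smooth_measurable.
have mp' : measurable_fun setT (p' : mR -> mR).
  have [p2 sp2 D2] := smooth_derive sp.
  have -> : p' = p2 by apply/funext => x; have [_ <-] := Dp x; have [_ <-] := D2 x.
  exact: smooth_measurable.
have [_ H] := wW _ (tensor_test_function sq sp q0 p0).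
rewrite (@Rintegral_swap (fun v => W v * (p' v.2 * q v.1))); last first.
  by apply: measurable_funM => //; apply: measurable_funM; apply: measurableT_comp.
rewrite (@Rintegral_swap (fun v => (dW v).2 * (p v.2 * q v.1))); last first.
  by apply: measurable_funM => //; apply: measurable_funM; apply: measurableT_comp.
under [in RHS]eq_Rintegral do rewrite [p _ * _]mulrC.
rewrite -H; apply: eq_Rintegral => v _; congr (_ * _).
by rewrite (derive_tensor _ _ Dq Dp)/= mul1r mul0r add0r mulrC.
Qed.

End weak_partial_derivatives.

Section euclidean_norm.
Context {R : realType}.
Local Notation mR := (measurableTypeR R).
Local Notation P := (mR * mR)%type.

Lemma eucl_ge0 (v : R * R) : 0 <= eucl v.
Proof. exact: sqrtr_ge0. Qed.

Lemma sqr_eucl (v : R * R) : eucl v ^+ 2 = v.1 ^+ 2 + v.2 ^+ 2.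
Proof. by rewrite sqr_sqrtr// addr_ge0// sqr_ge0. Qed.

Lemma ler_eucl (x : R) (v : R * R) : x ^+ 2 <= v.1 ^+ 2 + v.2 ^+ 2 -> x <= eucl v.
Proof.
rewrite -sqr_eucl => h; have [x0|x0] := ltP x 0.
  by apply: le_trans (eucl_ge0 v); exact: ltW.
by rewrite -(@ler_pXn2r _ 2)// nnegrE eucl_ge0.
Qed.

(** 10/7 is a rational bound for the square root of 2. *)
Lemma eucl_sum (v : R * R) : `|v.1| + `|v.2| <= 10 / 7 * eucl v.
Proof.
suff : 7 / 10 * (`|v.1| + `|v.2|) <= eucl v by lra.
apply: ler_eucl.
have := sqr_ge0 (`|v.1| - `|v.2|).
rewrite -(real_normK (num_real v.1)) -(real_normK (num_real v.2)).
have := sqr_ge0 `|v.1|; have := sqr_ge0 `|v.2|.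
by nra.
Qed.

Lemma measurable_eucl : measurable_fun setT (@eucl R : P -> mR).
Proof.
apply: (@measurableT_comp _ _ _ _ _ _ (@Num.sqrt R : mR -> mR)).
  by apply: continuous_measurable_fun; exact: sqrt_continuous.
by apply: measurable_funD; apply: measurable_funX.
Qed.

Lemma eucl_contraction (e : R) (v w : R * R) : 0 < e -> 5 * e < 1 ->
  w.1 ^+ 2 + w.2 ^+ 2 <= e ^+ 2 * (v.1 ^+ 2 + v.2 ^+ 2) ->
  eucl v <= 5 / 4 * eucl (v - w).
Proof.
move=> e0 e5 h.
suff : 4 / 5 * eucl v <= eucl (v - w) by lra.
apply: ler_eucl; rewrite exprMn sqr_eucl /=.
have v0 : 0 <= v.1 ^+ 2 + v.2 ^+ 2 by rewrite addr_ge0 ?sqr_ge0.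
have e2 : e ^+ 2 <= 1 / 25 by nra.
have h2 : w.1 ^+ 2 + w.2 ^+ 2 <= 1 / 25 * (v.1 ^+ 2 + v.2 ^+ 2).
  by apply: le_trans h _; rewrite ler_wpM2r.
(* The square of v - 5 w bounds the cross term: |v - w|^2 is at least 4/5 |v|^2 - 4 |w|^2, hence at
   least 16/25 |v|^2. *)
have := sqr_ge0 (v.1 - 5 * w.1); have := sqr_ge0 (v.2 - 5 * w.2).
clear -h2; move: (v.1) (v.2) (w.1) (w.2) h2 => a b c d; lra.
Qed.

End euclidean_norm.

Section segment_increment.
Context {R : realType}.
Local Notation mR := (measurableTypeR R).
Local Notation mu := (@lebesgue_measure R).
Local Open Scope ereal_scope.

Lemma ge0_integral_line_affine (f : R -> \bar R) (x h : R) : h != 0%R ->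
  measurable_fun setT (f : mR -> _) -> (forall s, 0 <= f s) ->
  \int[mu]_s f s = \int[mu]_t (f (x + t * h)%R * `|h|%:E).
Proof.
move=> h0 mf f0.
have D (k : R) (t : R) : is_derive t 1%R (fun t => x + t * k)%R k.
  apply/is_derive_eps => eta eta0; exists 1%R => // r _ /=.
  rewrite (_ : x + (t + r) * k - (x + t * k) - k * r = 0)%R; last by ring.
  by rewrite normr0 mulr_ge0// ltW.
have pos (k : R) : (0 < k)%R -> \int[mu]_s f s = \int[mu]_t (f (x + t * k)%R * k%:E).
  move=> k0; apply: (ge0_integral_expanding k0 (D k)) => // t.
  exact: cvg_cst.
have [h1|h1] := ltP 0%R h.
  by rewrite (pos h h1); apply: eq_integral => t _; rewrite gtr0_norm.
have h2 : (0 < - h)%R by rewrite oppr_gt0 lt_neqAle h0.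
rewrite (pos (- h)%R h2) ler0_norm//.
rewrite -(@ge0_integral_line_opp _ (fun t => f (x + t * - h)%R * (- h)%:E)).
- by apply: eq_integral => t _; rewrite mulNr mulrN opprK.
- apply: emeasurable_funM => //; apply: measurableT_comp => //.
  apply: continuous_measurable_fun; exact: is_derive_continuous (D (- h)%R).
- by move=> t; rewrite mule_ge0// lee_fin ltW.
Qed.

(* The right-hand side is the integral of [|f|] between [x] and [x + h], parametrized *)
(* by [0, 1] so that Tonelli's theorem can exchange it with an integral in [x].        *)
Lemma increment_le (f : R -> R) (x h : R) :
  mu.-integrable setT (EFin \o (f : mR -> R)) ->
  `|\int[mu]_s (f s * \1_(`]s, +oo[%classic) (x + h)%R)%:E -
    \int[mu]_s (f s * \1_(`]s, +oo[%classic) x)%:E| <=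
  \int[mu]_t (`|f (x + t * h)| * `|h| * \1_(`[0%R, 1%R]%classic) t)%:E.
Proof.
move=> if_.
have mf : measurable_fun setT (f : mR -> mR) by apply/measurable_EFinP; exact: measurable_int if_.
have mi (y : R) : measurable_fun setT (fun s : mR => \1_(`]s, +oo[%classic) y : mR).
  under eq_fun do rewrite indic_itv_lt.
  apply: (@measurableT_comp _ _ _ _ _ _ (\1_([set v | v.1 < v.2]%R : set (mR * mR)%type) : (mR * mR)%type -> mR)).
    by apply: measurable_indic; exact: measurable_lt_plane.
  exact: measurable_fun_pair.
have int (y : R) : mu.-integrable setT (fun s : mR => (f s * \1_(`]s, +oo[%classic) y)%:E).
  apply: le_integrable if_ => //.
    by apply/measurable_EFinP; exact: (measurable_funM mf (mi y)).
  move=> s _ /=; rewrite lee_fin normrM ler_piMr//.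
  by rewrite ger0_norm// indicE; case: (_ \in _).
rewrite -integralB//.
have [->|h0] := eqVneq h 0%R.
  rewrite addr0 integral0_eq ?abse0//; last by move=> s _; rewrite -EFinB subrr.
  by apply: integral_ge0 => t _; rewrite lee_fin; apply: mulr_ge0 => //; apply: mulr_ge0.
have mS : measurable_fun setT (fun s : mR =>
    `|f s * \1_(`]s, +oo[%classic) (x + h)%R - f s * \1_(`]s, +oo[%classic) x|%:E).
  apply/measurable_EFinP; apply: measurableT_comp => //.
  exact: (measurable_funB (measurable_funM mf (mi _)) (measurable_funM mf (mi _))).
apply: (@le_trans _ _ (\int[mu]_s
    `|f s * \1_(`]s, +oo[%classic) (x + h)%R - f s * \1_(`]s, +oo[%classic) x|%:E)).
  apply: le_trans (le_abse_integral _ _ _) _ => //.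
  by apply: emeasurable_funB; apply/measurable_EFinP; exact: (measurable_funM mf (mi _)).
rewrite (ge0_integral_line_affine x h0 mS)//.
apply: ge0_le_integral => //.
- apply: emeasurable_funM => //; apply: (@measurableT_comp _ _ _ _ _ _ (fun s : mR =>
    `|f s * \1_(`]s, +oo[%classic) (x + h)%R - f s * \1_(`]s, +oo[%classic) x|%:E)) => //.
  by apply: measurable_funD => //; apply: measurable_funM.
- apply/measurable_EFinP; apply: measurable_funM; last exact: indic_itv_measurable.
  apply: measurable_funM => //; apply: measurableT_comp => //; apply: measurableT_comp => //.
  by apply: measurable_funD => //; apply: measurable_funM.
move=> t _; rewrite -EFinM lee_fin -mulrA [(`|h| * _)%R]mulrC mulrA ler_wpM2r//.
rewrite -mulrBr normrM ler_wpM2l//.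
(* At [s = x + t * h] the two indicators can differ only for [t] in [[0, 1]], whatever the sign of
   [h]. *)
rewrite !indicE !mem_setE !in_itv/= !andbT.
have -> : (x + t * h < x + h = (t * h < h))%R by rewrite ltrD2l.
have -> : (x + t * h < x = (t * h < 0))%R by rewrite gtrDl.
have [hp|hn] := ltP 0%R h.
  have -> : (t * h < h = (t < 1))%R by rewrite -[X in (_ < X)%R]mul1r ltr_pM2r.
  rewrite pmulr_llt0//; case: (ltP t 0%R) => t0.
    by rewrite (lt_trans t0 ltr01) subrr normr0 ler0n.
  by case: (ltP t 1%R) => t1; rewrite ?subrr ?subr0 ?normr0 ?normr1 ?ler0n// (ltW t1).
have {}hn : (h < 0)%R by rewrite lt_neqAle h0.
have -> : (t * h < h = (1 < t))%R by rewrite -[X in (_ < X)%R]mul1r ltr_nM2r.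
rewrite nmulr_llt0//; case: (ltP 0%R t) => t0; case: (ltP 1%R t) => t1.
- by rewrite subrr normr0 ler0n.
- by rewrite sub0r normrN1 (ltW t0).
- by have := lt_le_trans t1 t0; rewrite ltNge ler01.
- by rewrite subrr normr0 ler0n.
Qed.

End segment_increment.

Section deformation_increment.
Context {R : realType}.
Local Notation mR := (measurableTypeR R).
Local Notation P := (mR * mR)%type.
Local Notation mu := (@lebesgue_measure R).
Local Open Scope ereal_scope.

Context (e : R) (delta : R * R -> R * R) (a b c d : R * R -> R).
Hypotheses (e0 : (0 < e)%R) (e5 : (5 * e < 1)%R) (deltaC : C1_contraction e delta a b c d).
Hypothesis delta0 : delta 0%R = 0%R.

Let mdelta : measurable_fun setT (delta : P -> P).
Proof. exact: contraction_measurable deltaC. Qed.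

Lemma contraction_at0 v : ((delta v).1 ^+ 2 + (delta v).2 ^+ 2 <=
  e ^+ 2 * (v.1 ^+ 2 + v.2 ^+ 2))%R.
Proof. by have := contraction_lip deltaC v 0%R; rewrite delta0 /= !subr0. Qed.

(** The points [T 1 v] and [T 0 v] lie on one horizontal line, and at almost every [v] the
    representation of [W] holds at both by [ae_contraction]. The increment is then bounded by the
    integral of |g| along the segment [T t v]. For fixed [t], |delta_1 v| is at most e |v|, hence at
    most 5/4 e |T t v|, and substituting [T t v] costs a factor 25/14. *)
Lemma increment_coord1 (W g : P -> R) :
  measurable_fun setT (W : P -> mR) -> measurable_fun setT (g : P -> mR) ->
  {ae leb2 R, forall v : R * R,
  mu.-integrable setT (fun s : mR => (g (s, v.2))%:E) /\
  (W v)%:E = \int[mu]_s (g (s, v.2) * \1_(`]s, +oo[%classic) v.1)%:E} ->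
  \int[leb2 R]_v (`|W (v - delta v) - W (v.1, v.2 - (delta v).2)|)%:E <=
  (e * (5 / 4) * (25 / 14))%:E * \int[leb2 R]_v (eucl v * `|g v|)%:E.
Proof.
move=> mW mg aeW.
have C t : (0 <= t <= 1)%R -> C1_contraction e (fun v => (t * (delta v).1, 1 * (delta v).2)%R)
    (fun v => t * a v)%R (fun v => t * b v)%R (fun v => 1 * c v)%R (fun v => 1 * d v)%R.
  move=> t01; apply: (contraction_scale deltaC t01); by rewrite ler01 lexx.
pose T t (v : P) : P := (v.1 - t * (delta v).1, v.2 - (delta v).2)%R.
have TE t v : T t v = (v - (t * (delta v).1, 1 * (delta v).2))%R.
  by rewrite /T mul1r.
have ae1 := ae_contraction e0 e5 (C 1%R ltac:(by rewrite ler01 lexx)) aeW.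
have ae0 := ae_contraction e0 e5 (C 0%R ltac:(by rewrite ler01 lexx)) aeW.
pose F (w : P * mR) : \bar R := (`|g (T w.2 w.1)| * `|(delta w.1).1| *
   \1_(`[0%R, 1%R]%classic) w.2)%:E.
have md1 : measurable_fun setT (fun v : P => (delta v).1 : mR) by exact: measurableT_comp.
have md2 : measurable_fun setT (fun v : P => (delta v).2 : mR) by exact: measurableT_comp.
have mT : measurable_fun setT (fun w : P * mR => T w.2 w.1).
  apply: measurable_fun_pair.
    apply: measurable_funB; first exact: measurableT_comp.
    by apply: measurable_funM => //; exact: (measurableT_comp md1).
  apply: measurable_funB; first exact: measurableT_comp.
  exact: (measurableT_comp md2).
have mTt t : measurable_fun setT (T t).
  apply: measurable_fun_pair; apply: measurable_funB => //.
  by apply: measurable_funM.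
have mF : measurable_fun setT F.
  apply/measurable_EFinP; apply: measurable_funM.
    apply: measurable_funM; apply: measurableT_comp => //.
      exact: (measurableT_comp mg mT).
    exact: (measurableT_comp md1).
  by apply: measurableT_comp => //; exact: indic_itv_measurable.
have F0 w : 0 <= F w by rewrite lee_fin; apply: mulr_ge0 => //; apply: mulr_ge0.
apply: (@le_trans _ _ (\int[leb2 R]_v \int[mu]_t F (v, t))).
  apply: ae_ge0_le_integral => //.
  - apply/measurable_EFinP; apply: measurableT_comp => //; apply: measurable_funB.
      have := measurableT_comp mW (mTt 1%R).
      rewrite (_ : W \o T 1%R = fun v => W (v - delta v)%R)//.
      by apply/funext => v; rewrite /= /T mul1r.
    have := measurableT_comp mW (mTt 0%R).
    rewrite (_ : W \o T 0%R = fun v => W (v.1, v.2 - (delta v).2)%R)//.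
    by apply/funext => v; rewrite /= /T mul0r subr0.
  - by move=> v _; exact: integral_ge0.
  - exact: (measurable_fun_fubini_tonelli_F F).
  apply: (@filterS2 _ _ (ae_filter_ringOfSetsType (leb2 R)) _ _ _ _ ae1 ae0) => v [i1 E1] [_ E0] _.
  have q1 : (v - (1 * (delta v).1, 1 * (delta v).2) = v - delta v)%R.
    by rewrite !mul1r -surjective_pairing.
  have q0 : (v - (0 * (delta v).1, 1 * (delta v).2) = (v.1, v.2 - (delta v).2))%R.
    by rewrite mul0r mul1r; congr pair; rewrite /= subr0.
  rewrite q1 in i1 E1; rewrite q0 in E0.
  rewrite -[X in X <= _]/(`|(W (v - delta v)%R)%:E - (W (v.1, (v.2 - (delta v).2)%R))%:E|) E1 E0.
  have := increment_le v.1 (- (delta v).1) i1.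
  move=> /le_trans; apply; apply: ge0_le_integral => //.
  - apply/measurable_EFinP; apply: measurable_funM; last exact: indic_itv_measurable.
    apply: measurable_funM => //; apply: measurableT_comp => //.
    apply: measurableT_comp => //; apply: measurable_fun_pair => //.
    by apply: measurable_funD => //; exact: measurable_funM.
  - exact: (measurableT_comp mF (@pair1_measurable _ _ P mR v)).
  by move=> t _; rewrite /F /T /= normrN mulrN.
rewrite (@fubini_tonelli _ _ _ _ _ (sigma_leb2 R) mu F mF F0).
set I := (\int[leb2 R]_v (eucl v * `|g v|)%:E).
have I0 : 0 <= I by apply: integral_ge0 => v _; rewrite lee_fin mulr_ge0// eucl_ge0.
set K := (e * (5 / 4) * (25 / 14))%R.
have K0 : (0 <= K)%R by rewrite /K; move: e0; lra.
apply: (@le_trans _ _ (\int[mu]_t (K%:E * I * (\1_(`[0%R, 1%R]%classic) t)%:E))); last first.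
  have m01 := (measurable_EFinP setT _).2 (@indic_itv_measurable R `[0%R, 1%R]).
  have KI0 : 0 <= K%:E * I by exact: mule_ge0.
  rewrite ge0_integralZl//.
  rewrite integral_indic// setIT /= (lebesgue_measure_itv `[0%R, 1%R])/= lte_fin ltr01.
  by rewrite oppr0 adde0 mule1.
apply: ge0_le_integral => //.
- by move=> t _; exact: integral_ge0.
- exact: (measurable_fun_fubini_tonelli_G F).
- apply: measurable_funeM; exact: ((measurable_EFinP setT _).2 (@indic_itv_measurable R `[0%R, 1%R])).
move=> t _; rewrite indicE; have [|tn] := boolP (t \in _); last first.
  rewrite mule0 integral0_eq// => v _; rewrite /F /= indicE (negbTE tn) mulr0//.
rewrite inE/= in_itv/= => t01; rewrite mule1.
have := @ge0_integral_contraction_le _ _ _ _ _ _ _ e0 e5 (C t t01) (fun w => (eucl w * `|g w|)%:E).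
have mh : measurable_fun setT (fun w : P => (eucl w * `|g w|)%:E).
  apply/measurable_EFinP; apply: measurable_funM; first exact: measurable_eucl.
  exact: measurableT_comp.
move=> /(_ mh) /(_ (fun w => ltac:(by rewrite lee_fin mulr_ge0// eucl_ge0))) H.
have mhT : measurable_fun setT (fun v : P => (eucl (T t v) * `|g (T t v)|)%:E).
  exact: (measurableT_comp mh (mTt t)).
apply: (@le_trans _ _ ((e * (5 / 4))%:E * \int[leb2 R]_v (eucl (T t v) * `|g (T t v)|)%:E)).
  have r0 : (0 <= e * (5 / 4))%R by move: e0; lra.
  rewrite -ge0_integralZl_EFin//; last first.
    by move=> v _; rewrite lee_fin mulr_ge0// eucl_ge0.
  apply: ge0_le_integral => //.
  - exact: (measurableT_comp mF (@pair2_measurable _ _ P mR t)).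
  - by apply: emeasurable_funM.
  move=> v _; rewrite /F /= -EFinM lee_fin indicE mem_set ?mulr1; last by rewrite /= in_itv.
  rewrite mulrA [leRHS]mulrC ler_wpM2l//.
  have d1 : (`|(delta v).1| <= e * eucl v)%R.
    apply: normr_le_sqr; first by rewrite mulr_ge0 ?eucl_ge0// ltW.
    rewrite exprMn sqr_eucl; apply: le_trans (contraction_at0 v).
    by rewrite lerDl sqr_ge0.
  apply: (le_trans d1); rewrite -mulrA ler_pM2l// TE.
  apply: (eucl_contraction e0 e5) => /=.
  have := contraction_lip (C t t01) v 0%R; rewrite delta0 /= !mulr0 !subr0.
  by [].
rewrite /K [X in _ <= X * _]EFinM -muleA; apply: lee_wpmul2l; first by rewrite lee_fin; move: e0; lra.
apply: le_trans H; rewrite le_eqVlt; apply/orP; left; apply/eqP.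
by apply: eq_integral => v _; rewrite TE.
Qed.

End deformation_increment.

Section increment_bound.
Context {R : realType}.
Local Notation mR := (measurableTypeR R).
Local Notation P := (mR * mR)%type.
Local Notation mu := (@lebesgue_measure R).
Local Open Scope ereal_scope.

Lemma eucl_pswap (v : R * R) : eucl (pswap v) = eucl v.
Proof. by rewrite /eucl addrC. Qed.

Context (e : R) (delta : R * R -> R * R) (a b c d : R * R -> R).
Hypotheses (e0 : (0 < e)%R) (e5 : (5 * e < 1)%R) (deltaC : C1_contraction e delta a b c d).
Hypothesis delta0 : delta 0%R = 0%R.
Context (W : R * R -> R) (dW : R * R -> R * R).
Hypothesis wW : weak_gradient W dW.
Hypothesis iW : (leb2 R).-integrable setT (EFin \o W).
Hypothesis id1 : (leb2 R).-integrable setT (fun v => (dW v).1%:E).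
Hypothesis id2 : (leb2 R).-integrable setT (fun v => (dW v).2%:E).

Let mW : measurable_fun setT (W : P -> mR).
Proof. by apply/measurable_EFinP; exact: measurable_int iW. Qed.

Let md1 : measurable_fun setT (fun v : P => (dW v).1 : mR).
Proof. by apply/measurable_EFinP; exact: measurable_int id1. Qed.

Let md2 : measurable_fun setT (fun v : P => (dW v).2 : mR).
Proof. by apply/measurable_EFinP; exact: measurable_int id2. Qed.

Let mswap : measurable_fun setT (@pswap R : P -> P).
Proof. exact: measurable_fun_pair. Qed.

Lemma integrable_pswap (f : P -> R) : (leb2 R).-integrable setT (EFin \o f) ->
  (leb2 R).-integrable setT (EFin \o (fun v => f (pswap v))).
Proof.
move=> if_; have mf := measurable_int _ if_.
apply/integrableP; split; first exact: (measurableT_comp mf mswap).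
case/integrableP : if_ => _; apply: le_lt_trans; rewrite le_eqVlt; apply/orP; left; apply/eqP.
by apply: (@ge0_integral_swap _ (fun v => `|(f v)%:E|)) => //; exact: measurableT_comp.
Qed.

Let K : R := (e * (5 / 4) * (25 / 14))%R.

Lemma increment_first :
  \int[leb2 R]_v (`|W (v - delta v) - W (v.1, v.2 - (delta v).2)|)%:E <=
  K%:E * \int[leb2 R]_v (eucl v * `|(dW v).1|)%:E.
Proof.
apply: (increment_coord1 e0 e5 deltaC delta0 mW md1).
exact: (ac_representation iW id1 (weak_gradient_partial1 wW)).
Qed.

(** The estimate for the first coordinate, applied after the swap to the field whose other component
    is scaled to 0. *)
Lemma increment_second :
  \int[leb2 R]_v (`|W (v.1, v.2 - (delta v).2) - W v|)%:E <=
  K%:E * \int[leb2 R]_v (eucl v * `|(dW v).2|)%:E.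
Proof.
have C := contraction_scale (contraction_swap deltaC) (t := 1%R) (s := 0%R)
  ltac:(by rewrite ler01 lexx) ltac:(by rewrite ler01 lexx).
have := increment_coord1 e0 e5 C _ (measurableT_comp mW mswap) (measurableT_comp md2 mswap)
  (ac_representation (integrable_pswap iW) (integrable_pswap id2)
    (weak_gradient_partial2 wW mW md2)).
rewrite mul0r mul1r (_ : pswap (0 : R * R)%R = 0%R)// delta0 => /(_ erefl).
have mh1 : measurable_fun setT (fun v : P => (`|W (v.1, v.2 - (delta v).2) - W v|)%:E).
  apply/measurable_EFinP; apply: measurableT_comp => //; apply: measurable_funB => //.
  apply: measurableT_comp => //; apply: measurable_fun_pair => //.
  apply: measurable_funB => //; apply: measurableT_comp => //.
  exact: contraction_measurable deltaC.
have mh2 : measurable_fun setT (fun v : P => (eucl v * `|(dW v).2|)%:E).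
  apply/measurable_EFinP; apply: measurable_funM; first exact: measurable_eucl.
  exact: measurableT_comp.
rewrite -(@ge0_integral_swap _ _ mh1)// -(@ge0_integral_swap _ _ mh2)//; last first.
  by move=> v; rewrite lee_fin mulr_ge0// eucl_ge0.
have -> : \int[leb2 R]_v (eucl (pswap v) * `|(dW (pswap v)).2|)%:E =
  \int[leb2 R]_v (eucl v * `|(dW (pswap v)).2|)%:E.
  by apply: eq_integral => v _; rewrite eucl_pswap.
apply: le_trans; rewrite le_eqVlt; apply/orP; left; apply/eqP.
apply: eq_integral => -[x y] _ /=; rewrite /pswap/=.
by rewrite !(mul0r, mul1r) !subr0.
Qed.

(** The two coordinates are moved one after the other. The constant comes from 5/4 * 25/14 * 10/7,
    which is below 16/5. *)
Lemma increment_bound :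
  \int[leb2 R]_v (`|W (v - delta v) - W v|)%:E <=
  (16 / 5 * e)%:E * L1norm (fun v => eucl v * eucl (dW v))%R.
Proof.
have mdelta : measurable_fun setT (delta : P -> P) by exact: contraction_measurable deltaC.
have mA : measurable_fun setT (fun v : P => W (v - delta v)%R : mR).
  apply: measurableT_comp => //; apply: measurable_fun_pair; apply: measurable_funB => //;
  exact: measurableT_comp.
have mB : measurable_fun setT (fun v : P => W (v.1, v.2 - (delta v).2)%R : mR).
  apply: measurableT_comp => //; apply: measurable_fun_pair => //.
  by apply: measurable_funB => //; exact: measurableT_comp.
have m1 : measurable_fun setT (fun v : P => (`|W (v - delta v) - W (v.1, v.2 - (delta v).2)|)%:E).
  by apply/measurable_EFinP; apply: measurableT_comp => //; exact: measurable_funB.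
have m2 : measurable_fun setT (fun v : P => (`|W (v.1, v.2 - (delta v).2) - W v|)%:E).
  by apply/measurable_EFinP; apply: measurableT_comp => //; exact: measurable_funB.
apply: (@le_trans _ _ (\int[leb2 R]_v ((`|W (v - delta v) - W (v.1, v.2 - (delta v).2)|)%:E +
  (`|W (v.1, v.2 - (delta v).2) - W v|)%:E))).
  apply: ge0_le_integral => //.
  - apply/measurable_EFinP; apply: measurableT_comp => //; exact: measurable_funB.
  - exact: emeasurable_funD.
  move=> v _; rewrite -EFinD lee_fin.
  by rewrite (_ : W (v - delta v) - W v = (W (v - delta v) - W (v.1, v.2 - (delta v).2)) +
    (W (v.1, v.2 - (delta v).2) - W v))%R ?ler_normD//; ring.
rewrite ge0_integralD//.
apply: (le_trans (leeD increment_first increment_second)).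
have n1 : measurable_fun setT (fun v : P => (eucl v * `|(dW v).1|)%:E).
  by apply/measurable_EFinP; apply: measurable_funM; [exact: measurable_eucl|exact: measurableT_comp].
have n2 : measurable_fun setT (fun v : P => (eucl v * `|(dW v).2|)%:E).
  by apply/measurable_EFinP; apply: measurable_funM; [exact: measurable_eucl|exact: measurableT_comp].
have n10 (v : P) : 0 <= (eucl v * `|(dW v).1|)%:E by rewrite lee_fin mulr_ge0// eucl_ge0.
have n20 (v : P) : 0 <= (eucl v * `|(dW v).2|)%:E by rewrite lee_fin mulr_ge0// eucl_ge0.
have K0 : (0 <= K)%R by rewrite /K; move: e0; lra.
have mdW : measurable_fun setT (fun v : P => (eucl v * eucl (dW v))%R : mR).
  apply: measurable_funM; first exact: measurable_eucl.
  rewrite (_ : (fun v : P => eucl (dW v)) = @eucl R \o (fun v => ((dW v).1, (dW v).2))).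
    by apply: measurableT_comp; [exact: measurable_eucl|exact: measurable_fun_pair].
  by apply/funext => v /=; rewrite -surjective_pairing.
rewrite -ge0_muleDr ?integral_ge0// -ge0_integralD// /L1norm.
have s0 : (0 <= 16 / 5 * e)%R by move: e0; lra.
rewrite -!ge0_integralZl_EFin//; last 3 first.
- by apply/measurable_EFinP; exact: measurableT_comp.
- by move=> v _; rewrite adde_ge0.
- exact: emeasurable_funD.
apply: ge0_le_integral => //.
- by move=> v _; rewrite mule_ge0// adde_ge0.
- by apply: emeasurable_funM => //; exact: emeasurable_funD.
- by apply: emeasurable_funM => //; apply/measurable_EFinP; exact: measurableT_comp.
move=> v _; rewrite -EFinD -!EFinM lee_fin.
rewrite [X in (_ <= _ * X)%R]ger0_norm; last by rewrite mulr_ge0 ?eucl_ge0.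
have h := eucl_sum (dW v).
have h1 := eucl_ge0 v; have h2 := eucl_ge0 (dW v).
rewrite -mulrDr.
have h3 : (eucl v * (`|(dW v).1| + `|(dW v).2|) <= eucl v * (10 / 7 * eucl (dW v)))%R.
  by rewrite ler_wpM2l.
apply: (@le_trans _ _ (K * (eucl v * (10 / 7 * eucl (dW v))))%R); first by rewrite ler_wpM2l.
have h4 : (0 <= e * (eucl v * eucl (dW v)))%R by apply: mulr_ge0; [exact: ltW|exact: mulr_ge0].
by rewrite /K; lra.
Qed.

End increment_bound.

(** * Schur's test *)

Section schur_test.
Context {R : realType}.
Local Notation mR := (measurableTypeR R).
Local Notation P := (mR * mR)%type.
Local Open Scope ereal_scope.

Context (m n : nat) (K : 'I_m -> 'I_n -> P * P -> R) (f : 'I_m -> P -> R) (w : P -> R).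
Context (A A' : R).
Hypothesis mK : forall i j, measurable_fun setT (K i j : P * P -> mR).
Hypothesis K0 : forall i j p, (0 <= K i j p)%R.
Hypothesis mf : forall i, measurable_fun setT (f i : P -> mR).
Hypothesis f0 : forall i p, (0 <= f i p)%R.
Hypothesis mw : measurable_fun setT (w : P -> mR).
Hypothesis w0 : forall p, (0 <= w p)%R.
Hypothesis A0 : (0 < A)%R.
Hypothesis A'0 : (0 <= A')%R.
Hypothesis rows : forall j u, \sum_(i < m) \int[leb2 R]_z (K i j (u, z))%:E <= A%:E.
Hypothesis cols : forall i z, \sum_(j < n) \int[leb2 R]_u (K i j (u, z))%:E <= (A' * w z)%:E.

Let mff i : measurable_fun setT (fun z : P => f i z ^+ 2 : mR)%R.
Proof. by have := measurable_funM (mf i) (mf i). Qed.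

(** Cauchy-Schwarz for the kernel as a measure in [z] and [i], of total mass at most [A], derived
    from AM-GM with a free parameter [t]. *)
Lemma schur_pointwise j u :
  (\sum_(i < m) \int[leb2 R]_z (K i j (u, z) * f i z)%:E) ^+ 2 <=
  A%:E * \sum_(i < m) \int[leb2 R]_z (K i j (u, z) * f i z ^+ 2)%:E.
Proof.
set g := \sum_(i < m) _; set h := \sum_(i < m) _.
have mKu i : measurable_fun setT (fun z : P => K i j (u, z) : mR).
  exact: (measurableT_comp (mK i j) (@pair1_measurable _ _ P P u)).
have g0 : 0 <= g.
  by apply: sume_ge0 => i _; apply: integral_ge0 => z _; rewrite lee_fin mulr_ge0.
have h0 : 0 <= h.
  apply: sume_ge0 => i _; apply: integral_ge0 => z _; rewrite lee_fin mulr_ge0//.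
  exact: sqr_ge0.
have [->|hfin] := eqVneq h +oo.
  by rewrite gt0_muley ?lte_fin// leey.
have {hfin} /fineK hE : h \is a fin_num by rewrite ge0_fin_numE// ltey.
have key t : (0 <= t)%R -> (2 * t)%:E * g <= h + (t ^+ 2 * A)%:E.
  move=> t0; apply: (@le_trans _ _ (h + (t ^+ 2)%:E * \sum_(i < m) \int[leb2 R]_z (K i j (u, z))%:E)).
    rewrite /g /h !ge0_sume_distrr; last 2 first.
    - by move=> i _; apply: integral_ge0 => z _; rewrite lee_fin.
    - by move=> i _; apply: integral_ge0 => z _; rewrite lee_fin mulr_ge0.
    rewrite -big_split/=; apply: lee_sum => i _.
    have tt : (0 <= 2 * t)%R by rewrite mulr_ge0.
    have Kf0 z : setT z -> 0 <= (K i j (u, z) * f i z)%:E.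
      by move=> _; rewrite lee_fin mulr_ge0.
    have mKf : measurable_fun setT (fun z : P => (K i j (u, z) * f i z)%:E).
      by apply/measurable_EFinP; exact: (measurable_funM (mKu i) (mf i)).
    have mKff : measurable_fun setT (fun z : P => (K i j (u, z) * f i z ^+ 2)%:E).
      by apply/measurable_EFinP; exact: (measurable_funM (mKu i) (mff i)).
    have mKe : measurable_fun setT (fun z : P => (K i j (u, z))%:E).
      exact: (measurable_EFinP setT _).2 (mKu i).
    rewrite -ge0_integralZl_EFin// -ge0_integralZl_EFin ?sqr_ge0//; last first.
      by move=> z _; rewrite lee_fin.
    rewrite -ge0_integralD//.
    - apply: ge0_le_integral => //.
      + by move=> z _; rewrite mule_ge0// ?lee_fin// mulr_ge0.
      + exact: measurable_funeM.
      + by apply: emeasurable_funD => //; exact: measurable_funeM.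
      + move=> z _; rewrite -!EFinM -EFinD lee_fin.
        have := mulr_ge0 (K0 i j (u, z)) (sqr_ge0 (f i z - t)); lra.
    - by move=> z _; rewrite lee_fin mulr_ge0// sqr_ge0.
    - by move=> z _; rewrite -EFinM lee_fin mulr_ge0// sqr_ge0.
    - exact: measurable_funeM.
  by rewrite [X in _ <= _ + X]EFinM; apply: leeD2l; apply: lee_wpmul2l; rewrite ?lee_fin ?sqr_ge0.
(* [t = 1] already shows that [g] is finite, so that [t = g / A] can be chosen afterwards. *)
have gfin : g \is a fin_num.
  rewrite ge0_fin_numE//; have := key 1%R ler01; rewrite -hE -EFinD => H.
  by rewrite ltey; apply/eqP => gy; move: H; rewrite gy mulr1 gt0_muley ?lte_fin// leye_eq.
move: g0 h0 key; rewrite -(fineK gfin) -hE !lee_fin; set G := fine g; set H := fine h.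
(* AM-GM, [2 t K f <= K f^2 + t^2 K], is optimal at [t = g / A]. *)
move=> G0 H0 key; have := key (G / A)%R (divr_ge0 G0 (ltW A0)).
rewrite -!EFinM -EFinD !lee_fin.
rewrite (_ : 2 * (G / A) * G = 2 * (G ^+ 2 / A))%R; last by field; rewrite gt_eqF.
rewrite (_ : (G / A) ^+ 2 * A = G ^+ 2 / A)%R; last by field; rewrite gt_eqF.
move=> HH; rewrite -expr2 -ler_pdivrMl// mulrC; lra.
Qed.

(** The pointwise bound is integrated in [u]; after Tonelli's theorem the column bound applies. The
    weight [w] leaves room for a Jacobian that a later substitution removes. *)
Lemma schur :
  \sum_(j < n) \int[leb2 R]_u (\sum_(i < m) \int[leb2 R]_z (K i j (u, z) * f i z)%:E) ^+ 2 <=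
  (A * A')%:E * \sum_(i < m) \int[leb2 R]_z (w z * f i z ^+ 2)%:E.
Proof.
pose F i j (p : P * P) := (K i j p * f i p.2 ^+ 2)%:E.
have F0 i j p : 0 <= F i j p by rewrite lee_fin mulr_ge0// sqr_ge0.
have mF i j : measurable_fun setT (F i j).
  have mf2 : measurable_fun setT ((fun z : P => f i z ^+ 2 : mR)%R \o (snd : P * P -> P)).
    exact: measurableT_comp (mff i) measurable_snd.
  by apply/measurable_EFinP; exact: measurable_funM (mK i j) mf2.
have mG i j : measurable_fun setT (fun u => \int[leb2 R]_z F i j (u, z)).
  exact: (@measurable_fun_fubini_tonelli_F _ _ _ _ _ (sigma_leb2 R) (F i j)).
have mG' i j : measurable_fun setT (fun z => \int[leb2 R]_u F i j (u, z)).
  exact: (@measurable_fun_fubini_tonelli_G _ _ _ _ _ (sigma_leb2 R) (F i j)).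
have mKf i j : measurable_fun setT (fun u => \int[leb2 R]_z (K i j (u, z) * f i z)%:E).
  apply: (@measurable_fun_fubini_tonelli_F _ _ _ _ _ (sigma_leb2 R) (fun p => (K i j p * f i p.2)%:E)).
    have mf2 : measurable_fun setT ((f i : P -> mR) \o (snd : P * P -> P)).
      exact: measurableT_comp (mf i) measurable_snd.
    by apply/measurable_EFinP; exact: measurable_funM (mK i j) mf2.
  by move=> p; rewrite lee_fin mulr_ge0.
have G0 i j u : 0 <= \int[leb2 R]_z F i j (u, z) by exact: integral_ge0.
apply: (@le_trans _ _ (\sum_(j < n) \int[leb2 R]_u (A%:E * \sum_(i < m) \int[leb2 R]_z F i j (u, z)))).
  apply: lee_sum => j _; apply: ge0_le_integral => //.
  - by move=> u _; rewrite expe2 mule_ge0//; apply: sume_ge0 => i _;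
      apply: integral_ge0 => z _; rewrite lee_fin mulr_ge0.
  - by apply: emeasurable_funM; apply: emeasurable_sum.
  - by apply: measurable_funeM; apply: emeasurable_sum.
  - by move=> u _; exact: schur_pointwise.
under eq_bigr => j _.
  rewrite ge0_integralZl_EFin ?(ltW A0)//; last 2 first.
  - by move=> u _; apply: sume_ge0.
  - by apply: emeasurable_sum.
  rewrite ge0_integral_sum//.
  under eq_bigr => i _ do rewrite (@fubini_tonelli _ _ _ _ _ (sigma_leb2 R) (sigma_leb2 R) (F i j) (mF i j) (F0 i j)).
  over.
rewrite -ge0_sume_distrr; last first.
  by move=> j _; apply: sume_ge0 => i _; apply: integral_ge0 => z _; exact: integral_ge0.
rewrite [X in _ <= X * _]EFinM -muleA; apply: lee_wpmul2l; first by rewrite lee_fin ltW.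
rewrite exchange_big/= ge0_sume_distrr; last first.
  by move=> i _; apply: integral_ge0 => z _; rewrite lee_fin mulr_ge0// sqr_ge0.
apply: lee_sum => i _.
rewrite -ge0_integral_sum//; last by move=> j z _; exact: integral_ge0.
have mwf : measurable_fun setT (fun z : P => (w z * f i z ^+ 2)%:E).
  by apply/measurable_EFinP; exact: (measurable_funM mw (mff i)).
rewrite -ge0_integralZl_EFin//; last by move=> z _; rewrite lee_fin mulr_ge0// sqr_ge0.
apply: ge0_le_integral => //.
- by move=> z _; apply: sume_ge0 => j _; exact: integral_ge0.
- by apply: emeasurable_sum.
- exact: measurable_funeM.
move=> z _.
under eq_bigr => j _.
  rewrite (eq_integral (fun u => (f i z ^+ 2)%:E * (K i j (u, z))%:E)); last first.
    by move=> u _; rewrite /F /= mulrC EFinM.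
  rewrite ge0_integralZl_EFin ?sqr_ge0//; last 2 first.
  - by move=> u _; rewrite lee_fin.
  - by apply/measurable_EFinP; exact: (measurableT_comp (mK i j) (@pair2_measurable _ _ P P z)).
  over.
rewrite -ge0_sume_distrr; last by move=> j _; apply: integral_ge0 => u _; rewrite lee_fin.
apply: (@le_trans _ _ ((f i z ^+ 2)%:E * (A' * w z)%:E)).
  by apply: lee_wpmul2l; rewrite ?lee_fin ?sqr_ge0.
rewrite -!EFinM lee_fin le_eqVlt; apply/orP; left; apply/eqP; ring.
Qed.

Lemma schur_ae (D : 'I_n -> P -> R) :
  (forall j, measurable_fun setT (D j : P -> mR)) ->
  (forall j, {ae leb2 R, forall u,
    (`|D j u|)%:E <= \sum_(i < m) \int[leb2 R]_z (K i j (u, z) * f i z)%:E}) ->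
  \sum_(j < n) \int[leb2 R]_u (D j u ^+ 2)%:E <=
  (A * A')%:E * \sum_(i < m) \int[leb2 R]_z (w z * f i z ^+ 2)%:E.
Proof.
move=> mD aeD; apply: le_trans schur; apply: lee_sum => j _.
have mKf i : measurable_fun setT (fun u => \int[leb2 R]_z (K i j (u, z) * f i z)%:E).
  apply: (@measurable_fun_fubini_tonelli_F _ _ _ _ _ (sigma_leb2 R) (fun p => (K i j p * f i p.2)%:E)).
    have mf2 : measurable_fun setT ((f i : P -> mR) \o (snd : P * P -> P)).
      exact: measurableT_comp (mf i) measurable_snd.
    by apply/measurable_EFinP; exact: measurable_funM (mK i j) mf2.
  by move=> p; rewrite lee_fin mulr_ge0.
have S0 u : 0 <= \sum_(i < m) \int[leb2 R]_z (K i j (u, z) * f i z)%:E.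
  by apply: sume_ge0 => i _; apply: integral_ge0 => z _; rewrite lee_fin mulr_ge0.
apply: ae_ge0_le_integral => //.
- by move=> u _; rewrite lee_fin sqr_ge0.
- by apply/measurable_EFinP; exact: (measurable_funM (mD j) (mD j)).
- by move=> u _; rewrite expe2 mule_ge0.
- by apply: emeasurable_funM; apply: emeasurable_sum.
apply: filterS (aeD j) => u Du _.
rewrite -[X in X%:E]real_normK ?num_real// EFin_expe !expe2.
by apply: lee_pmul.
Qed.

End schur_test.

(** * Layers *)

Section correlation.
Context {R : realType}.
Local Notation mR := (measurableTypeR R).
Local Notation P := (mR * mR)%type.
Local Open Scope ereal_scope.

(* A layer adds a constant, so its outputs are square integrable only up to a constant. *)
Definition L2_offset (x : P -> R) (k : R) : Prop :=
  measurable_fun setT (x : P -> mR) /\ \int[leb2 R]_u ((x u - k) ^+ 2)%:E < +oo.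

Lemma measurable_sqrB (x y : P -> R) : measurable_fun setT (x : P -> mR) ->
  measurable_fun setT (y : P -> mR) ->
  measurable_fun setT (fun u => ((x u - y u) ^+ 2)%:E).
Proof.
move=> mx my; have md := measurable_funB mx my.
by apply/measurable_EFinP; exact: (measurable_funM md md).
Qed.

Lemma measurable_add2 : measurable_fun setT (fun p : P * P => (p.1 + p.2 : P)%R).
Proof.
by apply: measurable_fun_pair; apply: (@measurable_funD _ _ R); exact: measurableT_comp.
Qed.

Lemma measurable_sub2 : measurable_fun setT (fun p : P * P => (p.2 - p.1 : P)%R).
Proof.
by apply: measurable_fun_pair; apply: (@measurable_funB _ _ R); exact: measurableT_comp.
Qed.

Lemma measurable_addl (u : P) : measurable_fun setT (fun v : P => (u + v : P)%R).
Proof. exact: (measurableT_comp measurable_add2 (@pair1_measurable _ _ P P u)). Qed.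

Definition correl (W x : P -> R) (u : P) : R := (\int[leb2 R]_v (W v * x (u + v)))%R.

(** Where this fails, the value of [correl] carries no information; comparisons of correlations are
    made only where it holds, which is almost everywhere. *)
Definition correl_integrable (W x : P -> R) (u : P) : Prop :=
  (leb2 R).-integrable setT (EFin \o (fun v : P => W v * x (u + v))%R).

Lemma measurable_correl_arg (W x : P -> R) :
  measurable_fun setT (W : P -> mR) -> measurable_fun setT (x : P -> mR) ->
  measurable_fun setT (fun p : P * P => W p.2 * x (p.1 + p.2) : mR)%R.
Proof.
move=> mW mx.
have mW2 : measurable_fun setT ((W : P -> mR) \o (snd : P * P -> P)).
  exact: measurableT_comp mW measurable_snd.
have mx2 : measurable_fun setT ((x : P -> mR) \o (fun p : P * P => (p.1 + p.2 : P)%R)).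
  exact: measurableT_comp mx measurable_add2.
exact: measurable_funM mW2 mx2.
Qed.

Lemma measurable_correl (W x : P -> R) :
  measurable_fun setT (W : P -> mR) -> measurable_fun setT (x : P -> mR) ->
  measurable_fun setT (correl W x : P -> mR).
Proof.
move=> mW mx; have mF := measurable_correl_arg mW mx.
pose F (p : P * P) : \bar R := (W p.2 * x (p.1 + p.2))%:E.
have mFe : measurable_fun setT F by exact: (measurable_EFinP setT _).2 mF.
have -> : correl W x = fine \o (fun u => \int[leb2 R]_v F^\+ (u, v) - \int[leb2 R]_v F^\- (u, v)).
  by apply/funext => u; congr fine; rewrite [LHS]integralE; congr (_ - _);
    apply: eq_integral => v _; rewrite ?funeposE ?funenegE.
apply: (measurableT_comp (@fine_measurable R setT measurableT)); apply: emeasurable_funB.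
- apply: (@measurable_fun_fubini_tonelli_F _ _ _ _ _ (sigma_leb2 R) (F^\+)) => //.
  exact: measurable_funepos.
- apply: (@measurable_fun_fubini_tonelli_F _ _ _ _ _ (sigma_leb2 R) (F^\-)) => //.
  exact: measurable_funeneg.
Qed.

(** |x| is at most |k| + 1 + (x - k)^2. The correlation of |W| with the integrable function (x -
    k)^2 is integrable in [u] by Tonelli's theorem, hence finite almost everywhere. *)
Lemma ae_integrable_correl (W x : P -> R) (k : R) :
  (leb2 R).-integrable setT (EFin \o W) -> L2_offset x k ->
  {ae leb2 R, forall u, correl_integrable W x u}.
Proof.
move=> iW [mx xfin].
have mW : measurable_fun setT (W : P -> mR) by apply/measurable_EFinP; exact: measurable_int iW.
have mxk : measurable_fun setT (fun u : P => x u - k : mR)%R.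
  exact: (measurable_funB mx (@measurable_cst _ _ P mR setT k)).
have msq : measurable_fun setT (fun u : P => (x u - k) ^+ 2 : mR)%R.
  exact: (measurable_funM mxk mxk).
have mnW : measurable_fun setT (fun v : P => `|W v| : mR)%R by exact: measurableT_comp.
pose F (p : P * P) : \bar R := (`|W p.2| * (x (p.1 + p.2) - k) ^+ 2)%:E.
have mF : measurable_fun setT F.
  by apply/measurable_EFinP; exact: (measurable_correl_arg mnW msq).
have F0 p : 0 <= F p by rewrite lee_fin mulr_ge0// sqr_ge0.
have mFu : measurable_fun setT (fun u => \int[leb2 R]_v F (u, v)).
  exact: (@measurable_fun_fubini_tonelli_F _ _ _ _ _ (sigma_leb2 R) F).
have iF : (leb2 R).-integrable setT (fun u => \int[leb2 R]_v F (u, v)).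
  apply/integrableP; split => //.
  under eq_integral => u _ do rewrite gee0_abs ?integral_ge0//.
  rewrite (@fubini_tonelli _ _ _ _ _ (sigma_leb2 R) (sigma_leb2 R) F mF F0).
  set I := \int[leb2 R]_u ((x u - k) ^+ 2)%:E in xfin.
  have I0 : 0 <= I by apply: integral_ge0 => u _; rewrite lee_fin sqr_ge0.
  rewrite (eq_integral (fun v => I * `|(W v)%:E|)); last first.
    move=> v _; transitivity (\int[leb2 R]_u (`|W v|%:E * ((x (u + v) - k) ^+ 2)%:E)).
      by apply: eq_integral => u _; rewrite /F /= EFinM.
    rewrite ge0_integralZl_EFin//; last 2 first.
    - by move=> u _; rewrite lee_fin sqr_ge0.
    - apply/measurable_EFinP; apply: (measurableT_comp msq).
      by under eq_fun do rewrite addrC; apply: measurable_addl.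
    rewrite muleC; congr (_ * _).
    rewrite -[RHS]/(\int[leb2 R]_u ((x u - k) ^+ 2)%:E).
    transitivity (\int[leb2 R]_u ((x (v + u) - k) ^+ 2)%:E).
      by apply: eq_integral => u _; rewrite [(u + v)%R]addrC.
    apply: (@ge0_integral_translate _ v (fun u => ((x u - k) ^+ 2)%:E)).
      exact: (measurable_EFinP setT _).2 msq.
    by move=> u; rewrite lee_fin sqr_ge0.
  have Ifin : I \is a fin_num by rewrite ge0_fin_numE.
  have mWe : measurable_fun setT (fun v : P => `|(W v)%:E|) by exact: (measurable_EFinP setT _).2 mnW.
  rewrite -(fineK Ifin) ge0_integralZl_EFin// ?fine_ge0//.
  by case/integrableP : iW => _ Wfin; rewrite lte_mul_pinfty ?fineK// lee_fin fine_ge0.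
have /= ae1 := integrable_ae measurableT iF.
apply: filterS ae1 => u /(_ I) ufin; apply/integrableP; split.
  apply/measurable_EFinP.
  exact: (measurableT_comp (measurable_correl_arg mW mx) (@pair1_measurable _ _ P P u)).
have mFv : measurable_fun setT (fun v => F (u, v)).
  exact: (measurableT_comp mF (@pair1_measurable _ _ P P u)).
have mWe : measurable_fun setT (fun v : P => `|(W v)%:E|) by exact: (measurable_EFinP setT _).2 mnW.
have k0 : (0 <= `|k| + 1)%R by rewrite addr_ge0.
apply: (@le_lt_trans _ _ (\int[leb2 R]_v ((`|k| + 1)%:E * `|(W v)%:E| + F (u, v)))).
  apply: ge0_le_integral => //.
  - apply: measurableT_comp => //; apply/measurable_EFinP.
    exact: (measurableT_comp (measurable_correl_arg mW mx) (@pair1_measurable _ _ P P u)).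
  - by apply: emeasurable_funD => //; exact: measurable_funeM.
  move=> v _; rewrite /F /= -EFinM -EFinD lee_fin normrM [((_ + 1) * _)%R]mulrC -mulrDr ler_wpM2l//.
  have := ler_normD (x (u + v) - k)%R k; rewrite subrK => /le_trans; apply.
  rewrite -[((x (u + v) - k) ^+ 2)%R]real_normK ?num_real//.
  have := sqr_ge0 (`|x (u + v) - k| - 1)%R; have := normr_ge0 (x (u + v) - k)%R.
  by set t := `|x (u + v) - k|%R; lra.
rewrite ge0_integralD//.
- rewrite ge0_integralZl_EFin//; apply: lte_add_pinfty.
    by case/integrableP : iW => _ Wfin; rewrite lte_mul_pinfty// lee_fin.
  by rewrite -ge0_fin_numE// integral_ge0.
- exact: measurable_funeM.
Qed.

End correlation.

Section layers.
Context {R : realType}.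
Local Notation mR := (measurableTypeR R).
Local Notation P := (mR * mR)%type.
Local Open Scope ereal_scope.

Lemma schur_const_rows (m n : nat) (N : 'I_m -> 'I_n -> \bar R) (C : \bar R) j :
  schur_const N < C -> \sum_(i < m) N i j <= C.
Proof.
rewrite /schur_const gt_max => /andP[h _]; apply: le_trans (ltW h).
by apply: ereal_sup_ubound; exists j.
Qed.

Lemma schur_const_cols (m n : nat) (N : 'I_m -> 'I_n -> \bar R) (C : \bar R) i :
  (0 < m)%N -> (0 < n)%N ->
  schur_const N < C -> \sum_(j < n) N i j <= (n%:R / m%:R)%:E * C.
Proof.
move=> m0 n0; rewrite /schur_const gt_max => /andP[_ /ltW h].
have {}h : (m%:R / n%:R)%:E * \sum_(j < n) N i j <= C.
  by apply: le_trans h; apply: ereal_sup_ubound; exists i.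
have m0' : (m%:R != 0 :> R)%R by rewrite pnatr_eq0 -lt0n.
have n0' : (n%:R != 0 :> R)%R by rewrite pnatr_eq0 -lt0n.
rewrite -[leLHS]mul1e (_ : 1 = (n%:R / m%:R)%:E * (m%:R / n%:R)%:E); last first.
  by rewrite -EFinM (_ : _ * _ = 1)%R//; field; rewrite m0' n0'.
by rewrite -muleA; apply: lee_wpmul2l => //; rewrite lee_fin divr_ge0.
Qed.

Lemma correl_diff_le (W x x' : P -> R) (u : P) :
  measurable_fun setT (W : P -> mR) -> measurable_fun setT (x : P -> mR) ->
  measurable_fun setT (x' : P -> mR) ->
  correl_integrable W x u -> correl_integrable W x' u ->
  `|correl W x u - correl W x' u|%:E <=
  \int[leb2 R]_z (`|W (z - u)| * `|x z - x' z|)%:E.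
Proof.
move=> mW mx mx' ix ix'.
rewrite /correl -RintegralB//.
have iB : (leb2 R).-integrable setT (EFin \o (fun v : P => W v * x (u + v) - W v * x' (u + v)))%R.
  by have := integrableB measurableT ix ix'.
apply: (@le_trans _ _ (\int[leb2 R]_v (`|W v * x (u + v) - W v * x' (u + v)|)%:E)).
  have := le_normr_Rintegral measurableT iB; rewrite -lee_fin => /le_trans; apply.
  rewrite /Rintegral fineK//; apply: integrable_fin_num => //.
  exact: (integrable_norm iB).
pose G z := (`|W (z - u)| * `|x z - x' z|)%:E.
rewrite -[leRHS](@ge0_integral_translate _ u G).
- rewrite le_eqVlt; apply/orP; left; apply/eqP; apply: eq_integral => v _.
  rewrite /G (_ : (u + v - u = v)%R); last by rewrite addrC addKr.
  by rewrite -mulrBr normrM.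
- have mWu : measurable_fun setT (W \o (fun z : P => (z - u)%R) : P -> mR).
    exact: (measurableT_comp mW (measurableT_comp measurable_sub2 (@pair1_measurable _ _ P P u))).
  have mxx := measurable_funB mx mx'.
  apply/measurable_EFinP.
  exact: (measurable_funM (measurableT_comp (@normr_measurable R setT) mWu) (measurableT_comp (@normr_measurable R setT) mxx)).
- by move=> z; rewrite lee_fin mulr_ge0.
Qed.

(** The squared channel norm without its factor 1 / (m |Omega|). *)
Definition energy (m : nat) (x : 'I_m -> P -> R) : \bar R :=
  \sum_(i < m) \int[leb2 R]_u (x i u ^+ 2)%:E.

Lemma energy_ge0 m (x : 'I_m -> P -> R) : 0 <= energy x.
Proof. by apply: sume_ge0 => i _; apply: integral_ge0 => u _; rewrite lee_fin sqr_ge0. Qed.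

Context (sigma : R -> R).
Hypothesis hsigma : forall s t, (`|sigma s - sigma t| <= `|s - t|)%R.

Lemma nonexpansive_measurable : measurable_fun setT (sigma : mR -> mR).
Proof.
apply: continuous_measurable_fun => s; apply/cvgrPdist_lt => eta eta0.
exists eta => //= t st; apply: le_lt_trans (hsigma _ _) st.
Qed.

Context (m n : nat) (W : 'I_m -> 'I_n -> R * R -> R) (b : 'I_n -> R).
Hypotheses (m0 : (0 < m)%N) (n0 : (0 < n)%N).
Hypothesis iW : forall i j, (leb2 R).-integrable setT (EFin \o W i j).

Let mW i j : measurable_fun setT (W i j : P -> mR).
Proof. by apply/measurable_EFinP; exact: measurable_int (iW i j). Qed.

Lemma measurable_layer (x : 'I_m -> P -> R) :
  (forall i, measurable_fun setT (x i : P -> mR)) ->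
  forall j, measurable_fun setT (layer sigma W b x j : P -> mR).
Proof.
move=> mx j; apply: (measurableT_comp nonexpansive_measurable).
apply: (@measurable_funD _ _ R) => //.
by apply: (@measurable_sum _ _ R) => i; exact: measurable_correl.
Qed.

Lemma layer_diff_le (x x' : 'I_m -> P -> R) j u :
  (`|layer sigma W b x j u - layer sigma W b x' j u| <=
  \sum_(i < m) `|correl (W i j) (x i) u - correl (W i j) (x' i) u|)%R.
Proof.
apply: le_trans (hsigma _ _) _; rewrite opprD addrACA subrr addr0 -sumrB.
exact: ler_norm_sum.
Qed.

Lemma measurable_shifted_filter (V : P -> R) : measurable_fun setT (V : P -> mR) ->
  measurable_fun setT (fun p : P * P => `|V (p.2 - p.1)| : mR)%R.
Proof.
move=> mV; apply: (measurableT_comp (@normr_measurable R setT)).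
exact: measurableT_comp mV measurable_sub2.
Qed.

Lemma integral_shift_row (V : P -> R) (u : P) : measurable_fun setT (V : P -> mR) ->
  \int[leb2 R]_z (`|V (z - u)|)%:E = L1norm V.
Proof.
move=> mV; rewrite /L1norm -(@ge0_integral_translate _ (- u)%R (fun v => `|V v|%:E))//.
  by apply: eq_integral => z _; rewrite addrC.
by apply/measurable_EFinP; exact: (measurableT_comp (@normr_measurable R setT) mV).
Qed.

Lemma integral_reflect_translate (z : P) (g : P -> \bar R) :
  measurable_fun setT g -> (forall v, 0 <= g v) ->
  \int[leb2 R]_u g (z - u)%R = \int[leb2 R]_v g v.
Proof.
move=> mg g0; rewrite -[RHS](@ge0_integral_opp _ g)//.
pose G (u : P) := g (- u)%R.
rewrite -[RHS](@ge0_integral_translate _ (- z)%R G)//.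
  by apply: eq_integral => u _; rewrite /G opprD opprK.
apply: (measurableT_comp mg); apply: measurable_fun_pair;
  by apply: measurableT_comp => //; exact: oppr_measurable.
by move=> v; exact: g0.
Qed.

Lemma integral_shift_col (V : P -> R) (z : P) : measurable_fun setT (V : P -> mR) ->
  \int[leb2 R]_u (`|V (z - u)|)%:E = L1norm V.
Proof.
move=> mV; apply: (@integral_reflect_translate z (fun v => `|V v|%:E)) => //.
by apply/measurable_EFinP; exact: (measurableT_comp (@normr_measurable R setT) mV).
Qed.

Lemma ae_correl_integrable (x : 'I_m -> P -> R) (k : 'I_m -> R) j :
  (forall i, L2_offset (x i) (k i)) ->
  {ae leb2 R, forall u, forall i, correl_integrable (W i j) (x i) u}.
Proof.
by move=> Lx; apply: (@filter_forall _ _ _ _ (ae_filter_ringOfSetsType (leb2 R))) => i;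
  exact: ae_integrable_correl (iW i j) (Lx i).
Qed.

(** Schur's test for the kernel |W (z - u)| with weight 1: [Bconst W < 1] bounds the rows by 1 and
    the columns by n/m, the ratio that the averages over channels compensate. *)
Lemma layer_nonexpansive (x x' : 'I_m -> P -> R) (k k' : 'I_m -> R) :
  Bconst W < 1 ->
  (forall i, L2_offset (x i) (k i)) -> (forall i, L2_offset (x' i) (k' i)) ->
  energy (fun j u => layer sigma W b x j u - layer sigma W b x' j u)%R <=
  (n%:R / m%:R)%:E * energy (fun i u => x i u - x' i u)%R.
Proof.
move=> hB Lx Lx'.
have mx i := (Lx i).1; have mx' i := (Lx' i).1.
have nm0 : (0 <= n%:R / m%:R :> R)%R by rewrite divr_ge0.
have mxx i : measurable_fun setT (fun u : P => `|x i u - x' i u| : mR)%R.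
  apply: (measurableT_comp (@normr_measurable R setT)).
  exact: (measurable_funB (mx i) (mx' i)).
apply: le_trans (@schur_ae _ _ _ (fun i j p => `|W i j (p.2 - p.1)|%R)
  (fun i u => `|x i u - x' i u|%R) (cst 1%R) 1%R (n%:R / m%:R)%R _ _ _ _ _ _ _ _ _ _ _ _ _) _ => //.
- by move=> i j; exact: measurable_shifted_filter.
- move=> j u /=; under eq_bigr => i _ do rewrite (integral_shift_row u (mW i j)).
  exact: schur_const_rows hB.
- move=> i z /=; under eq_bigr => j _ do rewrite (integral_shift_col z (mW i j)).
  by rewrite mulr1 -[leRHS]mule1; exact: schur_const_cols hB.
- by move=> j; apply: (@measurable_funB _ _ R); exact: measurable_layer.
- move=> j; apply: (@filterS2 _ _ (ae_filter_ringOfSetsType (leb2 R)) _ _ _ _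
    (ae_correl_integrable j Lx) (ae_correl_integrable j Lx')) => u iu iu'.
  apply: (@le_trans _ _ (\sum_(i < m) `|correl (W i j) (x i) u - correl (W i j) (x' i) u|%:E)).
    by rewrite sumEFin lee_fin; exact: layer_diff_le.
  by apply: lee_sum => i _; exact: correl_diff_le.
rewrite mul1r; apply: lee_wpmul2l; first by rewrite lee_fin.
apply: lee_sum => i _; rewrite le_eqVlt; apply/orP; left; apply/eqP.
by apply: eq_integral => u _; rewrite mul1r real_normK ?num_real.
Qed.

Definition layer_cst (k : 'I_m -> R) (j : 'I_n) : R :=
  sigma (\sum_(i < m) (\int[leb2 R]_v W i j v) * k i + b j)%R.

Lemma layer_cstE (k : 'I_m -> R) j u : layer sigma W b (fun i _ => k i) j u = layer_cst k j.
Proof.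
rewrite /layer /layer_cst; congr (sigma (_ + _)%R); apply: eq_bigr => i _.
by rewrite RintegralZr.
Qed.

Lemma L2_offset_cst (k : R) : L2_offset (cst k) k.
Proof. by split => //=; rewrite integral0_eq// => u _; rewrite subrr expr0n. Qed.

(** The new offset is the response to the constant input [k], and [layer_nonexpansive] compares [x]
    with that input. *)
Lemma L2_offset_layer (x : 'I_m -> P -> R) (k : 'I_m -> R) :
  Bconst W < 1 -> (forall i, L2_offset (x i) (k i)) ->
  forall j, L2_offset (layer sigma W b x j) (layer_cst k j).
Proof.
move=> hB Lx j; split; first by apply: measurable_layer => i; case: (Lx i).
have := layer_nonexpansive hB Lx (fun i => L2_offset_cst (k i)).
have fin : energy (fun i u => x i u - k i)%R < +oo.
  by apply: lte_sum_pinfty => i _; case: (Lx i).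
move=> H; apply: (@le_lt_trans _ _ ((n%:R / m%:R)%:E * energy (fun i u => x i u - k i)%R)); last first.
  by rewrite lte_mul_pinfty// lee_fin divr_ge0.
apply: le_trans H; rewrite /energy (bigD1 j)//=.
apply: (@le_trans _ _ (\int[leb2 R]_u
    ((layer sigma W b x j u - layer sigma W b (fun i => cst (k i)) j u) ^+ 2)%:E)).
  rewrite le_eqVlt; apply/orP; left; apply/eqP; apply: eq_integral => u _.
  by rewrite -(layer_cstE k j u).
by rewrite leeDl//; apply: sume_ge0 => i _; apply: integral_ge0 => u _; rewrite lee_fin sqr_ge0.
Qed.

End layers.

(** * Commutation of a layer and a deformation *)

Section reflection.
Context {R : realType}.
Local Notation mR := (measurableTypeR R).
Local Notation P := (mR * mR)%type.

Lemma has_grad_reflect (f : R * R -> R) (a b : R) (u p : R * R) (k : R) :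
  has_grad f a b (u - p) -> has_grad (fun v => k - f (u - v)) a b p.
Proof.
move=> gf eta eta0; have [del del0 H] := gf eta eta0.
exists del => // h l hdel ldel; have := H (- h) (- l); rewrite !normrN => /(_ hdel ldel).
have -> : u - (p.1 + h, p.2 + l) = ((u - p).1 - h, (u - p).2 - l).
  by congr pair; rewrite /= opprD addrA.
apply: le_trans; rewrite le_eqVlt; apply/orP; left; apply/eqP.
by rewrite -normrN; congr (`|_|); ring.
Qed.

(** The relative displacement in terms of v = z - u when [z] is fixed and [u] varies, as needed for
    columns. *)
Lemma contraction_reflect (e : R) (tau : R * R -> R * R) (a b c d : R * R -> R) (z : R * R) :
  C1_contraction e tau a b c d ->
  C1_contraction e (fun v => tau z - tau (z - v)) (fun v => a (z - v)) (fun v => b (z - v))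
    (fun v => c (z - v)) (fun v => d (z - v)).
Proof.
move=> tauC; have [ca cb cc cd] := contraction_cont tauC.
have cu : continuous (fun v : R * R => z - v).
  by move=> v; apply: cvgB; [exact: cvg_cst|exact: cvg_id].
split.
- move=> p; exact: has_grad_reflect (contraction_grad1 tauC _).
- move=> p; exact: has_grad_reflect (contraction_grad2 tauC _).
- split=> v; [exact: (continuous_comp (@cu v) (@ca _))|exact: (continuous_comp (@cu v) (@cb _))|
    exact: (continuous_comp (@cu v) (@cc _))|exact: (continuous_comp (@cu v) (@cd _))].
- by move=> p; exact: (contraction_col1 tauC).
- by move=> p; exact: (contraction_col2 tauC).
- move=> p q; have := contraction_lip tauC (z - q) (z - p).
  have E1 (x y w : R) : w - x - (w - y) = y - x by ring.
  by rewrite /= !E1.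
Qed.

End reflection.

Section substitution_rule.
Context {R : realType}.
Local Notation mR := (measurableTypeR R).
Local Notation P := (mR * mR)%type.
Local Open Scope ereal_scope.

Context (phi : P -> P) (w : P -> R).
Hypothesis rule : forall g : P -> \bar R, measurable_fun setT g -> (forall v, 0 <= g v) ->
  \int[leb2 R]_v g v = \int[leb2 R]_v (g (phi v) * (w v)%:E).
Hypothesis w0 : forall v, (0 <= w v)%R.
Hypothesis mphi : measurable_fun setT (phi : P -> P).
Hypothesis mw : measurable_fun setT (w : P -> mR).

Lemma integrable_substitution (f : P -> R) : (leb2 R).-integrable setT (EFin \o f) ->
  (leb2 R).-integrable setT (EFin \o (fun v => f (phi v) * w v)%R).
Proof.
move=> if_.
have mf : measurable_fun setT (f : P -> mR) by apply/measurable_EFinP; exact: measurable_int if_.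
have mnf : measurable_fun setT (fun v : P => `|(f v)%:E|).
  apply: measurableT_comp => //; exact: (measurable_EFinP setT _).2 mf.
apply/integrableP; split.
  by apply/measurable_EFinP; exact: (measurable_funM (measurableT_comp mf mphi) mw).
case/integrableP : if_ => _; apply: le_lt_trans.
rewrite (rule mnf)//; apply: ge0_le_integral => //.
- apply/measurable_EFinP; apply: (measurableT_comp (@normr_measurable R setT)).
  exact: (measurable_funM (measurableT_comp mf mphi) mw).
- by apply: emeasurable_funM; [exact: (measurableT_comp mnf mphi)|exact: (measurable_EFinP setT _).2 mw].
- by move=> v _ /=; rewrite normrM (ger0_norm (w0 v)) EFinM.
Qed.

Lemma Rintegral_substitution (f : P -> R) : measurable_fun setT (f : P -> mR) ->
  (\int[leb2 R]_v f v = \int[leb2 R]_v (f (phi v) * w v))%R.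
Proof. by move=> mf; congr fine; exact: integral_substitution. Qed.

End substitution_rule.

Section deformed_layer.
Context {R : realType}.
Local Notation mR := (measurableTypeR R).
Local Notation P := (mR * mR)%type.
Local Open Scope ereal_scope.

Context (e : R) (tau : R * R -> R * R) (a b c d : R * R -> R).
Hypotheses (e0 : (0 < e)%R) (e5 : (5 * e < 1)%R) (tauC : C1_contraction e tau a b c d).

Let rho (v : P) : P := (v - tau v)%R.
Let J := jacobian_det a b c d.

Let J0 z : (0 < J z)%R. Proof. exact: jacobian_det_gt0 e0 e5 tauC z. Qed.

Let mJ : measurable_fun setT (J : P -> mR).
Proof. by apply: continuous_measurable2; exact: jacobian_det_continuous tauC. Qed.

Lemma measurable_deformation : measurable_fun setT rho.
Proof.
apply: measurable_fun_pair; apply: measurable_funB => //;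
  by apply: measurableT_comp => //; exact: contraction_measurable tauC.
Qed.

Lemma L2_offset_deform (x : P -> R) (k : R) : L2_offset x k -> L2_offset (x \o rho) k.
Proof.
move=> [mx xfin]; split; first exact: (measurableT_comp mx measurable_deformation).
have msq := measurable_sqrB mx (@measurable_cst _ _ P mR setT k).
have sq0 (u : P) : 0 <= ((x u - k) ^+ 2)%:E by rewrite lee_fin sqr_ge0.
apply: (le_lt_trans (ge0_integral_contraction_le e0 e5 tauC msq sq0)).
by rewrite lte_mul_pinfty// lee_fin; lra.
Qed.

Let rule_translate (y : P) (g : P -> \bar R) : measurable_fun setT g -> (forall v, 0 <= g v) ->
  \int[leb2 R]_v g v = \int[leb2 R]_v (g (v - y)%R * (cst 1%R v)%:E).
Proof.
move=> mg g0; rewrite -(@ge0_integral_translate _ (- y)%R g)//.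
by apply: eq_integral => v _; rewrite mule1 addrC.
Qed.

Let rule_deform (y : P) (g : P -> \bar R) : measurable_fun setT g -> (forall v, 0 <= g v) ->
  \int[leb2 R]_v g v = \int[leb2 R]_v (g (rho v - y)%R * (J v)%:E).
Proof.
move=> mg g0.
have my : measurable_fun setT (fun z : P => (z - y)%R : P).
  exact: (measurableT_comp measurable_sub2 (@pair1_measurable _ _ P P y)).
rewrite (rule_translate y mg g0).
under eq_integral => v _ do rewrite mule1.
rewrite (@ge0_integral_contraction _ _ _ _ _ _ _ e0 e5 tauC (fun z => g (z - y)%R))//.
exact: (measurableT_comp mg my).
Qed.

(* Bounds [W (rho z - rho u) J z - W (z - u)], the kernel of the commutator of the   *)
(* correlation with [W] and the deformation after the substitution of [rho z].   *)
Definition deform_kernel (W : P -> R) (p : P * P) : R :=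
  (`|W (rho p.2 - rho p.1) - W (p.2 - p.1)| * J p.2 + `|W (p.2 - p.1)| * `|J p.2 - 1|)%R.

Lemma deform_kernel_ge0 (W : P -> R) p : (0 <= deform_kernel W p)%R.
Proof. by rewrite addr_ge0// mulr_ge0// ltW. Qed.

Lemma measurable_rho_sub : measurable_fun setT (fun p : P * P => (rho p.2 - rho p.1)%R : P).
Proof.
have mrho := measurable_deformation.
have m2 : measurable_fun setT (fun p : P * P => (rho p.1, rho p.2)).
  by apply: measurable_fun_pair; apply: (measurableT_comp mrho).
exact: (measurableT_comp measurable_sub2 m2).
Qed.

Lemma measurable_increment (W : P -> R) : measurable_fun setT (W : P -> mR) ->
  measurable_fun setT (fun p : P * P => `|W (rho p.2 - rho p.1) - W (p.2 - p.1)|%R : mR).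
Proof.
move=> mW; apply: (measurableT_comp (@normr_measurable R setT)).
exact: (measurable_funB (measurableT_comp mW measurable_rho_sub) (measurableT_comp mW measurable_sub2)).
Qed.

Lemma measurable_deform_kernel (W : P -> R) : measurable_fun setT (W : P -> mR) ->
  measurable_fun setT (deform_kernel W : P * P -> mR).
Proof.
move=> mW.
have mJ2 : measurable_fun setT ((J : P -> mR) \o (snd : P * P -> P)).
  exact: (measurableT_comp mJ measurable_snd).
have mJ1 : measurable_fun setT (fun z : P => `|J z - 1|%R : mR).
  apply: (measurableT_comp (@normr_measurable R setT)).
  exact: (measurable_funB mJ (@measurable_cst _ _ P mR setT 1%R)).
have mJ12 : measurable_fun setT ((fun z : P => `|J z - 1|%R : mR) \o (snd : P * P -> P)).
  exact: (measurableT_comp mJ1 measurable_snd).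
have mW1 := measurable_shifted_filter mW.
exact: (measurable_funD (measurable_funM (measurable_increment mW) mJ2) (measurable_funM mW1 mJ12)).
Qed.

(** The substitutions [rho z - rho u] and [z - u] bring both correlations to the variable [z]. The
    constant [k] can be subtracted from [x] because both substitutions leave the integral of [W]
    unchanged ([E]). *)
Lemma deform_correl_diff (W x : P -> R) (k : R) (u : P) :
  (leb2 R).-integrable setT (EFin \o W) -> measurable_fun setT (x : P -> mR) ->
  correl_integrable W x (rho u) -> correl_integrable W (x \o rho) u ->
  `|correl W x (rho u) - correl W (x \o rho) u|%:E <=
  \int[leb2 R]_z (deform_kernel W (u, z) * `|x (rho z) - k|)%:E.
Proof.
move=> iW mx ix ixr.
have mW : measurable_fun setT (W : P -> mR) by apply/measurable_EFinP; exact: measurable_int iW.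
have mone : measurable_fun setT (cst 1%R : P -> mR) by [].
have mrhou : measurable_fun setT (fun z : P => (rho z - rho u)%R : P).
  exact: (measurableT_comp measurable_rho_sub (@pair1_measurable _ _ P P u)).
have mu_ : measurable_fun setT (fun z : P => (z - u)%R : P).
  exact: (measurableT_comp measurable_sub2 (@pair1_measurable _ _ P P u)).
have J0' v : (0 <= J v)%R by exact: ltW.
have one0 (v : P) : (0 <= cst 1 v :> R)%R by [].
have i1 := integrable_substitution (rule_deform (rho u)) J0' mrhou mJ ix.
have i2 := integrable_substitution (rule_translate u) one0 mu_ mone ixr.
have i3 := integrable_substitution (rule_deform (rho u)) J0' mrhou mJ iW.
have i4 := integrable_substitution (rule_translate u) one0 mu_ mone iW.
have mix : measurable_fun setT (fun v : P => W v * x (rho u + v) : mR)%R.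
  by apply/measurable_EFinP; exact: measurable_int ix.
have mixr : measurable_fun setT (fun v : P => W v * (x \o rho) (u + v) : mR)%R.
  by apply/measurable_EFinP; exact: measurable_int ixr.
rewrite /correl (Rintegral_substitution (rule_deform (rho u)) J0' mix).
rewrite (Rintegral_substitution (rule_translate u) one0 mixr).
have E : (\int[leb2 R]_v (W (rho v - rho u) * J v) = \int[leb2 R]_v (W (v - u) * cst 1 v))%R.
  rewrite -(Rintegral_substitution (rule_deform (rho u)) J0' mW).
  exact: (Rintegral_substitution (rule_translate u) one0 mW).
have iB12 := integrableB measurableT i1 i2.
have iB34 := integrableB measurableT i3 i4.
have ik := integrableZl measurableT k iB34.
pose F z := (W (rho z - rho u) * x (rho u + (rho z - rho u)) * J z -
  W (z - u) * (x \o rho) (u + (z - u)) * cst 1 z)%R.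
pose G z := (W (rho z - rho u) * J z - W (z - u) * cst 1 z)%R.
have iF : (leb2 R).-integrable setT (EFin \o F) by exact: iB12.
have iG : (leb2 R).-integrable setT (EFin \o G) by exact: iB34.
have iH : (leb2 R).-integrable setT (EFin \o (fun z => F z - k * G z)%R) by exact: integrableB iF ik.
have -> : (\int[leb2 R]_v (W (rho v - rho u) * x (rho u + (rho v - rho u)) * J v) -
    \int[leb2 R]_v (W (v - u) * (x \o rho) (u + (v - u)) * cst 1 v) =
    \int[leb2 R]_z (F z - k * G z))%R.
  rewrite RintegralB// RintegralZl// [in X in (_ - k * X)%R]RintegralB// E subrr mulr0 subr0.
  by rewrite RintegralB.
have := le_normr_Rintegral measurableT iH; rewrite -lee_fin => /le_trans; apply.
rewrite /Rintegral fineK; last by apply: integrable_fin_num => //; exact: (integrable_norm iH).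
apply: ge0_le_integral => //.
- by apply/measurable_EFinP; apply: (measurableT_comp (@normr_measurable R setT));
    apply/measurable_EFinP; exact: measurable_int iH.
- have mku : measurable_fun setT (fun z : P => deform_kernel W (u, z) : mR).
    exact: (measurableT_comp (measurable_deform_kernel mW) (@pair1_measurable _ _ P P u)).
  have mxk : measurable_fun setT (fun z : P => `|x (rho z) - k| : mR)%R.
    apply: (measurableT_comp (@normr_measurable R setT)).
    exact: (measurable_funB (measurableT_comp mx measurable_deformation) (@measurable_cst _ _ P mR setT k)).
  by apply/measurable_EFinP; exact: measurable_funM mku mxk.
move=> z _; rewrite lee_fin /F /G /=.
have -> : (rho u + (rho z - rho u) = rho z)%R by rewrite addrC subrK.
have -> : (u + (z - u) = z)%R by rewrite addrC subrK.
rewrite (_ : _ - _ = ((W (rho z - rho u) - W (z - u)) * J z + W (z - u) * (J z - 1)) * (x (rho z) - k))%R; last by ring.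
rewrite normrM ler_wpM2r// /deform_kernel/=; apply: le_trans (ler_normD _ _) _.
by rewrite !normrM (gtr0_norm (J0 z)).
Qed.

Section kernel_bounds.
Context (W : R * R -> R) (dW : R * R -> R * R).
Hypothesis hW : cnn_filter W dW.

Let iW : (leb2 R).-integrable setT (EFin \o W). Proof. by case: hW. Qed.

Let mW : measurable_fun setT (W : P -> mR).
Proof. by apply/measurable_EFinP; exact: measurable_int iW. Qed.

Let B := L1norm W.
Let C := L1norm (fun v => eucl v * eucl (dW v))%R.

Let mincr (delta : P -> P) : measurable_fun setT delta ->
  measurable_fun setT (fun v : P => (`|W (v - delta v) - W v|)%:E).
Proof.
move=> md; apply/measurable_EFinP; apply: (measurableT_comp (@normr_measurable R setT)).
apply: (measurable_funB _ mW); apply: (measurableT_comp mW).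
by apply: measurable_fun_pair; apply: (@measurable_funB _ _ R) => //; exact: measurableT_comp.
Qed.

Let incr_bound (delta : R * R -> R * R) (a' b' c' d' : R * R -> R) :
  C1_contraction e delta a' b' c' d' -> delta 0%R = 0%R ->
  \int[leb2 R]_v (`|W (v - delta v) - W v|)%:E <= (16 / 5 * e)%:E * C.
Proof. by case: hW => _ iW' wW id1 id2 deltaC delta0; exact: (increment_bound e0 e5 deltaC delta0 wW iW' id1 id2). Qed.

Lemma increment_row (u : P) :
  \int[leb2 R]_z (`|W (rho z - rho u) - W (z - u)|)%:E <= (16 / 5 * e)%:E * C.
Proof.
have sC := contraction_shift tauC u.
have s0 : (tau (u + 0) - tau u = 0)%R by rewrite addr0 subrr.
apply: le_trans (incr_bound sC s0).
rewrite -(@ge0_integral_translate _ u (fun z => (`|W (rho z - rho u) - W (z - u)|)%:E))//; last first.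
  exact: (measurable_EFinP setT _).2 (measurableT_comp (measurable_increment mW) (@pair1_measurable _ _ P P u)).
rewrite le_eqVlt; apply/orP; left; apply/eqP; apply: eq_integral => v _.
have -> : (rho (u + v) - rho u = v - (tau (u + v) - tau u))%R by rewrite /rho; congr pair; rewrite /=; ring.
by have -> : (u + v - u = v)%R by rewrite addrC addKr.
Qed.

Lemma increment_col (z : P) :
  \int[leb2 R]_u (`|W (rho z - rho u) - W (z - u)|)%:E <= (16 / 5 * e)%:E * C.
Proof.
have sC := contraction_reflect z tauC.
have s0 : (tau z - tau (z - 0) = 0)%R by rewrite subr0 subrr.
apply: le_trans (incr_bound sC s0).
rewrite -(@integral_reflect_translate _ z (fun v => (`|W (v - (tau z - tau (z - v))) - W v|)%:E))//; last first.
  by apply: mincr; exact: contraction_measurable sC.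
rewrite le_eqVlt; apply/orP; left; apply/eqP; apply: eq_integral => u _.
by have -> : (rho z - rho u = (z - u) - (tau z - tau (z - (z - u))))%R by
  rewrite /rho; congr pair; rewrite /= subKr; ring.
Qed.

Let mincr1 (u : P) : measurable_fun setT (fun z : P => (`|W (rho z - rho u) - W (z - u)|)%:E).
Proof. exact: (measurable_EFinP setT _).2 (measurableT_comp (measurable_increment mW) (@pair1_measurable _ _ P P u)). Qed.

Let mincr2 (z : P) : measurable_fun setT (fun u : P => (`|W (rho z - rho u) - W (z - u)|)%:E).
Proof. exact: (measurable_EFinP setT _).2 (measurableT_comp (measurable_increment mW) (@pair2_measurable _ _ P P z)). Qed.

Let mshift1 (u : P) : measurable_fun setT (fun z : P => (`|W (z - u)|)%:E).
Proof. exact: (measurable_EFinP setT _).2 (measurableT_comp (measurable_shifted_filter mW) (@pair1_measurable _ _ P P u)). Qed.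

Let mshift2 (z : P) : measurable_fun setT (fun u : P => (`|W (z - u)|)%:E).
Proof. exact: (measurable_EFinP setT _).2 (measurableT_comp (measurable_shifted_filter mW) (@pair2_measurable _ _ P P z)). Qed.

Let mker : measurable_fun setT (deform_kernel W : P * P -> mR).
Proof. exact: measurable_deform_kernel mW. Qed.

Lemma deform_kernel_row (u : P) :
  \int[leb2 R]_z (deform_kernel W (u, z))%:E <=
  (36 / 25 * (16 / 5 * e))%:E * C + (11 / 5 * e)%:E * B.
Proof.
have k1 : (0 <= 36 / 25 :> R)%R by lra.
have k2 : (0 <= 11 / 5 * e)%R by move: e0; lra.
apply: (@le_trans _ _ (\int[leb2 R]_z ((36 / 25)%:E * (`|W (rho z - rho u) - W (z - u)|)%:E +
   (11 / 5 * e)%:E * (`|W (z - u)|)%:E))).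
  apply: ge0_le_integral => //.
  - by move=> z _; rewrite lee_fin deform_kernel_ge0.
  - exact: (measurable_EFinP setT _).2 (measurableT_comp mker (@pair1_measurable _ _ P P u)).
  - by apply: emeasurable_funD; apply: measurable_funeM.
  move=> z _; rewrite -!EFinM -EFinD lee_fin /deform_kernel/=.
  have /andP[_ Jz] := jacobian_det_bounds e0 e5 tauC z.
  rewrite mulrC [X in (_ + X <= _)%R]mulrC; apply: lerD; apply: ler_wpM2r => //.
  exact: jacobian_det_sub1 e0 e5 tauC z.
rewrite ge0_integralD//.
- rewrite !ge0_integralZl_EFin// integral_shift_row//; apply: leeD => //.
  rewrite [X in _ <= X * _]EFinM -muleA; apply: lee_wpmul2l => //.
  exact: increment_row.
- exact: measurable_funeM.
- by move=> z _; rewrite mule_ge0 ?lee_fin.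
- exact: measurable_funeM.
Qed.

(** The bound has to be proportional to [J z]: since J is at least 14/25, |J - 1| is at most 11/5 *
    25/14 * e * J. *)
Lemma deform_kernel_col (z : P) :
  \int[leb2 R]_u (deform_kernel W (u, z))%:E <=
  (J z)%:E * ((16 / 5 * e)%:E * C + (11 / 5 * (25 / 14) * e)%:E * B).
Proof.
have k1 : (0 <= J z)%R by exact: ltW.
have k2 : (0 <= `|J z - 1|)%R by [].
rewrite /deform_kernel/=.
rewrite (eq_integral (fun u => (J z)%:E * (`|W (rho z - rho u) - W (z - u)|)%:E +
   (`|J z - 1|)%:E * (`|W (z - u)|)%:E)); last first.
  by move=> u _; rewrite -!EFinM -EFinD; congr EFin; ring.
rewrite ge0_integralD//.
- rewrite !ge0_integralZl_EFin// integral_shift_col// -/B.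
  have B0 : 0 <= B by exact: integral_ge0.
  have C0 : 0 <= C by exact: integral_ge0.
  have q1 : (0 <= 16 / 5 * e)%R by move: e0; lra.
  have q2 : (0 <= 11 / 5 * (25 / 14) * e)%R by move: e0; lra.
  rewrite [leRHS]ge0_muleDr ?mule_ge0//. apply: leeD.
    by apply: lee_wpmul2l => //; exact: increment_col.
  rewrite muleA; apply: lee_wpmul2r => //; rewrite -EFinM lee_fin.
  have /andP[Jz _] := jacobian_det_bounds e0 e5 tauC z.
  apply: le_trans (jacobian_det_sub1 e0 e5 tauC z) _.
  by move: e0 Jz; rewrite -/J => e0' Jz; nra.
- by move=> u _; rewrite mule_ge0 ?lee_fin.
- exact: measurable_funeM.
- exact: measurable_funeM.
Qed.

End kernel_bounds.

(** Schur's test with weight [J] on the columns: the integral of J |x o rho - k|^2 is that of |x -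
    k|^2 by the change of variables ([en]), so that the deformation of the input costs nothing. *)
Lemma layer_deform_error (sigma : R -> R) (m n : nat) (W : 'I_m -> 'I_n -> R * R -> R)
  (dW : 'I_m -> 'I_n -> R * R -> R * R) (bias : 'I_n -> R) (x : 'I_m -> P -> R) (k : 'I_m -> R) :
  (forall s t, (`|sigma s - sigma t| <= `|s - t|)%R) ->
  (0 < m)%N -> (0 < n)%N ->
  (forall i j, cnn_filter (W i j) (dW i j)) ->
  Bconst W < 1 -> Cconst dW < 1 ->
  (forall i, L2_offset (x i) (k i)) ->
  energy (fun j u => layer sigma W bias x j (rho u) -
                     layer sigma W bias (fun i => x i \o rho) j u)%R <=
  (n%:R / m%:R * (7 * e) ^+ 2)%:E * energy (fun i u => x i u - k i)%R.
Proof.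
move=> hsigma m0 n0 hW hB hC Lx.
have iW i j : (leb2 R).-integrable setT (EFin \o W i j) by case: (hW i j).
have mW i j : measurable_fun setT (W i j : P -> mR).
  by apply/measurable_EFinP; exact: measurable_int (iW i j).
have mx i := (Lx i).1.
have Lxr i := L2_offset_deform (Lx i).
have nm0 : (0 <= n%:R / m%:R :> R)%R by rewrite divr_ge0.
pose A : R := (36 / 25 * (16 / 5 * e) + 11 / 5 * e)%R.
pose A' : R := (n%:R / m%:R * (16 / 5 * e + 11 / 5 * (25 / 14) * e))%R.
have A0 : (0 < A)%R by rewrite /A; move: e0; lra.
have A'0 : (0 <= A')%R by rewrite /A' mulr_ge0//; move: e0; lra.
pose f i (u : P) := `|x i (rho u) - k i|%R.
have mf i : measurable_fun setT (f i : P -> mR).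
  apply: (measurableT_comp (@normr_measurable R setT)).
  exact: (measurable_funB (measurableT_comp (mx i) measurable_deformation) (@measurable_cst _ _ P mR setT (k i))).
have f0 i p : (0 <= f i p)%R by exact: normr_ge0.
have J0' z : (0 <= J z)%R by exact: ltW.
have q1 : (0 <= 36 / 25 * (16 / 5 * e))%R by move: e0; lra.
have q2 : (0 <= 11 / 5 * e)%R by move: e0; lra.
have q3 : (0 <= 16 / 5 * e)%R by move: e0; lra.
have q4 : (0 <= 11 / 5 * (25 / 14) * e)%R by move: e0; lra.
have B0 i j : 0 <= L1norm (W i j) by exact: integral_ge0.
have C0 i j : 0 <= L1norm (fun v => eucl v * eucl (dW i j v))%R by exact: integral_ge0.
have rows j u : \sum_(i < m) \int[leb2 R]_z (deform_kernel (W i j) (u, z))%:E <= A%:E.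
  apply: (@le_trans _ _ (\sum_(i < m) ((36 / 25 * (16 / 5 * e))%:E *
      L1norm (fun v => eucl v * eucl (dW i j v))%R + (11 / 5 * e)%:E * L1norm (W i j)))).
    by apply: lee_sum => i _; exact: deform_kernel_row.
  rewrite big_split/= -!ge0_sume_distrr//.
  rewrite /A EFinD -[X in _ <= X + _]mule1 -[X in _ <= _ + X]mule1.
  apply: leeD; (apply: lee_wpmul2l; first by rewrite lee_fin).
    exact: (schur_const_rows j hC).
  exact: (schur_const_rows j hB).
have cols i z : \sum_(j < n) \int[leb2 R]_u (deform_kernel (W i j) (u, z))%:E <= (A' * J z)%:E.
  apply: (@le_trans _ _ (\sum_(j < n) ((J z)%:E * ((16 / 5 * e)%:E *
      L1norm (fun v => eucl v * eucl (dW i j v))%R + (11 / 5 * (25 / 14) * e)%:E * L1norm (W i j))))).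
    by apply: lee_sum => j _; exact: deform_kernel_col.
  rewrite -ge0_sume_distrr; last by move=> j _; rewrite adde_ge0// mule_ge0.
  rewrite big_split/= -!ge0_sume_distrr//.
  rewrite [(A' * J z)%R]mulrC [X in _ <= X]EFinM; apply: lee_wpmul2l; first by rewrite lee_fin.
  rewrite (_ : A' = 16 / 5 * e * (n%:R / m%:R) + 11 / 5 * (25 / 14) * e * (n%:R / m%:R))%R;
    last by rewrite /A'; ring.
  rewrite EFinD [X in _ <= X + _]EFinM [X in _ <= _ + X]EFinM.
  apply: leeD; (apply: lee_wpmul2l; first by rewrite lee_fin).
    by rewrite -[leRHS]mule1; exact: (schur_const_cols i m0 n0 hC).
  by rewrite -[leRHS]mule1; exact: (schur_const_cols i m0 n0 hB).
have mlay j : measurable_fun setT (layer sigma W bias x j : P -> mR) by exact: measurable_layer.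
have mlayr j : measurable_fun setT (layer sigma W bias (fun i => x i \o rho) j : P -> mR).
  by apply: measurable_layer => // i'; exact: (Lxr i').1.
have H := @schur_ae _ _ _ (fun i j => deform_kernel (W i j)) f J A A'
  (fun i j => measurable_deform_kernel (mW i j)) (fun i j => deform_kernel_ge0 (W i j))
  mf f0 mJ J0' A0 A'0 rows cols
  (fun j u => layer sigma W bias x j (rho u) - layer sigma W bias (fun i => x i \o rho) j u)%R.
apply: le_trans (H _ _) _.
- by move=> j; exact: (measurable_funB (measurableT_comp (mlay j) measurable_deformation) (mlayr j)).
- move=> j; have ae1 := ae_contraction e0 e5 tauC (ae_correl_integrable iW j Lx).
  have ae2 := ae_correl_integrable iW j Lxr.
  apply: (@filterS2 _ _ (ae_filter_ringOfSetsType (leb2 R)) _ _ _ _ ae1 ae2) => u iu iu'.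
  apply: (@le_trans _ _ (\sum_(i < m) `|correl (W i j) (x i) (rho u) - correl (W i j) (x i \o rho) u|%:E)).
    rewrite sumEFin lee_fin; apply: le_trans (hsigma _ _) _.
    by rewrite opprD addrACA subrr addr0 -sumrB; exact: ler_norm_sum.
  by apply: lee_sum => i _; apply: deform_correl_diff; [exact: iW|exact: mx|exact: iu|exact: iu'].
have en : \sum_(i < m) \int[leb2 R]_z (J z * f i z ^+ 2)%:E = energy (fun i u => x i u - k i)%R.
  apply: eq_bigr => i _.
  have msq := measurable_sqrB (mx i) (@measurable_cst _ _ P mR setT (k i)).
  rewrite (ge0_integral_contraction e0 e5 tauC msq); last by move=> v; rewrite lee_fin sqr_ge0.
  by apply: eq_integral => v _; rewrite /f real_normK ?num_real// -EFinM mulrC.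
rewrite en; apply: lee_wpmul2r; first exact: energy_ge0.
rewrite lee_fin mulrCA ler_wpM2l//.
(* The row constant is 6.808 e and the column constant below 7.13 e, apart from n/m; their product
   is below 49 e^2. *)
have := mulr_ge0 (ltW e0) (ltW e0); rewrite expr2 /A; lra.
Qed.

End deformed_layer.

(** * Deformations of class C^2 *)

Section smooth_deformation.
Context {R : realType}.

Lemma norm_fst_le (v : R * R) : `|v.1| <= `|v|.
Proof. by rewrite [leRHS]prod_normE le_max lexx. Qed.

Lemma norm_snd_le (v : R * R) : `|v.2| <= `|v|.
Proof. by rewrite [leRHS]prod_normE le_max lexx orbT. Qed.

Lemma diff_pairE (f : R * R -> R * R) (p v : R * R) : differentiable f p ->
  'd f p v = v.1 *: 'D_((1, 0) : R * R) f p + v.2 *: 'D_((0, 1) : R * R) f p.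
Proof.
move=> df; rewrite !deriveE// -!linearZ -linearD; congr ('d f p _).
by case: v => x y; congr pair; rewrite /= /GRing.scale/=; ring.
Qed.

Lemma diff_error (f : R * R -> R * R) (p : R * R) : differentiable f p ->
  forall eta : R, 0 < eta -> exists2 del : R, 0 < del &
    forall v : R * R, `|v| < del -> `|f (p + v) - f p - 'd f p v| <= eta * `|v|.
Proof.
move=> /diff_locally /eqaddoP df eta eta0; have := df eta eta0.
move=> /nbhs_ballP[del /= del0 H]; exists del => // v vdel.
have := H v; rewrite -ball_normE /= sub0r normrN => /(_ vdel).
rewrite -[X in `|X| <= _ -> _]/(f (v + p) - (f p + 'd f p v)).
by rewrite opprD addrA [v + p]addrC.
Qed.

Lemma pair_error (X Y D1 D2 : R * R) (h k : R) :
  X.1 - Y.1 - (D1.1 * h + D2.1 * k) = (X - Y - (h *: D1 + k *: D2)).1 /\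
  X.2 - Y.2 - (D1.2 * h + D2.2 * k) = (X - Y - (h *: D1 + k *: D2)).2.
Proof. by split; rewrite /= /GRing.scale/=; ring. Qed.

Lemma has_grad_diff (f : R * R -> R * R) (p : R * R) : differentiable f p ->
  has_grad (fun v => (f v).1) ('D_((1, 0) : R * R) f p).1 ('D_((0, 1) : R * R) f p).1 p /\
  has_grad (fun v => (f v).2) ('D_((1, 0) : R * R) f p).2 ('D_((0, 1) : R * R) f p).2 p.
Proof.
move=> df; set D1 := 'D_((1, 0) : R * R) f p; set D2 := 'D_((0, 1) : R * R) f p.
suff H (eta : R) : 0 < eta -> exists2 del : R, 0 < del & forall h k : R,
    `|h| < del -> `|k| < del ->
    `|f (p.1 + h, p.2 + k) - f p - (h *: D1 + k *: D2)| <= eta * (`|h| + `|k|).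
  split=> eta eta0; have [del del0 {}H] := H eta eta0; exists del => // h k hdel kdel;
    apply: le_trans (H h k hdel kdel);
    have [E1 E2] := pair_error (f (p.1 + h, p.2 + k)) (f p) D1 D2 h k.
  - rewrite E1; exact: norm_fst_le.
  - rewrite E2; exact: norm_snd_le.
move=> eta0; have [del del0 H] := diff_error df eta0; exists del => // h k hdel kdel.
have nv : `|((h, k) : R * R)| < del by rewrite prod_normE gt_max hdel.
have le : `|((h, k) : R * R)| <= `|h| + `|k|.
  by rewrite prod_normE ge_max lerDl lerDr !normr_ge0.
have := H (h, k) nv; rewrite diff_pairE// => {}H.
by apply: (le_trans H); rewrite ler_wpM2l// ltW.
Qed.

Lemma euclZ (t : R) (v : R * R) : eucl (t *: v) = `|t| * eucl v.
Proof.
rewrite /eucl /= /GRing.scale/= !exprMn -mulrDr sqrtrM ?sqr_ge0//.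
by rewrite sqrtr_sqr.
Qed.

Lemma eucl_gt0 (v : R * R) : (0 < eucl v) = (v != 0).
Proof.
have [->|v0] := eqVneq v 0; first by rewrite /eucl /= expr0n addr0 sqrtr0 ltxx.
rewrite lt_neqAle eucl_ge0 andbT eq_sym; apply: contra v0.
rewrite sqrtr_eq0 => h; have h1 := sqr_ge0 v.1; have h2 := sqr_ge0 v.2.
have /eqP : v.1 ^+ 2 = 0 by lra.
have /eqP : v.2 ^+ 2 = 0 by lra.
by rewrite !sqrf_eq0 => /eqP b /eqP a; apply/eqP; rewrite [v]surjective_pairing a b.
Qed.

Lemma op_norm_bound (f : {linear (R * R)%type -> (R * R)%type}) (e : R) v :
  (op_norm f <= e%:E)%E -> eucl (f v) <= e * eucl v.
Proof.
move=> fe; have bound w : eucl w <= 1 -> eucl (f w) <= e.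
  move=> w1; rewrite -lee_fin; apply: le_trans fe; apply: ereal_sup_ubound.
  by exists w.
have [->|v0] := eqVneq v 0.
  by rewrite linear0 /eucl /= expr0n addr0 sqrtr0 mulr0.
have nv : 0 < eucl v by rewrite eucl_gt0.
have := bound ((eucl v)^-1 *: v).
rewrite linearZ !euclZ ger0_norm ?invr_ge0 ?eucl_ge0// mulVf ?gt_eqF//.
by move=> /(_ (lexx _)); rewrite ler_pdivrMl// mulrC.
Qed.

Context (tau : R * R -> R * R) (e : R).
Hypotheses (tauC2 : Ck 2 tau) (e0 : 0 < e) (taue : (grad_sup tau <= e%:E)%E).

Let dtau p : differentiable tau p. Proof. by case: tauC2. Qed.

Lemma deformation_diff_bound p v : eucl ('d tau p v) <= e * eucl v.
Proof.
apply: op_norm_bound; apply: le_trans taue; apply: ereal_sup_ubound.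
by exists p.
Qed.

Let A p := 'D_((1, 0) : R * R) tau p.
Let B p := 'D_((0, 1) : R * R) tau p.

Let eucl10 : eucl (((1, 0) : R * R)) = 1.
Proof. by rewrite /eucl/= expr1n expr0n addr0 sqrtr1. Qed.

Let eucl01 : eucl (((0, 1) : R * R)) = 1.
Proof. by rewrite /eucl/= expr1n expr0n add0r sqrtr1. Qed.

Let sqr_bound (v : R * R) (r : R) : 0 <= r -> eucl v <= r -> v.1 ^+ 2 + v.2 ^+ 2 <= r ^+ 2.
Proof. by move=> r0 vr; rewrite -sqr_eucl ler_pXn2r// nnegrE// eucl_ge0. Qed.

(** The mean value inequality for a vector-valued map: the scalar mean value theorem is applied to
    the inner product of [tau] along the segment with w = tau p - tau q, followed by
    Cauchy-Schwarz. *)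
Lemma deformation_lip p q :
  ((tau p).1 - (tau q).1) ^+ 2 + ((tau p).2 - (tau q).2) ^+ 2 <=
      e ^+ 2 * ((p.1 - q.1) ^+ 2 + (p.2 - q.2) ^+ 2).
Proof.
pose w := tau p - tau q; pose h := p - q.
have lin (r k t : R) : is_derive t 1 (fun t => r + t * k) k.
  apply/is_derive_eps => eta eta0; exists 1 => // s _.
  rewrite (_ : r + (t + s) * k - (r + t * k) - k * s = 0); last by ring.
  by rewrite normr0 mulr_ge0// ltW.
pose y (t : R) : R * R := (q.1 + t * h.1, q.2 + t * h.2).
pose g t := w.1 * (tau (y t)).1 + w.2 * (tau (y t)).2.
pose dg t := w.1 * ('d tau (y t) h).1 + w.2 * ('d tau (y t) h).2.
have gdg (t : R) : is_derive t 1 g (dg t).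
  have [g1 g2] := has_grad_diff (dtau (y t)).
  have D1 := @has_grad_comp _ _ _ _ (fun s => q.1 + s * h.1) (fun s => q.2 + s * h.2) t _ _ g1
    (lin q.1 h.1 t) (lin q.2 h.2 t).
  have D2 := @has_grad_comp _ _ _ _ (fun s => q.1 + s * h.1) (fun s => q.2 + s * h.2) t _ _ g2
    (lin q.1 h.1 t) (lin q.2 h.2 t).
  suff -> : dg t = w.1 *: ((A (y t)).1 * h.1 + (B (y t)).1 * h.2) +
                   w.2 *: ((A (y t)).2 * h.1 + (B (y t)).2 * h.2).
    exact: is_deriveD (is_deriveZ w.1 D1) (is_deriveZ w.2 D2).
  rewrite /dg diff_pairE// -/(A _) -/(B _).
  by move: (A (y t)) (B (y t)) => u v; rewrite /= /GRing.scale/=; ring.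
have [t _] := MVT_line gdg ler01.
have y1 : y 1 = p by rewrite /y !mul1r /h /= !subrKC -surjective_pairing.
have y0 : y 0 = q by rewrite /y !mul0r !addr0 -surjective_pairing.
rewrite /g y1 y0 subr0 mulr1 => H.
have wE : eucl w ^+ 2 = dg t by rewrite -H sqr_eucl /w /=; ring.
have cs : dg t <= eucl w * eucl ('d tau (y t) h).
  rewrite -[X in X <= _]/(w.1 * ('d tau (y t) h).1 + w.2 * ('d tau (y t) h).2).
  set z := 'd tau _ _; rewrite /eucl -sqrtrM ?addr_ge0 ?sqr_ge0//.
  apply: le_trans (ler_norm _) _; rewrite -sqrtr_sqr ler_sqrt.
    by have := sqr_ge0 (w.1 * z.2 - w.2 * z.1); lra.
  by rewrite mulr_ge0// addr_ge0// sqr_ge0.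
have wle : eucl w <= e * eucl h.
  have [w0|w0] := leP (eucl w) 0.
    by apply: le_trans w0 _; rewrite mulr_ge0 ?eucl_ge0// ltW.
  rewrite -(ler_pM2l w0) -expr2 wE; apply: le_trans cs _.
  by rewrite ler_pM2l//; exact: deformation_diff_bound.
have eh : 0 <= e * eucl h by rewrite mulr_ge0 ?eucl_ge0// ltW.
have := sqr_bound eh wle.
by rewrite exprMn sqr_eucl.
Qed.

Lemma deformation_contraction : C1_contraction e tau
  (fun p => ('D_((1, 0) : R * R) tau p).1) (fun p => ('D_((0, 1) : R * R) tau p).1)
  (fun p => ('D_((1, 0) : R * R) tau p).2) (fun p => ('D_((0, 1) : R * R) tau p).2).
Proof.
have cD v : continuous (fun p => 'D_v tau p).
  by move=> p; apply: differentiable_continuous; case: tauC2 => _ /(_ v)[].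
split.
- by move=> p; case: (has_grad_diff (dtau p)).
- by move=> p; case: (has_grad_diff (dtau p)).
- split=> p; [
    exact: (continuous_comp (@cD _ p) (@cvg_fst _ _ _ _ _))|
    exact: (continuous_comp (@cD _ p) (@cvg_fst _ _ _ _ _))|
    exact: (continuous_comp (@cD _ p) (@cvg_snd _ _ _ _ _))|
    exact: (continuous_comp (@cD _ p) (@cvg_snd _ _ _ _ _))].
- move=> p; apply: sqr_bound; first exact: ltW.
  by rewrite deriveE//; apply: le_trans (deformation_diff_bound p _) _; rewrite eucl10 mulr1.
- move=> p; apply: sqr_bound; first exact: ltW.
  by rewrite deriveE//; apply: le_trans (deformation_diff_bound p _) _; rewrite eucl01 mulr1.
- exact: deformation_lip.
Qed.

End smooth_deformation.

(** * Networks *)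

Section network.
Context {R : realType}.
Local Notation mR := (measurableTypeR R).
Local Notation P := (mR * mR)%type.
Local Open Scope ereal_scope.

Lemma eq_energy (m : nat) (x y : 'I_m -> P -> R) : (forall i u, x i u = y i u) ->
  energy x = energy y.
Proof. by move=> xy; apply: eq_bigr => i _; apply: eq_integral => u _; rewrite xy. Qed.

Lemma energy0 (m : nat) (x : 'I_m -> P -> R) : (forall i u, x i u = 0%R) -> energy x = 0.
Proof.
move=> x0; rewrite /energy big1// => i _; rewrite integral0_eq// => u _.
by rewrite x0 expr0n.
Qed.

(** The triangle inequality for squared norms, without square roots; the remainder is (p - s q)^2 /
    s. It is sharp when [s] is the ratio of the norms. *)
Lemma energyD_le (m : nat) (f g : 'I_m -> P -> R) (s : R) : (0 < s)%R ->
  (forall i, measurable_fun setT (f i : P -> mR)) ->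
  (forall i, measurable_fun setT (g i : P -> mR)) ->
  energy (fun i u => f i u + g i u)%R <=
  (1 + s^-1)%:E * energy f + (1 + s)%:E * energy g.
Proof.
move=> s0 mf mg.
have k1 : (0 <= 1 + s^-1)%R by rewrite addr_ge0// invr_ge0 ltW.
have k2 : (0 <= 1 + s)%R by rewrite addr_ge0// ltW.
have sqr0 (h : P -> R) u : setT u -> 0 <= (h u ^+ 2)%:E by rewrite lee_fin sqr_ge0.
have msq (h : P -> R) : measurable_fun setT (h : P -> mR) ->
    measurable_fun setT (fun u : P => (h u ^+ 2)%:E).
  by move=> mh; exact: (measurable_EFinP setT _).2 (measurable_funM mh mh).
rewrite /energy !ge0_sume_distrr; last 2 first.
- by move=> i _; apply: integral_ge0; exact: sqr0.
- by move=> i _; apply: integral_ge0; exact: sqr0.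
rewrite -big_split/=; apply: lee_sum => i _.
have mfi := msq _ (mf i); have mgi := msq _ (mg i).
rewrite -!ge0_integralZl_EFin//; [|exact: sqr0|exact: sqr0].
have mF := measurable_funeM (1 + s^-1)%:E mfi; have mG := measurable_funeM (1 + s)%:E mgi.
have F0 u : setT u -> 0 <= (1 + s^-1)%:E * (f i u ^+ 2)%:E.
  by move=> _; rewrite mule_ge0 ?lee_fin ?sqr_ge0.
have G0 u : setT u -> 0 <= (1 + s)%:E * (g i u ^+ 2)%:E.
  by move=> _; rewrite mule_ge0 ?lee_fin ?sqr_ge0.
rewrite -ge0_integralD//; apply: ge0_le_integral => //.
- by move=> u _; rewrite lee_fin sqr_ge0.
- exact: msq (measurable_funD (mf i) (mg i)).
- exact: emeasurable_funD.
move=> u _; rewrite -!EFinM -EFinD lee_fin.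
set p := f i u; set q := g i u.
rewrite (_ : ((1 + s^-1) * p ^+ 2 + (1 + s) * q ^+ 2 = (p + q) ^+ 2 + s^-1 * (p - s * q) ^+ 2)%R).
  by rewrite lerDl mulr_ge0 ?sqr_ge0// invr_ge0 ltW.
by field; rewrite gt_eqF.
Qed.

Context (L : nat) (M : nat -> nat).
Context (W : forall l, 'I_(M l) -> 'I_(M l.+1) -> R * R -> R).
Context (dW : forall l, 'I_(M l) -> 'I_(M l.+1) -> R * R -> R * R).
Context (b : forall l, 'I_(M l.+1) -> R) (sigma : R -> R).
Hypothesis hM : forall l, (l <= L)%N -> (0 < M l)%N.
Hypothesis hW : forall l, (l < L)%N -> forall lam' lam,
     cnn_filter (@W l lam' lam) (@dW l lam' lam).
Hypothesis hsigma : forall s t, (`|sigma s - sigma t| <= `|s - t|)%R.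
Hypothesis hB : forall l, (l < L)%N -> Bconst (@W l) < 1.
Hypothesis hC : forall l, (l < L)%N -> Cconst (@dW l) < 1.

(* The output of the network for the input [0], which is constant on the plane. *)
Fixpoint resting_value (l : nat) : 'I_(M l) -> R :=
  match l with
  | 0 => fun _ => 0%R
  | l'.+1 => layer_cst sigma (@W l') (@b l') (@resting_value l')
  end.
Arguments resting_value : clear implicits.

Let iW l : (l < L)%N -> forall i j, (leb2 R).-integrable setT (EFin \o @W l i j).
Proof. by move=> lL i j; case: (hW lL i j). Qed.

Lemma cnn_L2_offset (x0 : 'I_(M 0%N) -> P -> R) : (forall i, L2_offset (x0 i) 0%R) ->
  forall l, (l <= L)%N -> forall i, L2_offset (cnn sigma W b l x0 i) (resting_value l i).
Proof.
move=> Lx0; elim=> [//|l IH] lL.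
exact: (L2_offset_layer hsigma (@b l) (hM (ltnW lL)) (hM lL) (iW lL) (hB lL) (IH (ltnW lL))).
Qed.

Let ratioM l : (l < L)%N ->
  ((M l.+1)%:R / (M l)%:R * ((M l)%:R / (M 0%N)%:R) = (M l.+1)%:R / (M 0%N)%:R :> R)%R.
Proof.
by move=> lL; have Ml := hM (ltnW lL); field; rewrite !pnatr_eq0 -!lt0n Ml hM.
Qed.

(** The ratios n/m of [layer_nonexpansive] telescope. *)
Lemma cnn_energy (x0 : 'I_(M 0%N) -> P -> R) : (forall i, L2_offset (x0 i) 0%R) ->
  forall l, (l <= L)%N ->
  energy (fun i u => cnn sigma W b l x0 i u - resting_value l i)%R <=
  ((M l)%:R / (M 0%N)%:R)%:E * energy x0.
Proof.
move=> Lx0; elim=> [|l IH] lL.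
  rewrite divff ?pnatr_eq0 -?lt0n ?hM// mul1e le_eqVlt; apply/orP; left; apply/eqP.
  by apply: eq_energy => i u; rewrite subr0.
have LX := cnn_L2_offset Lx0 (ltnW lL).
have := layer_nonexpansive hsigma (@b l) (hM (ltnW lL)) (hM lL) (iW lL) (hB lL) LX
  (fun i => L2_offset_cst (resting_value l i)).
rewrite (@eq_energy _ _ (fun i u => cnn sigma W b l.+1 x0 i u - resting_value l.+1 i)%R); last first.
  move=> i u; congr (_ - _)%R; exact: layer_cstE (iW lL) _ _ _.
move=> /le_trans; apply; rewrite -ratioM// [X in _ <= X * _]EFinM -muleA.
by apply: lee_wpmul2l; [rewrite lee_fin divr_ge0|exact: IH (ltnW lL)].
Qed.

Context (e : R) (tau : R * R -> R * R) (c1 c2 c3 c4 : R * R -> R).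
Hypotheses (e0 : (0 < e)%R) (e5 : (5 * e < 1)%R) (tauC : C1_contraction e tau c1 c2 c3 c4).

(* In the sum [7 l + 1/2] the term [1/2] makes the weight [7 / (7 l + 1/2)] used in *)
(* [energyD_le] finite at [l = 0]; it is absorbed by the constant [8] when [1 <= L].   *)
Lemma cnn_deform_energy (x0 : 'I_(M 0%N) -> P -> R) : (forall i, L2_offset (x0 i) 0%R) ->
  forall l, (l <= L)%N ->
  energy (fun i u => deform tau (cnn sigma W b l x0) i u - cnn sigma W b l (deform tau x0) i u)%R <=
  ((M l)%:R / (M 0%N)%:R * ((7 * l%:R + 2^-1) * e) ^+ 2)%:E * energy x0.
Proof.
move=> Lx0.
have Lxd0 i : L2_offset (deform tau x0 i) 0%R by exact: (L2_offset_deform e0 e5 tauC (Lx0 i)).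
elim=> [|l IH] lL.
  rewrite energy0 => [|i u]; last by rewrite /= subrr.
  by rewrite mule_ge0 ?energy_ge0// lee_fin mulr_ge0 ?sqr_ge0// divr_ge0.
have m0 := hM (ltnW lL); have n0 := hM lL.
have LX := cnn_L2_offset Lx0 (ltnW lL).
have LXD i : L2_offset (deform tau (cnn sigma W b l x0) i) (resting_value l i).
  exact: (L2_offset_deform e0 e5 tauC (LX i)).
have LXd := cnn_L2_offset Lxd0 (ltnW lL).
set x := cnn sigma W b l x0 in LX LXD IH *.
set xd := cnn sigma W b l (deform tau x0) in LXd IH *.
have mlay y : (forall i, L2_offset (y i) (resting_value l i)) -> forall j,
    measurable_fun setT (layer sigma (@W l) (@b l) y j : P -> mR).
  by move=> Ly; apply: (measurable_layer hsigma (@b l) (iW lL)) => i; case: (Ly i).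
(* [f] is the commutator of the last layer with the deformation; [g] is the error of the previous
   layers, passed through the last layer. *)
pose f j u := (layer sigma (@W l) (@b l) x j (u - tau u) -
  layer sigma (@W l) (@b l) (deform tau x) j u)%R.
pose g j u := (layer sigma (@W l) (@b l) (deform tau x) j u - layer sigma (@W l) (@b l) xd j u)%R.
have mf j : measurable_fun setT (f j : P -> mR).
  exact: (measurable_funB (measurableT_comp (mlay x LX j) (measurable_deformation e0 tauC)) (mlay _ LXD j)).
have mg j : measurable_fun setT (g j : P -> mR).
  exact: (measurable_funB (mlay _ LXD j) (mlay _ LXd j)).
pose al : R := (7 * l%:R + 2^-1)%R.
have al0 : (0 < al)%R by rewrite /al ltr_wpDl// mulr_ge0.
have s0 : (0 < 7 / al)%R by rewrite divr_gt0.
rewrite (@eq_energy _ _ (fun j u => f j u + g j u)%R); last first.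
  by move=> j u; rewrite /f /g addrA subrK.
apply: (le_trans (energyD_le s0 mf mg)).
have Ef : energy f <= ((M l.+1)%:R / (M 0%N)%:R * (7 * e) ^+ 2)%:E * energy x0.
  have := layer_deform_error e0 e5 tauC (@b l) hsigma m0 n0 (hW lL) (hB lL) (hC lL) LX.
  move=> /le_trans; apply.
  rewrite -ratioM// [X in _ <= X%:E * _](_ : _ = (M l.+1)%:R / (M l)%:R * (7 * e) ^+ 2 * ((M l)%:R / (M 0%N)%:R))%R;
    last by ring.
  rewrite [X in _ <= X * _]EFinM -muleA; apply: lee_wpmul2l.
    by rewrite lee_fin mulr_ge0 ?sqr_ge0// divr_ge0.
  exact: (cnn_energy Lx0 (ltnW lL)).
have Eg : energy g <= ((M l.+1)%:R / (M 0%N)%:R * (al * e) ^+ 2)%:E * energy x0.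
  have := layer_nonexpansive hsigma (@b l) m0 n0 (iW lL) (hB lL) LXD LXd.
  move=> /le_trans; apply; rewrite -ratioM// -mulrA [X in _ <= X * _]EFinM -muleA.
  by apply: lee_wpmul2l; [rewrite lee_fin divr_ge0|exact: IH (ltnW lL)].
apply: (le_trans (leeD (lee_wpmul2l _ Ef) (lee_wpmul2l _ Eg))).
- by rewrite lee_fin addr_ge0// invr_ge0 ltW.
- by rewrite lee_fin addr_ge0// ltW.
have E0 := energy_ge0 x0.
rewrite !muleA -!EFinM -ge0_muleDl ?lee_fin; last 2 first.
- by rewrite !mulr_ge0// ?addr_ge0// ?invr_ge0 ?ltW// exprn_ge0// mulr_ge0 ltW.
- by rewrite !mulr_ge0// ?addr_ge0// ?invr_ge0 ?ltW// exprn_ge0// mulr_ge0 ltW.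
rewrite -EFinD le_eqVlt; apply/orP; left; apply/eqP; congr (_%:E * _).
(* For s = 7 / al, (1 + 1/s) 7^2 + (1 + s) al^2 = (al + 7)^2. *)
rewrite (_ : 7 * l.+1%:R + 2^-1 = al + 7)%R; last by rewrite /al -natr1; ring.
have M00 : ((M 0%N)%:R != 0 :> R)%R by rewrite pnatr_eq0 -lt0n hM.
have aln0 : (al != 0)%R by rewrite gt_eqF.
by field; rewrite ?M00 ?aln0.
Qed.

End network.

Lemma chan_normE (R : realType) (J : R) (m : nat) (x : 'I_m -> R * R -> R) :
  chan_norm J x = sqrte ((m%:R^-1 * ((2 * 2 `^ J) ^+ 2)^-1)%:E * energy x)%E.
Proof.
rewrite /chan_norm /energy EFinM -muleA [X in _ = sqrte (_ * X)%E]ge0_sume_distrr; last first.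
  by move=> i _; apply: integral_ge0 => u _; rewrite lee_fin sqr_ge0.
congr (sqrte (_ * _)%E); apply: eq_bigr => i _; congr (_ * _)%E.
by apply: eq_integral => u _; rewrite real_normK ?num_real.
Qed.

Lemma grad_sup_ge0 (R : realType) (tau : R * R -> R * R) : (0 <= grad_sup tau)%E.
Proof.
have e00 : eucl (0 : R * R) = 0 by rewrite /eucl /= expr0n addr0 sqrtr0.
apply: (@le_trans _ _ (op_norm ('d tau 0))); last first.
  by apply: ereal_sup_ubound; exists 0.
apply: ereal_sup_ubound; exists 0; first by rewrite /= e00.
by rewrite linear0 e00.
Qed.

Lemma Lfun2_L2_offset (R : realType) (f : R * R -> R) :
  f \in Lfun (leb2 R) 2%:E -> L2_offset f 0.
Proof.
move=> Lf; split.
  by have := sub_Lfun_mfun Lf; rewrite inE.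
under eq_integral do rewrite subr0.
have /integrableP[_] := Lfun2_integrable_sqr Lf.
by under eq_integral => u _ do rewrite /= ger0_norm ?sqr_ge0//.
Qed.

Theorem proposition3p3 (R : realType) (J : R) (L : nat) (M : nat -> nat)
  (W : forall l, 'I_(M l) -> 'I_(M l.+1) -> R * R -> R)
  (dW : forall l, 'I_(M l) -> 'I_(M l.+1) -> R * R -> R * R)
  (b : forall l, 'I_(M l.+1) -> R)
  (sigma : R -> R) (tau : R * R -> R * R) (x0 : 'I_(M 0%N) -> R * R -> R)
  (hM : forall l, (l <= L)%N -> (0 < M l)%N)
  (hW : forall l, (l < L)%N -> forall lam' lam,
     cnn_filter (@W l lam' lam) (@dW l lam' lam))
  (hx0 : forall lam, x0 lam \in Lfun (leb2 R) 2%:E)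
  (htau : Ck 2 tau)
  (htau5 : (grad_sup tau < (5^-1)%:E)%E)
  (hsigma : forall s t, `|sigma s - sigma t| <= `|s - t|)
  (hB : forall l, (l < L)%N -> (Bconst (@W l) < 1)%E)
  (hC : forall l, (l < L)%N -> (Cconst (@dW l) < 1)%E) :
  (chan_norm J (fun lam u => (deform tau (cnn sigma W b L x0) lam u
                             - cnn sigma W b L (deform tau x0) lam u)%R)
   <= (8 * L%:R)%:E * grad_sup tau * chan_norm J x0)%E.
Proof.
have g0 := grad_sup_ge0 tau.
have gfin : (grad_sup tau \is a fin_num)%E by rewrite ge0_fin_numE// (lt_trans htau5)// ltey.
pose G := fine (grad_sup tau).
have gE : grad_sup tau = G%:E by rewrite /G fineK.
move: g0 htau5; rewrite gE lee_fin lte_fin => G0 G5.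
have Lx0 i : L2_offset (x0 i) 0 by exact: Lfun2_L2_offset.
set X := energy (fun lam u => deform tau (cnn sigma W b L x0) lam u -
  cnn sigma W b L (deform tau x0) lam u).
have X0 : (0 <= X)%E by exact: energy_ge0.
have E0 : (0 <= energy x0)%E by exact: energy_ge0.
have Efin : energy x0 \is a fin_num.
  rewrite ge0_fin_numE//; apply: lte_sum_pinfty => i _.
  by case: (Lx0 i) => _; under eq_integral do rewrite subr0.
(* The estimates need a positive bound, whereas [G] may be 0; so [e] is kept free above [G]. *)
have key (e : R) : 0 < e -> 5 * e < 1 -> G <= e ->
    (X <= ((M L)%:R / (M 0%N)%:R * ((7 * L%:R + 2^-1) * e) ^+ 2)%:E * energy x0)%E.
  move=> e0 e5 Ge.
  have taue : (grad_sup tau <= e%:E)%E by rewrite gE lee_fin.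
  have tauC := deformation_contraction htau e0 taue.
  exact: (@cnn_deform_energy R L M W dW b sigma hM hW hsigma hB hC e tau _ _ _ _ e0 e5 tauC x0 Lx0 L (leqnn L)).
have XL : (X <= ((M L)%:R / (M 0%N)%:R * (8 * L%:R * G) ^+ 2)%:E * energy x0)%E.
  (* For [L = 0] the term 1/2 cannot be absorbed, but the two outputs coincide. *)
  have [L0|Lpos] := posnP L.
    rewrite /X; move: X X0 key; rewrite L0 => _ _ _.
    rewrite energy0 => [|i u]; last by rewrite /= subrr.
    by rewrite mule_ge0// lee_fin mulr_ge0 ?sqr_ge0// divr_ge0.
  have L1 : 1 <= L%:R :> R by rewrite ler1n.
  have [Gpos|Gn] := ltP 0 G.
    have := key G Gpos _ (lexx G) => /(_ _)/le_trans; apply; first lra.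
    apply: lee_wpmul2r => //; rewrite lee_fin ler_wpM2l ?divr_ge0//.
    rewrite ler_pXn2r ?nnegrE ?mulr_ge0// ?addr_ge0 ?mulr_ge0//.
    by rewrite ler_wpM2r//; lra.
  (* With zero gradient the bound C e^2 holds for every small positive [e]; the choice below brings
     it under an arbitrary [eta]. *)
  have {Gn} GE : G = 0 by apply/eqP; rewrite eq_le Gn.
  rewrite GE mulr0 expr0n mulr0 mul0e.
  move: key; rewrite -(fineK Efin); set E := fine _ => key.
  have EE : 0 <= E by rewrite fine_ge0.
  pose C : R := (M L)%:R / (M 0%N)%:R * (7 * L%:R + 2^-1) ^+ 2 * E.
  have C0 : 0 <= C by rewrite !mulr_ge0// ?divr_ge0// sqr_ge0.
  apply/lee_addgt0Pr => eta eta0; rewrite add0e.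
  pose e := Num.min 10^-1 (eta / (C + 1)).
  have e0 : 0 < e by rewrite lt_min divr_gt0// ?ltr_wpDl// invr_gt0 ltr0n.
  have e10 : e <= 10^-1 by rewrite ge_min lexx.
  have eC : e * (C + 1) <= eta.
    by rewrite -ler_pdivlMr ?ltr_wpDl// ge_min lexx orbT.
  have e5 : 5 * e < 1 by lra.
  apply: (le_trans (key e e0 e5 _)); first by rewrite GE ltW.
  rewrite -EFinM lee_fin (_ : _ * E = C * e ^+ 2); last by rewrite /C; ring.
  by nra.
rewrite !chan_normE -/X.
have M0 l : (l <= L)%N -> 0 < (M l)%:R :> R by move=> lL; rewrite ltr0n hM.
set om := ((2 * 2 `^ J) ^+ 2)^-1.
have om0 : 0 <= om by rewrite invr_ge0 sqr_ge0.
have c0 l : 0 <= (M l)%:R^-1 * om by rewrite mulr_ge0// invr_ge0.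
have r0 : 0 <= 8 * L%:R * G by rewrite !mulr_ge0.
(* The ratio of channel numbers turns the normalization of the output into that of the input. *)
apply: (@le_trans _ _ (sqrte (((8 * L%:R * G) ^+ 2)%:E * (((M 0%N)%:R^-1 * om)%:E * energy x0)))%E).
  rewrite lee_sqrt; last by rewrite !mule_ge0// lee_fin ?sqr_ge0.
  apply: (le_trans (lee_wpmul2l _ XL)); first by rewrite lee_fin.
  rewrite !muleA -!EFinM le_eqVlt; apply/orP; left; apply/eqP; congr (_%:E * _)%E.
  by field; rewrite !gt_eqF ?M0.
rewrite sqrteM ?lee_fin ?sqr_ge0// EFin_expe sqrte_sqr gee0_abs ?lee_fin//.
Qed.
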